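(* Let $\mathfrak{F}$ be a non-archimedean local field (of characteristic zero or positive characteristic), let $\mathbf{G}$ be a non-trivial connected reductive group defined over $\mathfrak{F}$, and let $G=\mathbf{G}(\mathfrak{F})$ with its natural locally profinite topology. Then $(G,K)$ is fair for every compact open subgroup $K\subset G$.
   Context: Definition (fair): Let $G$ be a locally profinite group and $K\subset G$ a profinite (i.e. compact) open subgroup. The pair $(G,K)$ is fair if for every open subgroup $H\subset K$ there is an open subgroup $H'\subset K$ such that for all $g\in G$ one has a strict inclusion $K\cap gH'g^{-1}\subsetneq K\cap gHg^{-1}$. *)

(* Defs.v *)
From HB Require Import structures.
From mathcomp Require Import all_boot all_order all_algebra.
From mathcomp Require Import all_classical all_reals all_analysis.
From mathcomp Require Import -(notations) mpoly.

Set Implicit Arguments.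
Unset Strict Implicit.
Unset Printing Implicit Defensive.

Import Order.TTheory GRing.Theory Num.Theory.

Local Open Scope classical_set_scope.
Local Open Scope ring_scope.

(* A non-archimedean local field is a field that is locally compact for the
   topology of a nontrivial ultrametric absolute value; equivalently, a complete
   discretely valued field with finite residue field. No assumption is made on
   the characteristic. *)
HB.mixin Record isNonArchLocalField (R : realType) F
    & GRing.Field F & Topological F := {
  absv : F -> R ;
  absv_ge0 : forall x, 0 <= absv x ;
  absv_eq0 : forall x, absv x = 0 <-> x = 0 ;
  absvM : forall x y, absv (x * y) = absv x * absv y ;
  absvD : forall x y, absv (x + y) <= Num.max (absv x) (absv y) ;
  absv_nontrivial : exists x, x != 0 /\ absv x != 1 ;
  absv_nbhs : forall x : F, nbhs x =
    filter_from [set e : R | 0 < e] (fun e => [set y | absv (x - y) < e]) ;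
  lfield_locally_compact : locally_compact [set: F]
}.

#[short(type="nonArchLocalFieldType")]
HB.structure Definition NonArchLocalField (R : realType) :=
  { F of isNonArchLocalField R F & GRing.Field F & Topological F }.

HB.mixin Record isTopologicalGroup G & Group G & Topological G := {
  mulg_continuous : continuous (fun xy : G * G => (xy.1 * xy.2)%g) ;
  invg_continuous : continuous (fun x : G => x^-1%g)
}.

#[short(type="topologicalGroupType")]
HB.structure Definition TopologicalGroup :=
  { G of isTopologicalGroup G & Group G & Topological G }.

Section Fair.
Local Open Scope group_scope.
Variable G : topologicalGroupType.
Implicit Types (K H : set G) (g : G).

Definition is_subgroup H :=
  [/\ H 1, forall x y, H x -> H y -> H (x * y) & forall x, H x -> H x^-1].

Definition open_subgroup H := open H /\ is_subgroup H.

Definition conj_set g H := [set g * h * g^-1 | h in H].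

(* Meant for G locally profinite and K a compact open subgroup of G. Recall that
   `<` is strict inclusion. *)
Definition fair K :=
  forall H, open_subgroup H -> H `<=` K ->
  exists H', [/\ open_subgroup H', H' `<=` K &
    forall g, K `&` conj_set g H' `<` K `&` conj_set g H].

End Fair.

(* Linear algebraic groups are taken in the classical sense: Zariski closed
   subgroups of GL_n(L), where L is algebraically closed, identified with their
   sets of L-points. *)
Section LinearGroups.
Variables (L : closedFieldType) (n : nat).
Implicit Types (X U : set 'M[L]_n) (p : mpoly (n * n) L).

Definition mxeval p (A : 'M[L]_n) : L := meval (mxvec A 0) p.

(* Closed subsets of GL_n(L). Polynomials in the matrix entries suffice, as the
   powers of 1/det in a regular function on GL_n can be cleared. *)
Definition zariski_closed X := exists S : set (mpoly (n * n) L),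
  X = [set A | A \in unitmx /\ forall p, S p -> mxeval p A = 0].

Definition zariski_connected X := forall A B,
  zariski_closed A -> zariski_closed B -> A `|` B = X -> A `&` B = set0 ->
  A = set0 \/ B = set0.

Definition is_mxsubgroup X := [/\ X `<=` [set A | A \in unitmx], X 1%:M,
  forall A B, X A -> X B -> X (A *m B) & forall A, X A -> X (invmx A)].

Definition unipotent (A : 'M[L]_n) := exists k, (A - 1%:M) ^+ k = 0.

Definition mxnormal U X :=
  U `<=` X /\ forall A B, X A -> U B -> U (A *m B *m invmx A).

(* The largest connected normal unipotent closed subgroup of X: the family below
   is directed and its union is one of its members when X is a closed subgroup
   of GL_n(L). *)
Definition unipotent_radical X := \bigcup_(U in
  [set U | [/\ is_mxsubgroup U, zariski_closed U, zariski_connected U,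
     mxnormal U X & U `<=` unipotent]]) U.

Definition reductive X := unipotent_radical X = [set 1%:M].

Definition vanishing_ideal X : set (mpoly (n * n) L) :=
  [set p | forall A, X A -> mxeval p A = 0].

(* X is defined over F (and not merely F-closed): its vanishing ideal is
   generated by polynomials with coefficients in F. *)
Definition defined_over (F : fieldType) (iota : {rmorphism F -> L}) X :=
  forall p, vanishing_ideal X p ->
  exists s : seq (mpoly (n * n) L * mpoly (n * n) F),
    (forall cq, cq \in s -> vanishing_ideal X (map_mpoly iota cq.2)) /\
    p = \sum_(cq <- s) cq.1 * map_mpoly iota cq.2.

End LinearGroups.

Record linearGroup (F : fieldType) (L : closedFieldType)
    (iota : {rmorphism F -> L}) (n : nat) := LinearGroup {
  geometric_points :> set 'M[L]_n ;
  linearGroup_subgroup : is_mxsubgroup geometric_points ;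
  linearGroup_closed : zariski_closed geometric_points ;
  linearGroup_defined_over : defined_over iota geometric_points
}.

Definition rational_set (F : fieldType) (L : closedFieldType)
    (iota : {rmorphism F -> L}) (n : nat) (G : linearGroup iota n) :
    set 'M[F]_n :=
  [set A | geometric_points G (map_mx iota A)].

Definition rational_points F L iota n G : Type :=
  set_type (@rational_set F L iota n G).

Section RationalPointsGroup.
Variables (F : fieldType) (L : closedFieldType) (iota : {rmorphism F -> L}).
Variables (n : nat) (G : linearGroup iota n).
Local Notation GF := (rational_points G).

HB.instance Definition _ := SubType.on GF.
HB.instance Definition _ := Choice.on GF.

Lemma rationalP (x : GF) : rational_set G (val x).
Proof. by case: x => A /= /set_mem. Qed.

Lemma rational_unit (x : GF) : val x \in unitmx.
Proof.
have := rationalP x; rewrite /rational_set /=.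
by case: (linearGroup_subgroup G) => + _ _ _ => /[apply] /=; rewrite map_unitmx.
Qed.

Definition rational_one : GF.
Proof.
exists 1%:M; apply/mem_set; rewrite /rational_set /= map_mx1.
by case: (linearGroup_subgroup G).
Defined.

Definition rational_mul (x y : GF) : GF.
Proof.
exists (val x *m val y); apply/mem_set; rewrite /rational_set /= map_mxM.
by case: (linearGroup_subgroup G) => _ _ + _; apply; apply: rationalP.
Defined.

Definition rational_inv (x : GF) : GF.
Proof.
exists (invmx (val x)); apply/mem_set; rewrite /rational_set /= map_invmx.
by case: (linearGroup_subgroup G) => _ _ _; apply; apply: rationalP.
Defined.

Lemma rational_mulA : associative rational_mul.
Proof. by move=> x y z; apply: val_inj; rewrite /= mulmxA. Qed.
Lemma rational_mul1 : left_id rational_one rational_mul.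
Proof. by move=> x; apply: val_inj; rewrite /= mul1mx. Qed.
Lemma rational_1mul : right_id rational_one rational_mul.
Proof. by move=> x; apply: val_inj; rewrite /= mulmx1. Qed.
Lemma rational_mulV : left_inverse rational_one rational_inv rational_mul.
Proof. by move=> x; apply: val_inj; rewrite /= mulVmx ?rational_unit. Qed.
Lemma rational_mulVr : right_inverse rational_one rational_inv rational_mul.
Proof. by move=> x; apply: val_inj; rewrite /= mulmxV ?rational_unit. Qed.

HB.instance Definition _ := isGroup.Build GF rational_mulA rational_mul1
  rational_1mul rational_mulV rational_mulVr.
End RationalPointsGroup.

Lemma continuous_for_ext (T U : topologicalType) (f g : T -> U) (z : T) :
  g =1 f -> {for z, continuous f} -> {for z, continuous g}.
Proof. by move=> /funext ->. Qed.

Section LocalFieldTopology.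
Variables (R : realType) (F : nonArchLocalFieldType R).
Implicit Types (x y : F).

Lemma absv1 : absv (1 : F) = 1.
Proof.
have n0 : absv (1 : F) != 0 by apply/eqP => /absv_eq0/eqP; rewrite oner_eq0.
by apply: (mulfI n0); rewrite mulr1 -absvM mulr1.
Qed.

Lemma absvN x : absv (- x) = absv x.
Proof.
suff h : absv (-1 : F) = 1 by rewrite -mulN1r absvM h mul1r.
have /eqP : absv (-1 : F) ^+ 2 = 1 by rewrite expr2 -absvM mulrNN mulr1 absv1.
rewrite sqrf_eq1 => /orP[/eqP//|/eqP h].
by have := absv_ge0 (-1 : F); rewrite h oppr_ge0 ler10.
Qed.

Lemma absvV x : x != 0 -> absv x^-1 = (absv x)^-1.
Proof.
move=> x0; have ax0 : absv x != 0 by apply/eqP => /absv_eq0/eqP; apply/negP.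
by apply: (mulfI ax0); rewrite -absvM !divff// absv1.
Qed.

Lemma cvg_absvP (T : topologicalType) (f : T -> F) (z : T) :
  {for z, continuous f} <->
  forall e : R, 0 < e -> \forall t \near z, absv (f z - f t) < e.
Proof.
split=> [fz e e0|h A].
  apply: (fz [set y | absv (f z - y) < e]); rewrite absv_nbhs.
  by exists e.
rewrite absv_nbhs => -[e /= e0 eA].
by apply: filterS (h e e0) => t; exact: eA.
Qed.

Lemma continuousD_lfield (T : topologicalType) (f g : T -> F) (z : T) :
  {for z, continuous f} -> {for z, continuous g} ->
  {for z, continuous (fun t => f t + g t)}.
Proof.
move=> /cvg_absvP fz /cvg_absvP gz; apply/cvg_absvP => e e0.
near=> t; rewrite opprD addrACA; apply: le_lt_trans (absvD _ _) _.
by rewrite gt_max; apply/andP; split; near: t; [exact: fz|exact: gz].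
Unshelve. all: by end_near. Qed.

Lemma continuousM_lfield (T : topologicalType) (f g : T -> F) (z : T) :
  {for z, continuous f} -> {for z, continuous g} ->
  {for z, continuous (fun t => f t * g t)}.
Proof.
move=> /cvg_absvP fz /cvg_absvP gz; apply/cvg_absvP => e e0.
pose M := 1 + absv (f z) + absv (g z).
have M1 : 1 <= M by rewrite /M -addrA lerDl addr_ge0 ?absv_ge0.
have M0 : 0 < M by apply: lt_le_trans M1.
have eM : 0 < e / M by rewrite divr_gt0.
near=> t.
have -> : f z * g z - f t * g t = f z * (g z - g t) + (f z - f t) * g t.
  by rewrite mulrBr mulrBl addrA subrK.
apply: le_lt_trans (absvD _ _) _; rewrite !absvM gt_max; apply/andP; split.
  apply: (@le_lt_trans _ _ (M * absv (g z - g t))).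
    by rewrite ler_wpM2r ?absv_ge0// /M addrAC lerDr addr_ge0 ?absv_ge0.
  rewrite mulrC -ltr_pdivlMr//; near: t; exact: gz.
have gt : absv (g t) <= M.
  have -> : g t = g z + - (g z - g t) by rewrite opprB addrC subrK.
  apply: le_trans (absvD _ _) _; rewrite absvN ge_max /M lerDr.
  rewrite addr_ge0 ?absv_ge0//= -addrA.
  apply: ltW; apply: (@lt_le_trans _ _ 1); last first.
    by rewrite lerDl addr_ge0 ?absv_ge0.
  by near: t; exact: gz.
apply: le_lt_trans (_ : absv (f z - f t) * M < e).
  by rewrite ler_wpM2l ?absv_ge0.
by rewrite -ltr_pdivlMr//; near: t; exact: fz.
Unshelve. all: by end_near. Qed.

Lemma continuousV_lfield (T : topologicalType) (f : T -> F) (z : T) :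
  f z != 0 -> {for z, continuous f} -> {for z, continuous (fun t => (f t)^-1)}.
Proof.
move=> fz0 /cvg_absvP fz; apply/cvg_absvP => e e0.
have a0 : 0 < absv (f z).
  by rewrite lt_neqAle absv_ge0 andbT eq_sym; apply/eqP => /absv_eq0/eqP; apply/negP.
near=> t.
have ft : absv (f z) <= absv (f t).
  have h : absv (f z - f t) < absv (f z) by near: t; exact: fz.
  have := absvD (f z - f t) (f t); rewrite subrK le_max => /orP[|//].
  by rewrite leNgt h.
have ft0 : f t != 0.
  by apply/eqP => /absv_eq0 h; move: ft; rewrite h leNgt a0.
have -> : (f z)^-1 - (f t)^-1 = - ((f z - f t) * ((f z)^-1 * (f t)^-1)).
  rewrite mulrBl mulrA divff// mul1r mulrCA divff// mulr1 opprB; first by [].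
rewrite absvN absvM.
rewrite absvM !absvV// -invfM ltr_pdivrMr ?mulr_gt0//; last exact: lt_le_trans ft.
apply: (@lt_le_trans _ _ (e * (absv (f z) * absv (f z)))).
  by near: t; apply: fz; rewrite !mulr_gt0.
by rewrite ler_pM2l// ler_pM2l.
Unshelve. all: by end_near. Qed.

Lemma continuous_sum_lfield (T : topologicalType) I (r : seq I) (P : pred I)
    (f : I -> T -> F) (z : T) :
  (forall i, {for z, continuous (f i)}) ->
  {for z, continuous (fun t => \sum_(i <- r | P i) f i t)}.
Proof.
move=> fz; elim: r => [|i r ih].
  apply: (@continuous_for_ext _ _ (fun=> 0)); last exact: cst_continuous.
  by move=> t; rewrite big_nil.
apply: (@continuous_for_ext _ _ (fun t => if P i
    then f i t + \sum_(i <- r | P i) f i t else \sum_(i <- r | P i) f i t)).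
  by move=> t; rewrite big_cons.
by case: (P i) => //; apply: continuousD_lfield.
Qed.

Lemma continuous_prod_lfield (T : topologicalType) I (r : seq I) (P : pred I)
    (f : I -> T -> F) (z : T) :
  (forall i, {for z, continuous (f i)}) ->
  {for z, continuous (fun t => \prod_(i <- r | P i) f i t)}.
Proof.
move=> fz; elim: r => [|i r ih].
  apply: (@continuous_for_ext _ _ (fun=> 1)); last exact: cst_continuous.
  by move=> t; rewrite big_nil.
apply: (@continuous_for_ext _ _ (fun t => if P i
    then f i t * \prod_(i <- r | P i) f i t else \prod_(i <- r | P i) f i t)).
  by move=> t; rewrite big_cons.
by case: (P i) => //; apply: continuousM_lfield.
Qed.

Lemma continuous_det_lfield (T : topologicalType) n (f : T -> 'M[F]_n) (z : T) :
  (forall i j, {for z, continuous (fun t => f t i j)}) ->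
  {for z, continuous (fun t => \det (f t))}.
Proof.
move=> fz; apply: continuous_sum_lfield => s.
by apply: continuousM_lfield; [exact: cst_continuous|
  exact: continuous_prod_lfield].
Qed.

Lemma continuous_mx_entry (T U : topologicalType) n (f : T -> 'M[U]_n) (z : T) :
  {for z, continuous f} <-> forall i j, {for z, continuous (fun t => f t i j)}.
Proof.
split=> [fz i j A Az|fz A [P PA PAA]].
  apply: (fz [set B : 'M[U]_n | A (B i j)]); exists (fun i' j' => if (i' == i) && (j' == j) then A else setT).
    move=> i' j'; case: ifP => [/andP[/eqP-> /eqP->]//|_]; exact: filterT.
  by move=> B /(_ i j); rewrite !eqxx.
suff : \forall t \near z, forall ij : 'I_n * 'I_n, P ij.1 ij.2 (f t ij.1 ij.2).
  by apply: filterS => t h; apply: PAA => i j; exact: (h (i, j)).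
by apply: filter_forall => -[i j]; exact: fz (PA i j).
Qed.

End LocalFieldTopology.

Section RationalPointsTopology.
Variables (R : realType) (F : nonArchLocalFieldType R) (L : closedFieldType).
Variables (iota : {rmorphism F -> L}) (n : nat) (G : linearGroup iota n).
Local Notation GF := (rational_points G).

(* The natural topology of G(F): induced from 'M[F]_n, with the product topology.
   As inversion is continuous on GL_n(F), this is also the topology induced from
   the closed embedding g |-> (g, g^-1) in 'M[F]_n * 'M[F]_n. *)
HB.instance Definition _ := Topological.copy GF (set_type (rational_set G)).

Lemma rational_continuous (T : topologicalType) (f : T -> GF) :
  (forall z i j, {for z, continuous (fun t => val (f t) i j)}) -> continuous f.
Proof.
move=> fz; apply: continuous_comp_initial => z.
by apply/continuous_mx_entry => i j; exact: fz.
Qed.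

Lemma rational_entry_continuous (z : GF) i j :
  {for z, continuous (fun x : GF => val x i j)}.
Proof.
move: i j; apply/continuous_mx_entry.
exact: (@initial_continuous GF _ (val : GF -> 'M[F]_n)).
Qed.

Lemma rational_mul_continuous :
  continuous (fun xy : GF * GF => (xy.1 * xy.2)%g).
Proof.
apply: rational_continuous => z i j.
apply: (@continuous_for_ext _ _ (fun xy : GF * GF =>
    \sum_k val xy.1 i k * val xy.2 k j)) => [xy|]; first by rewrite /= mxE.
apply: continuous_sum_lfield => k; apply: continuousM_lfield.
  apply: (@continuous_comp _ _ _ fst (fun x : GF => val x i k)).
    exact: cvg_fst.
  exact: rational_entry_continuous.
apply: (@continuous_comp _ _ _ snd (fun x : GF => val x k j)).
  exact: cvg_snd.
exact: rational_entry_continuous.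
Qed.

Lemma rational_inv_continuous : continuous (fun x : GF => x^-1%g).
Proof.
apply: rational_continuous => z i j.
apply: (@continuous_for_ext _ _ (fun x : GF => (\det (val x))^-1 *
    ((-1) ^+ (j + i) * \det (row' j (col' i (val x)))))) => [x|].
  by rewrite /= /invmx rational_unit !mxE.
have entry i' j' : {for z, continuous (fun x : GF => val x i' j')}.
  exact: rational_entry_continuous.
apply: continuousM_lfield.
  apply: continuousV_lfield; last by apply: continuous_det_lfield; exact: entry.
  by have := rational_unit z; rewrite unitmxE unitfE.
apply: continuousM_lfield; first exact: cst_continuous.
apply: continuous_det_lfield => i' j'.
apply: continuous_for_ext (entry (lift j i') (lift i j')) => x.
by rewrite !mxE.
Qed.

HB.instance Definition _ :=
  isTopologicalGroup.Build GF rational_mul_continuous rational_inv_continuous.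

End RationalPointsTopology.

(* Main.v *)
(** If (G, K) is not fair, there are r > 0 and, for every e > 0, an element g of
    G(F) such that every h in G(F) with h and g h g^-1 both r-close to 1 is
    e-close to 1. Consider an analytic curve psi in G(F) with psi(0) = 1, and
    conjugate it by g^-1. The span of the Taylor coefficients of psi is finite
    dimensional, so that a bound for a linear functional of psi - 1 on a small
    disc yields, up to a constant independent of the functional, a bound on a
    larger disc. As the gain from r to e beats the constant, an induction on the
    radius shows that the conjugated curve is e-close to 1 on a disc that does
    not depend on g. Letting e tend to 0, the characteristic polynomial of psi
    is constant. There are enough such curves to separate polynomial functions
    on G, hence every element of G is unipotent. Then G is contained in its
    unipotent radical, which is trivial.

    The curves are obtained by solving for the dependent coordinates over
    algebraically independent local coordinates at 1. That the formal solution
    satisfies all the equations of G follows from the uniqueness of the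
    dependent coordinates, because truncated arcs in G with prescribed local
    coordinates are found by multiplying arcs obtained at a generic point. *)

From HB Require Import structures.
Require Import Defs.
From mathcomp Require Import all_boot all_order all_algebra.
From mathcomp Require Import all_classical all_reals all_analysis.
From mathcomp Require Import -(notations) mpoly.
From mathcomp Require Import ring zify.

Set Implicit Arguments.
Unset Strict Implicit.
Unset Printing Implicit Defensive.

Import Order.TTheory GRing.Theory Num.Theory.
Local Open Scope ring_scope.

(** The conjugating element g is unbounded, so no estimate may depend on it. It enters only through
    the linear functionals that read off the entries of g^-1 (psi - 1) g, which is why the constant
    comparing two discs must be uniform in the functional. Coefficients of the characteristic
    polynomial are the right test functions: they are polynomial, invariant under conjugation, and
    detect unipotence.

    The characteristic is arbitrary, so there is no exponential map, and algebraic dependence may a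
    priori be inseparable. Two facts restore separability: the ideal of G is generated over F, so
    equations over F already have all the gradients at 1; and translations carry the tangent space
    at 1 to every point. Density of the rational points in G is not assumed: it is replaced by
    evaluation along formal curves over F. Power series are avoided throughout by computing with
    polynomials modulo powers of ['X]. *)

Local Notation mvar i := (mpolyX _ (mnm1 i)).

(** * Evaluation of polynomials at truncated arcs *)

Lemma mpoly_ring_ind (n : nat) (R : comRingType) (P : mpoly n R -> Prop) :
  (forall c, P (mpolyC n c)) -> (forall i, P (mvar i)) ->
  (forall p q, P p -> P q -> P (p + q)) ->
  (forall p q, P p -> P q -> P (p * q)) -> forall p, P p.
Proof.
move=> PC PX PD PM p; rewrite (mpolyE p).
have P0 : P 0 by rewrite -(mpolyC0 n R); exact: PC.
have P1 : P 1 by rewrite -(mpolyC1 n R); exact: PC.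
elim/big_rec: _ => // m q _ Pq; apply: PD => //.
rewrite -mul_mpolyC; apply: (PM) => //; rewrite mpolyXE_id.
elim/big_rec: _ => // i q' _ Pq'; apply: (PM) => //.
by elim: (m i) => [|k IH]; rewrite ?expr0 // exprS; apply: PM.
Qed.

Lemma mpoly_rmorph_eq (n : nat) (R : comRingType) (S : pzRingType)
    (f g : {rmorphism mpoly n R -> S}) :
  (forall c, f (mpolyC n c) = g (mpolyC n c)) ->
  (forall i, f (mvar i) = g (mvar i)) -> f =1 g.
Proof.
move=> fgC fgX p; elim/mpoly_ring_ind: p => //.
- by move=> p q; rewrite !rmorphD => -> ->.
- by move=> p q; rewrite !rmorphM => -> ->.
Qed.

Lemma mmap_var (n : nat) (R : ringType) (S : comRingType) (f : {rmorphism R -> S})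
  (v : 'I_n -> S) i : mmap f v (mvar i) = v i.
Proof. by rewrite mmapX mmap1U. Qed.

Lemma mmap_eq (n : nat) (R : ringType) (S : comRingType) (f : {rmorphism R -> S})
  (v w : 'I_n -> S) p : v =1 w -> mmap f v p = mmap f w p.
Proof. by move=> vw; apply: eq_bigr => m _; rewrite (mmap1_eq _ vw). Qed.

Lemma rmorph_mmap (n : nat) (R : comRingType) (S T : comRingType)
    (f : {rmorphism R -> S}) (g : {rmorphism S -> T}) (h : {rmorphism R -> T})
    (v : 'I_n -> S) p :
  (forall c, g (f c) = h c) -> g (mmap f v p) = mmap h (g \o v) p.
Proof.
move=> gf; have := @mpoly_rmorph_eq n R T (g \o mmap f v) (mmap h (g \o v)).
by apply => [c|i] /=; rewrite ?mmapC ?mmap_var ?gf.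
Qed.

Lemma mmap_mmap (n k : nat) (R : comRingType) (T : comRingType)
    (h : {rmorphism R -> T}) (v : 'I_n -> mpoly k R) (w : 'I_k -> T) p :
  mmap h w (mmap (mpolyC k (R := R)) v p) = mmap h (fun i => mmap h w (v i)) p.
Proof.
have := @mpoly_rmorph_eq n R T (mmap h w \o mmap (mpolyC k (R := R)) v)
  (mmap h (fun i => mmap h w (v i))).
by apply => [c|i] /=; rewrite ?mmapC ?mmap_var //= mmapC.
Qed.

Lemma mmap_mvar (n : nat) (R : comRingType) (p : mpoly n R) :
  mmap (mpolyC n (R := R)) (fun i => mvar i) p = p.
Proof.
have := @mpoly_rmorph_eq n R (mpoly n R) (mmap (mpolyC n (R := R)) (fun i => mvar i)) idfun.
by apply => [c|i] /=; rewrite ?mmapC ?mmap_var.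
Qed.

Lemma mnm_subid (n : nat) (m : multinom n) : mnm_sub m m = @mnm0 n.
Proof. by apply/mnmP => i; rewrite mnmBE subnn mnm0E. Qed.

Section TruncatedEvaluation.
Variables (L : fieldType) (n : nat).
Implicit Types (f g : mpoly n L) (v w : 'I_n -> {poly L}) (M : nat).

(** A formal arc is a family [v] of polynomials in one parameter, and f holds along it to order M
    when ['X^M] divides [pev v f]. *)
Definition pev v : mpoly n L -> {poly L} := mmap polyC v.
HB.instance Definition _ v := GRing.RMorphism.on (pev v).

Lemma pevC v c : pev v (mpolyC n c) = c%:P.
Proof. by rewrite /pev mmapC. Qed.

Lemma pev_var v i : pev v (mvar i) = v i.
Proof. exact: mmap_var. Qed.

Lemma pev_eq v w f : v =1 w -> pev v f = pev w f.
Proof. exact: mmap_eq. Qed.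

Lemma horner_pev v f (a : L) : (pev v f).[a] = meval (fun i => (v i).[a]) f.
Proof.
rewrite -[LHS]/(horner_eval a (pev v f)).
rewrite (@rmorph_mmap _ _ _ _ polyC (horner_eval a) idfun) //.
by move=> c; rewrite /= /horner_eval hornerC.
Qed.

Lemma pev_comp v f (q : {poly L}) : (pev v f) \Po q = pev (fun i => v i \Po q) f.
Proof.
have := @mpoly_rmorph_eq n L _ (comp_poly q \o pev v) (pev (fun i => v i \Po q)).
by apply => [c|i] /=; rewrite ?pevC ?pev_var ?comp_polyC.
Qed.

Lemma pev_const (x : 'I_n -> L) f : pev (fun i => (x i)%:P) f = (meval x f)%:P.
Proof.
have := @mpoly_rmorph_eq n L _ (pev (fun i => (x i)%:P)) (polyC \o meval x).
by apply => [c|i] /=; rewrite ?pevC ?pev_var ?mevalC ?mevalXU.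
Qed.

Lemma dvdp_pev_sub M v w f : (forall i, 'X^M %| v i - w i) ->
  'X^M %| pev v f - pev w f.
Proof.
move=> vw; elim/mpoly_ring_ind: f => [c|i|p q Hp Hq|p q Hp Hq].
- by rewrite !pevC subrr dvdp0.
- by rewrite !pev_var.
- by rewrite !rmorphD /= opprD addrACA dvdp_add.
rewrite !rmorphM /=.
have -> : pev v p * pev v q - pev w p * pev w q =
  (pev v p - pev w p) * pev v q + pev w p * (pev v q - pev w q).
  by rewrite mulrBl mulrBr addrA subrK.
by apply: dvdp_add; [apply: dvdp_mulr|apply: dvdp_mull].
Qed.

(** As M > 0, the square of ['X^M] is negligible modulo ['X^(M.+1)] and the gradient may be taken at
    the base point of the arc. This drives the Newton iteration for the curves and the uniqueness of
    its solution. *)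
Lemma pev_taylor M v (y : 'I_n -> L) f : (0 < M)%N ->
  'X^(M.+1) %| pev (fun i => v i + (y i) *: 'X^M) f
    - (pev v f + (\sum_i meval (fun i => (v i).[0]) (mderiv i f) * y i) *: 'X^M).
Proof.
move=> M0.
have X2 : ('X^(M.+1) : {poly L}) %| 'X^M * 'X^M.
  by rewrite -exprD dvdp_exp2l // -addn1 leq_add2l.
elim/mpoly_ring_ind: f => [c|i|p q Hp Hq|p q Hp Hq].
- rewrite !pevC big1 ?scale0r ?addr0 ?subrr ?dvdp0 // => i _.
  by rewrite mderivC meval0 mul0r.
- rewrite !pev_var (bigD1 i) //= big1 => [|j ji].
    by rewrite mderivX mnm1E eqxx scale1r mnm_subid mpolyX0 meval1 mul1r addr0 subrr dvdp0.
  by rewrite mderivX mnm1E eq_sym (negPf ji) scale0r meval0 mul0r.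
- under eq_bigr do rewrite mderivD mevalD mulrDl.
  rewrite big_split scalerDl !rmorphD /= addrACA opprD addrACA.
  exact: dvdp_add.
rewrite !rmorphM /=; set P' := pev _ p; set Q' := pev _ q.
under eq_bigr do rewrite mderivM mevalD !mevalM -(horner_pev v p) -(horner_pev v q) mulrDl.
rewrite big_split scalerDl.
set P := pev v p in Hp *; set Q := pev v q in Hq *.
set dp := \sum_i _ in Hp; set dq := \sum_i _ in Hq.
have -> : \sum_i (meval (fun i => (v i).[0]) (mderiv i p) * Q.[0] * y i)
  = dp * Q.[0] by rewrite mulr_suml; apply: eq_bigr => i _; rewrite mulrAC.
have -> : \sum_i (P.[0] * meval (fun i => (v i).[0]) (mderiv i q) * y i)
  = P.[0] * dq by rewrite mulr_sumr; apply: eq_bigr => i _; rewrite mulrA.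
(* In terms of order M, replacing P and Q by their constant terms costs only multiples of
   ['X^(M.+1)]. *)
have split0 (r : {poly L}) : exists s, r = r.[0]%:P + s * 'X.
  have /factor_theorem[s Hs] : root (r - r.[0]%:P) 0 by rewrite /root !hornerE subrr.
  by exists s; move: Hs; rewrite polyC0 subr0 => <-; rewrite addrC subrK.
have [sp Ep] := split0 P; have [sq Eq] := split0 Q.
have -> : P' * Q' - (P * Q + ((dp * Q.[0]) *: 'X^M + (P.[0] * dq) *: 'X^M)) =
  (P' - (P + dp *: 'X^M)) * Q' + (P + dp *: 'X^M) * (Q' - (Q + dq *: 'X^M))
  + dp *: (sq * 'X^(M.+1)) + dq *: (sp * 'X^(M.+1)) + (dp * dq) *: ('X^M * 'X^M).
  rewrite exprS [sq * _]mulrA [sp * _]mulrA -!mul_polyC.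
  have -> : sq * 'X = Q - Q.[0]%:P by apply/eqP; rewrite eq_sym subr_eq addrC -Eq.
  have -> : sp * 'X = P - P.[0]%:P by apply/eqP; rewrite eq_sym subr_eq addrC -Ep.
  rewrite !polyCM; set x := 'X^M.
  ring.
rewrite !dvdp_add //.
- by rewrite dvdp_mulr.
- by rewrite dvdp_mull.
- by rewrite -mul_polyC mulrA dvdp_mull.
- by rewrite -mul_polyC mulrA dvdp_mull.
- by rewrite -mul_polyC dvdp_mull.
Qed.

End TruncatedEvaluation.

(** * Hensel lifting and pseudo-division *)

Lemma horner_taylor1 (R : comNzRingType) (P : {poly R}) (z h : R) :
  exists q, P.[z + h] = P.[z] + P^`().[z] * h + q * h ^+ 2.
Proof.
elim/poly_ind: P => [|P c [q Hq]].
  by exists 0; rewrite deriv0 !horner0; ring.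
exists (P^`().[z] + q * (z + h)).
by rewrite derivD derivM derivX derivC !(hornerD, hornerM, hornerX, hornerC, horner0) Hq; ring.
Qed.

Lemma horner0_horner (L : fieldType) (P : {poly {poly L}}) (z : {poly L}) :
  P.[z].[0] = (map_poly (horner_eval 0) P).[z.[0]].
Proof. by rewrite -[RHS]/((map_poly (horner_eval 0) P).[horner_eval 0 z]) horner_map. Qed.

(** Newton correction, one order at a time: every approximation has constant term [z0], so the
    derivative there keeps its non-zero constant term and the next coefficient can be solved for. *)
Lemma hensel_truncated (L : fieldType) (P : {poly {poly L}}) (z0 : L) M :
  P.[z0%:P].[0] = 0 -> P^`().[z0%:P].[0] != 0 ->
  exists z, z.[0] = z0 /\ 'X^M %| P.[z].
Proof.
move=> P0 dP; elim: M => [|[|M] [z [z0E dz]]].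
- by exists z0%:P; rewrite hornerC expr0 dvd1p.
- exists z0%:P; rewrite hornerC; split=> //.
  by rewrite expr1 -[X in X %| _]subr0 -polyC0 dvdp_XsubCl /root P0.
have /dvdpP[u Eu] := dz.
pose c := - u.[0] / P^`().[z].[0].
have dPz : P^`().[z].[0] != 0.
  by move: dP; rewrite !horner0_horner hornerC z0E.
have [q Hq] := horner_taylor1 P z (c *: 'X^(M.+1)).
exists (z + c *: 'X^(M.+1)); split.
  by rewrite hornerD hornerZ hornerXn expr0n mulr0 addr0.
have -> : P.[z + c *: 'X^(M.+1)] =
    (u + c *: P^`().[z]) * 'X^(M.+1) + q * (c *: 'X^(M.+1)) ^+ 2.
  by rewrite Hq Eu -!mul_polyC; ring.
apply: dvdp_add; last first.
  apply: dvdp_mull; rewrite -mul_polyC exprMn; apply: dvdp_mull.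
  by rewrite -exprM dvdp_exp2l // muln2 -addnn addnS ltnS leq_addr.
rewrite [X in X %| _]exprS; apply: dvdp_mul => //.
rewrite -[X in X %| _]subr0 -polyC0 dvdp_XsubCl /root hornerD hornerZ /c.
by rewrite divfK // addrN.
Qed.

(** The endomorphism [s] will be the projection onto polynomials in some of the variables; tracking
    it keeps quotient and remainder over that subring. *)
Lemma pseudo_division (R : idomainType) (s : {rmorphism R -> R}) (Q D : {poly R}) :
  map_poly s Q = Q -> map_poly s D = D -> D != 0 ->
  exists k A B, [/\ lead_coef D ^+ k *: Q = A * D + B, (size B < size D)%N,
    map_poly s A = A & map_poly s B = B].
Proof.
move=> sQ sD D0; have [m] := ubnP (size Q); elim: m => // m IH in Q sQ *.
rewrite ltnS => szQ.
have [lt|le] := ltnP (size Q) (size D).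
  by exists 0%N, 0, Q; rewrite expr0 scale1r mul0r add0r rmorph0.
have Q0 : Q != 0.
  by apply: contraNneq D0 => Q0; move: le; rewrite Q0 size_poly0 leqn0 size_poly_eq0.
have slc P : map_poly s P = P -> s (lead_coef P) = lead_coef P.
  by rewrite lead_coefE => sP; rewrite -[in LHS]coef_map sP.
set T := lead_coef Q *: 'X^(size Q - size D).
pose Q' := lead_coef D *: Q - T * D.
have sT : map_poly s T = T by rewrite /T map_polyZ map_polyXn slc.
have sQ' : map_poly s Q' = Q' by rewrite /Q' rmorphB rmorphM /= map_polyZ slc ?sQ ?sT ?sD.
have szQ' : (size Q' < m)%N.
  apply: leq_trans szQ; rewrite -[X in (_ < X)%N]prednK ?size_poly_gt0 // ltnS.
  apply/leq_sizeP => j; rewrite leq_eqVlt => /predU1P[<-|lj].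
    rewrite /Q' /T coefB coefZ -scalerAl coefZ coefXnM.
    have sD0 : (0 < size D)%N by rewrite size_poly_gt0.
    have -> : ((size Q).-1 < size Q - size D)%N = false by lia.
    have -> : ((size Q).-1 - (size Q - size D) = (size D).-1)%N by lia.
    by rewrite -!lead_coefE mulrC subrr.
  apply/leq_sizeP: j lj; rewrite prednK ?size_poly_gt0 //.
  apply: leq_trans (size_polyD _ _) _; rewrite geq_max size_polyN size_scale_leq /=.
  apply: leq_trans (size_polyMleq _ _) _.
  rewrite /T; apply: (@leq_trans ((size Q - size D).+1 + size D).-1).
    by rewrite -!subn1 leq_sub2r // leq_add2r (leq_trans (size_scale_leq _ _)) ?size_polyXn.
  by rewrite addSn /= subnK.
have [k [A [B [E szB sA sB]]]] := IH _ sQ' szQ'.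
exists k.+1, (A + lead_coef D ^+ k *: T), B; split=> //; last first.
  by rewrite rmorphD /= map_polyZ rmorphXn /= slc ?sA ?sT.
by rewrite mulrDl addrAC -E -scalerAl -scalerDr /Q' subrK exprSr scalerA.
Qed.

(** * Elimination of variables *)

Lemma min_witness (T : Type) (P : T -> Prop) (size : T -> nat) :
  (exists x, P x) -> exists x, P x /\ forall y, P y -> (size x <= size y)%N.
Proof.
move=> [x Px]; pose A n := `[< exists x, P x /\ size x = n >].
have exA : exists n, A n by exists (size x); apply/asboolP; exists x.
case: (ex_minnP exA) => m /asboolP[y [Py <-]] mmin.
by exists y; split=> // z Pz; apply: mmin; apply/asboolP; exists z.
Qed.

Section VariableRestriction.
Variables (R : comNzRingType) (n : nat).
Implicit Types (S : {set 'I_n}) (f : mpoly n R) (j : 'I_n).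

(** An idempotent projection whose image is the ring of polynomials in the variables of S.
    Membership in this subring becomes the equation [restr S f = f], and all sets of variables share
    one type. *)
Definition restr S : mpoly n R -> mpoly n R :=
  mmap (mpolyC n (R := R)) (fun i => if i \in S then mvar i else 0).
HB.instance Definition _ S := GRing.RMorphism.on (restr S).

Lemma restr_var S i : restr S (mvar i) = if i \in S then mvar i else 0.
Proof. exact: mmap_var. Qed.

Lemma restrC S c : restr S (mpolyC n c) = mpolyC n c.
Proof. exact: mmapC. Qed.

Lemma mmap_restr (T : comRingType) (h : {rmorphism R -> T}) S v f :
  mmap h v (restr S f) = mmap h (fun i => if i \in S then v i else 0) f.
Proof.
rewrite mmap_mmap; apply: mmap_eq => i.
by case: ifP => _; rewrite ?mmap_var ?rmorph0.
Qed.

Lemma mmap_restr_eq (T : comRingType) (h : {rmorphism R -> T}) S v w f :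
  restr S f = f -> (forall i, i \in S -> v i = w i) ->
  mmap h v f = mmap h w f.
Proof.
move=> <- vw; rewrite !mmap_restr; apply: mmap_eq => i.
by case: ifP => // /vw.
Qed.

Lemma restr_setT f : restr [set: 'I_n] f = f.
Proof.
rewrite -[RHS]mmap_mvar; apply: mmap_eq => i.
by rewrite inE.
Qed.

Lemma restr_restr S (T : {set 'I_n}) f : S \subset T -> restr T (restr S f) = restr S f.
Proof.
move=> /fintype.subsetP ST; apply: etrans (mmap_restr _ _ _ _) _; apply: mmap_eq => i.
by case: ifP => // /ST ->.
Qed.

(** A polynomial in the variables [j |: S] read as a polynomial in the variable j. Other variables
    are sent to 0, so f is recovered only when it is fixed by [restr (j |: S)]. *)
Definition univ S j : mpoly n R -> {poly (mpoly n R)} :=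
  mmap (polyC \o mpolyC n (R := R))
    (fun i => if i == j then 'X else if i \in S then (mvar i)%:P else 0).
HB.instance Definition _ S j := GRing.RMorphism.on (univ S j).

Lemma univ_var S j i : univ S j (mvar i) =
  if i == j then 'X else if i \in S then (mvar i)%:P else 0.
Proof. exact: mmap_var. Qed.

Lemma univC S j c : univ S j (mpolyC n c) = (mpolyC n c)%:P.
Proof. exact: mmapC. Qed.

Lemma univ_horner S j f : restr (j |: S) f = f -> (univ S j f).[mvar j] = f.
Proof.
move=> fS; rewrite -[in RHS]fS.
have := @mpoly_rmorph_eq n R _ (horner_eval (mvar j) \o univ S j) (restr (j |: S)).
apply=> [c|i] /=; rewrite /horner_eval ?univC ?restrC ?hornerC //.
rewrite univ_var restr_var !inE; case: eqP => [->|_] /=; first by rewrite hornerX.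
by case: ifP; rewrite ?hornerC ?horner0.
Qed.

Lemma restr_univ S j f : map_poly (restr S) (univ S j f) = univ S j f.
Proof.
have := @mpoly_rmorph_eq n R _ (map_poly (restr S) \o univ S j) (univ S j).
apply=> [c|i] /=; rewrite ?univC ?map_polyC /= ?restrC //.
rewrite univ_var; case: ifP => _; first by rewrite map_polyX.
by case: ifP => iS; rewrite ?rmorph0 // map_polyC /= restr_var iS.
Qed.

Lemma restr_coef S (Q : {poly (mpoly n R)}) k :
  map_poly (restr S) Q = Q -> restr S Q`_k = Q`_k.
Proof. by move=> QS; rewrite -coef_map QS. Qed.

End VariableRestriction.

Lemma poly_lead_split (R : nzSemiRingType) (Q : {poly R}) :
  Q = \poly_(i < (size Q).-1) Q`_i + lead_coef Q *: 'X^((size Q).-1).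
Proof.
apply/polyP => k; rewrite coefD coef_poly coefZ coefXn lead_coefE.
have [lt|le] := ltnP k (size Q).-1.
  by rewrite (ltn_eqF lt) mulr0 addr0.
case: eqP => [->|ne]; rewrite ?mulr1 ?add0r // mulr0.
by rewrite nth_default // (leq_trans (leqSpred _)) // ltn_neqAle le andbT eq_sym; apply/eqP.
Qed.

Section VanishingIdeal.
Variables (L : fieldType) (n : nat) (X : set ('I_n -> L)).
Implicit Types (S : {set 'I_n}) (f g p q : mpoly n L) (j : 'I_n).

Definition vanishes f := forall x, X x -> meval x f = 0.

Lemma vanishes0 : vanishes 0.
Proof. by move=> x _; rewrite meval0. Qed.

Lemma vanishesD f g : vanishes f -> vanishes g -> vanishes (f + g).
Proof. by move=> If Ig x Xx; rewrite mevalD If // Ig // addr0. Qed.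

Lemma vanishesN f : vanishes f -> vanishes (- f).
Proof. by move=> If x Xx; rewrite mevalN If // oppr0. Qed.

Lemma vanishesB f g : vanishes f -> vanishes g -> vanishes (f - g).
Proof. by move=> If Ig; apply/vanishesD/vanishesN. Qed.

Lemma vanishesMl f g : vanishes g -> vanishes (f * g).
Proof. by move=> Ig x Xx; rewrite mevalM Ig // mulr0. Qed.

Lemma vanishesMr f g : vanishes f -> vanishes (f * g).
Proof. by move=> If; rewrite mulrC; apply: vanishesMl. Qed.

Lemma vanishes_horner (Q : {poly (mpoly n L)}) y :
  (forall k, vanishes Q`_k) -> vanishes Q.[y].
Proof.
move=> IQ; rewrite horner_coef; elim/big_rec: _ => [|i f _ If].
  exact: vanishes0.
by apply: vanishesD => //; apply: vanishesMr.
Qed.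

Hypothesis X_prime : forall f g, vanishes (f * g) -> vanishes f \/ vanishes g.
Hypothesis X_nonempty : ~ vanishes 1.

Lemma vanishesX f k : vanishes (f ^+ k) -> vanishes f.
Proof.
elim: k => [|k IH]; first by rewrite expr0 => /X_nonempty.
by rewrite exprS => /X_prime[|/IH].
Qed.

(* A truncated arc defined on the variables of [S] only extends to an arc on X,
   when its base point is generic. *)
Definition arcs_extend S := exists w, ~ vanishes w /\
  forall x, X x -> meval x w != 0 -> forall M (v : 'I_n -> {poly L}),
  (0 < M)%N ->
  (forall i, i \in S -> (v i).[0] = x i) ->
  (forall f, restr S f = f -> vanishes f -> 'X^M %| pev v f) ->
  exists v', [/\ forall i, i \in S -> v' i = v i, forall i, (v' i).[0] = x i &
    forall f, vanishes f -> 'X^M %| pev v' f].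

(** Every non-zero element of the coordinate ring has a non-zero multiple in the subring generated
    by the variables of S: algebraicity over these variables, phrased without fraction fields. *)
Definition eliminates_to S := forall p, ~ vanishes p ->
  exists p', [/\ restr S p' = p', ~ vanishes p' &
    exists q, vanishes (p' - q * p)].

Lemma arcs_extend_setT : arcs_extend [set: 'I_n].
Proof.
exists 1; split=> // x Xx _ M v M0 vx vI; exists v; split=> // [i|f If].
  by apply: vx; rewrite inE.
by apply: vI => //; apply: restr_setT.
Qed.

Lemma eliminates_to_setT : eliminates_to [set: 'I_n].
Proof.
move=> p Ip; exists p; split=> //; first exact: restr_setT.
by exists 1; rewrite mul1r subrr; apply: vanishes0.
Qed.

Section OneVariable.
Variables (S : {set 'I_n}) (j : 'I_n).
Hypothesis jS : j \notin S.

Let relation (Q : {poly (mpoly n L)}) :=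
  [/\ map_poly (restr S) Q = Q, vanishes Q.[mvar j] & ~ vanishes (lead_coef Q)].

Lemma relation_or (Q : {poly (mpoly n L)}) :
  map_poly (restr S) Q = Q -> vanishes Q.[mvar j] ->
  (forall k, vanishes Q`_k) \/ exists D, relation D /\ (size D <= size Q)%N.
Proof.
have [m] := ubnP (size Q); elim: m => // m IH in Q *; rewrite ltnS => szQ QS IQ.
have [->|Q0] := eqVneq Q 0.
  by left=> k; rewrite coef0; apply: vanishes0.
have [Ilc|nIlc] := pselect (vanishes (lead_coef Q)); last by right; exists Q.
pose Q' := \poly_(i < (size Q).-1) Q`_i.
have szQ' : (size Q' < size Q)%N.
  by rewrite -[X in (_ < X)%N]prednK ?size_poly_gt0 // ltnS size_poly.
have Q'S : map_poly (restr S) Q' = Q'.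
  apply/polyP => k; rewrite coef_map !coef_poly.
  by case: ifP => _; [exact: restr_coef | exact: rmorph0].
have IQ' : vanishes Q'.[mvar j].
  have -> : Q'.[mvar j] = Q.[mvar j] - lead_coef Q * mvar j ^+ (size Q).-1.
    by rewrite [in X in _ = X.[_] - _](poly_lead_split Q) hornerD hornerZ hornerXn addrK.
  by apply: vanishesB => //; apply: vanishesMr.
case: (IH Q') => // [|cI|[D [relD szD]]]; first exact: leq_trans szQ' szQ.
  left=> k; rewrite (poly_lead_split Q) coefD coefZ; apply: vanishesD => //.
  exact: vanishesMr.
by right; exists D; split=> //; apply: leq_trans (ltnW szQ').
Qed.

Variables (P : mpoly n L).
Hypothesis PS : restr (j |: S) P = P.
Hypothesis IP : vanishes P.
Hypothesis dP : ~ vanishes (univ S j P)^`().[mvar j].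

(** A relation D of least degree inherits separability from P. If its derivative vanished at the
    coordinate, all coefficients of D' would lie in the ideal by minimality. Differentiating a
    pseudo-division of [univ S j P] by D would then put the derivative of P in the ideal, since the
    remainder has its coefficients there too. *)
Lemma minimal_relation : exists D, [/\ relation D,
  ~ vanishes D^`().[mvar j] &
  forall Q, map_poly (restr S) Q = Q -> vanishes Q.[mvar j] ->
    (size Q < size D)%N -> forall k, vanishes Q`_k].
Proof.
pose Q := univ S j P.
have QS : map_poly (restr S) Q = Q by apply: restr_univ.
have IQ : vanishes Q.[mvar j] by rewrite univ_horner.
have [D [relD Dmin]] : exists D, relation D /\ forall Q, relation Q -> (size D <= size Q)%N.
  apply: min_witness; case: (relation_or QS IQ) => [cI|[D [relD _]]]; last by exists D.
  case: dP; apply: vanishes_horner => k; rewrite coef_deriv -mulr_natl.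
  exact: vanishesMl.
have small Q1 : map_poly (restr S) Q1 = Q1 -> vanishes Q1.[mvar j] ->
    (size Q1 < size D)%N -> forall k, vanishes Q1`_k.
  move=> Q1S IQ1 sz; case: (relation_or Q1S IQ1) => // -[E [relE szE]].
  by have := leq_ltn_trans (leq_trans (Dmin _ relE) szE) sz; rewrite ltnn.
exists D; split=> // IdD.
have [DS ID nI] := relD.
have D0 : D != 0.
  by apply/eqP => D0; apply: nI; rewrite D0 lead_coef0; apply: vanishes0.
have cdD : forall k, vanishes D^`()`_k.
  apply: small => //; last by rewrite lt_size_deriv.
  by rewrite -deriv_map DS.
have [k [A [B [E szB AS BS]]]] := pseudo_division QS DS D0.
have IB : vanishes B.[mvar j].
  have -> : B.[mvar j] = lead_coef D ^+ k * Q.[mvar j] - A.[mvar j] * D.[mvar j].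
    by rewrite -hornerZ E hornerD hornerM addrC addKr.
  by apply: vanishesB; apply: vanishesMl.
have cB := small _ BS IB szB.
have : vanishes (lead_coef D ^+ k * Q^`().[mvar j]).
  rewrite -hornerZ -derivZ E derivD derivM !hornerD !hornerM.
  apply: vanishesD; first (apply: vanishesD; apply: vanishesMl => //).
  by apply: vanishes_horner => i; rewrite coef_deriv -mulr_natl; apply: vanishesMl.
by case/X_prime => [/vanishesX|].
Qed.

(** A non-zero multiple Q of p of least degree in the variable j is constant in it. Otherwise Q
    divides the minimal relation D up to the ideal; the quotient vanishes at the coordinate and has
    smaller degree than D, so its coefficients lie in the ideal, and so does the leading coefficient
    of D. *)
Lemma eliminate_variable : eliminates_to (j |: S) -> eliminates_to S.
Proof.
have [D [[DS ID nI] _ small]] := minimal_relation.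
have D0 : D != 0.
  by apply/eqP => D0; apply: nI; rewrite D0 lead_coef0; apply: vanishes0.
move=> elim p Ip.
pose good Q := [/\ map_poly (restr S) Q = Q, ~ vanishes Q.[mvar j] &
  exists q, vanishes (Q.[mvar j] - q * p)].
have [Q [[QS nIQ [q Iq]] Qmin]] :
    exists Q, good Q /\ forall Q', good Q' -> (size Q <= size Q')%N.
  apply: min_witness; have [p1 [p1S nIp1 Ip1]] := elim p Ip.
  by exists (univ S j p1); split; rewrite ?restr_univ ?univ_horner.
have Q0 : Q != 0 by apply/eqP => Q0; apply: nIQ; rewrite Q0 horner0; apply: vanishes0.
have nIlc : ~ vanishes (lead_coef Q).
  move=> Ilc; pose Q' := \poly_(i < (size Q).-1) Q`_i.
  have Q'E : Q'.[mvar j] = Q.[mvar j] - lead_coef Q * mvar j ^+ (size Q).-1.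
    by rewrite [in X in _ = X.[_] - _](poly_lead_split Q) hornerD hornerZ hornerXn addrK.
  have IlX : vanishes (lead_coef Q * mvar j ^+ (size Q).-1) by apply: vanishesMr.
  have : good Q'.
    split.
    - apply/polyP => k; rewrite coef_map !coef_poly.
      by case: ifP => _; [exact: restr_coef | exact: rmorph0].
    - by move=> IQ'; apply: nIQ; rewrite -[_.[_]](subrK (lead_coef Q * mvar j ^+ (size Q).-1)) -Q'E; apply: vanishesD.
    - by exists q; rewrite Q'E addrAC; apply: vanishesB.
  move/Qmin; have := size_poly (size Q).-1 (fun i => Q`_i).
  by move: Q0; rewrite -size_poly_gt0 -/Q' => ? ? ?; lia.
have [sz1|sz1] := leqP (size Q) 1.
  exists Q`_0; have QE : Q.[mvar j] = Q`_0 by rewrite (size1_polyC sz1) hornerC coefC.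
  by rewrite -QE; split=> //; [rewrite QE restr_coef|exists q].
(* Both divisions of [D] and [Q] by each other are exact up to the ideal. *)
have szQD : (size Q <= size D)%N.
  have [k [A [B [E szB AS BS]]]] := pseudo_division QS DS D0.
  have BE : B.[mvar j] = lead_coef D ^+ k * Q.[mvar j] - A.[mvar j] * D.[mvar j].
    by rewrite -hornerZ E hornerD hornerM addrC addKr.
  have IAD : vanishes (A.[mvar j] * D.[mvar j]) by apply: vanishesMl.
  suff /Qmin/leq_ltn_trans/(_ szB)/ltnW : good B by [].
  split=> //.
    move=> IB; have : vanishes (lead_coef D ^+ k * Q.[mvar j]).
      by rewrite -[_ * _](subrK (A.[mvar j] * D.[mvar j])) -BE; apply: vanishesD.
    by case/X_prime => [/vanishesX|].
  exists (lead_coef D ^+ k * q); rewrite BE addrAC; apply: vanishesB => //.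
  by rewrite -mulrA -mulrBr; apply: vanishesMl.
have [k [A [B [E szB AS BS]]]] := pseudo_division DS QS Q0.
have BE : B.[mvar j] = lead_coef Q ^+ k * D.[mvar j] - A.[mvar j] * Q.[mvar j].
  by rewrite -hornerZ E hornerD hornerM addrC addKr.
have IB : vanishes B.[mvar j].
  apply: contrapT => nIB; suff /Qmin : good B by rewrite leqNgt szB.
  split=> //; exists (- A.[mvar j] * q); rewrite BE.
  have -> : lead_coef Q ^+ k * D.[mvar j] - A.[mvar j] * Q.[mvar j] - - A.[mvar j] * q * p
    = lead_coef Q ^+ k * D.[mvar j] - A.[mvar j] * (Q.[mvar j] - q * p) by ring.
  by apply: vanishesB; apply: vanishesMl.
have IAQ : vanishes (A.[mvar j] * Q.[mvar j]).
  have -> : A.[mvar j] * Q.[mvar j] = lead_coef Q ^+ k * D.[mvar j] - B.[mvar j].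
    by rewrite BE; ring.
  by apply: vanishesB => //; apply: vanishesMl.
have IA : vanishes A.[mvar j] by case/X_prime: IAQ.
have lQk : lead_coef Q ^+ k != 0 by rewrite expf_neq0 // lead_coef_eq0.
have A0 : A != 0.
  apply: contraTneq szB => A0; rewrite -leqNgt; apply: leq_trans szQD _.
  by rewrite -(size_scale D lQk) E A0 mul0r add0r.
have sA0 : (0 < size A)%N by rewrite size_poly_gt0.
have szBA : (size B < size (A * Q)%R)%N.
  by rewrite size_mul //; move: szB sA0; lia.
have szE : size D = (size A + size Q).-1.
  by rewrite -(size_scale D lQk) E size_polyDl // size_mul.
have szAD : (size A < size D)%N by move: sz1; lia.
have cA := small _ AS IA szAD.
case: nI; have lead : lead_coef Q ^+ k * lead_coef D = lead_coef A * lead_coef Q.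
  by rewrite -lead_coefM -(lead_coefZ (lead_coef Q ^+ k)) E lead_coefDl.
have : vanishes (lead_coef Q ^+ k * lead_coef D).
  by rewrite lead; apply: vanishesMr; apply: cA.
by case/X_prime => [/vanishesX|].
Qed.

(** The missing coordinate is found by Hensel lifting of a root of D along the arc. The extra
    factors of the exceptional polynomial keep D separable and its leading coefficient non-zero at
    the base point. *)
Lemma extend_variable : arcs_extend (j |: S) -> arcs_extend S.
Proof.
have [D [[DS ID nI] nId small]] := minimal_relation.
have D0 : D != 0.
  by apply/eqP => D0; apply: nI; rewrite D0 lead_coef0; apply: vanishes0.
move=> [w [Iw ext]]; exists (w * (lead_coef D * D^`().[mvar j])); split.
  by case/X_prime => // /X_prime[].
move=> x Xx; rewrite !mevalM !mulf_eq0 !negb_or => /andP[wx /andP[lx dx]] M v M0 vx vI.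
pose H := map_poly (pev v) D.
have val0 (Q : {poly (mpoly n L)}) : map_poly (restr S) Q = Q ->
    (map_poly (pev v) Q).[(x j)%:P].[0] = meval x Q.[mvar j].
  move=> QS; rewrite horner0_horner hornerC -map_poly_comp -(horner_map (meval x)) /= mevalXU.
  congr (_.[_]); apply/polyP => k; rewrite !coef_map /= /horner_eval horner_pev.
  by apply: mmap_restr_eq (restr_coef k QS) _ => i iS; apply: vx.
have dDS : map_poly (restr S) D^`() = D^`() by rewrite -deriv_map DS.
have [z [z0 Hz]] : exists z, z.[0] = x j /\ 'X^M %| H.[z].
  apply: hensel_truncated; first by rewrite val0 ?ID.
  by rewrite deriv_map val0.
pose v1 i := if i == j then z else v i.
have v1S i : i \in S -> v1 i = v i.
  by move=> iS; rewrite /v1; case: eqP => // ij; move: jS; rewrite -ij iS.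
have pv1 f : restr S f = f -> pev v1 f = pev v f.
  by move=> fS; apply: mmap_restr_eq fS v1S.
have pH (Q : {poly (mpoly n L)}) : map_poly (restr S) Q = Q ->
    pev v1 Q.[mvar j] = (map_poly (pev v) Q).[z].
  move=> QS; rewrite -(horner_map (pev v1)) /= pev_var /v1 eqxx; congr (_.[_]).
  by apply/polyP => k; rewrite !coef_map /= pv1 // restr_coef.
have [|f fS If|v' [v'S v'x v'I]] := ext x Xx wx M v1 M0.
- move=> i; rewrite !inE => /predU1P[->|iS]; first by rewrite /v1 eqxx.
  by rewrite v1S // vx.
- pose Q := univ S j f.
  have QS : map_poly (restr S) Q = Q by apply: restr_univ.
  have fE : f = Q.[mvar j] by rewrite univ_horner.
  (* By minimality of D the remainder has coefficients in the ideal, which the arc on S kills. A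
     power of the leading coefficient of D times f is thus 0 modulo ['X^M], and this leading
     coefficient is prime to ['X] along the arc. *)
  have [k [A [B [E szB AS BS]]]] := pseudo_division QS DS D0.
  have IB : vanishes B.[mvar j].
    have -> : B.[mvar j] = lead_coef D ^+ k * Q.[mvar j] - A.[mvar j] * D.[mvar j].
      by rewrite -hornerZ E hornerD hornerM addrC addKr.
    by apply: vanishesB; apply: vanishesMl; rewrite // -fE.
  have cB := small _ BS IB szB.
  have : 'X^M %| pev v (lead_coef D) ^+ k * (map_poly (pev v) Q).[z].
    have -> : pev v (lead_coef D) ^+ k * (map_poly (pev v) Q).[z] =
        (map_poly (pev v) A).[z] * H.[z] + (map_poly (pev v) B).[z].
      have -> : pev v (lead_coef D) ^+ k * (map_poly (pev v) Q).[z] =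
          (map_poly (pev v) (lead_coef D ^+ k *: Q)).[z].
        by rewrite map_polyZ hornerZ rmorphXn.
      by rewrite E rmorphD rmorphM /= hornerD hornerM.
    apply: dvdp_add; first exact: dvdp_mull.
    rewrite horner_coef; elim/big_rec: _ => [|i g _ Hg]; first exact: dvdp0.
    apply: dvdp_add => //; apply: dvdp_mulr; rewrite coef_map /=.
    by apply: vI; rewrite ?restr_coef.
  rewrite Gauss_dvdpr -?pH // -?fE //.
  apply/coprimep_expl/coprimep_expr; rewrite coprimep_sym.
  rewrite -['X]subr0 -polyC0 coprimep_XsubC /root horner_pev.
  suff -> : meval (fun i => (v i).[0]) (lead_coef D) = meval x (lead_coef D) by [].
  rewrite lead_coefE; apply: mmap_restr_eq (restr_coef _ DS) _ => i iS.
  exact: vx.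
- exists v'; split=> // i iS. by rewrite v'S ?v1S // !inE iS orbT.
Qed.

End OneVariable.

End VanishingIdeal.

Lemma dvdp_XnP (R : fieldType) M (p : {poly R}) :
  reflect (forall k, (k < M)%N -> p`_k = 0) ('X^M %| p).
Proof.
apply: (iffP idP) => [/dvdpP[q ->] k kM|H]; first by rewrite coefMXn kM.
apply/dvdpP; exists (drop_poly M p); rewrite -[LHS](poly_take_drop M).
rewrite [X in X + _](_ : _ = 0) ?add0r //; apply/polyP => k.
by rewrite coef_take_poly coef0; case: ifP => // /H.
Qed.

Section Descent.
Variables (L : fieldType) (n : nat) (X : set ('I_n -> L)).
Implicit Types (S : {set 'I_n}) (f g p q : mpoly n L) (j : 'I_n).

Lemma nvanishesP f : ~ vanishes X f -> exists2 x, X x & meval x f != 0.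
Proof.
move=> nIf; apply: contrapT => nex; apply: nIf => x Xx; apply/eqP.
by apply: contrapT => /negP fx; apply: nex; exists x.
Qed.

Definition tangent (x y : 'I_n -> L) := forall f, vanishes X f ->
  \sum_i meval x (mderiv i f) * y i = 0.

Lemma tangentP (x y : 'I_n -> L) : X x ->
  tangent x y <->
  forall f, vanishes X f -> 'X^2 %| pev (fun i => (x i)%:P + y i *: 'X) f.
Proof.
move=> Xx; split=> H f If; have /= := pev_taylor (fun i => (x i)%:P) y f (ltn0Sn 0).
  have -> : \sum_i meval (fun i => (x i)%:P.[0]) (mderiv i f) * y i = 0.
    rewrite -[RHS](H _ If); apply: eq_bigr => i _; congr (_ * _).
    by apply: meval_eq => k; rewrite hornerC.
  by rewrite pev_const If // scale0r addr0 subr0 expr1.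
have := H _ If; rewrite expr1 => H1 H2; have := dvdp_sub H1 H2.
rewrite opprB addrC subrK pev_const If // add0r => H3.
set s := \sum_i _ in H3.
have s0 : s = 0.
  have /dvdpP[u Eu] := H3; have := congr1 (fun p : {poly L} => p`_1) Eu.
  by rewrite coefZ coefX mulr1 coefMXn.
rewrite -[RHS]s0; apply: eq_bigr => i _; congr (_ * _).
by apply: meval_eq => k; rewrite hornerC.
Qed.

Hypothesis X_prime : forall f g, vanishes X (f * g) -> vanishes X f \/ vanishes X g.
Hypothesis X_nonempty : ~ vanishes X 1.

Variables (Y : {set 'I_n}) (D : mpoly n L).
Hypothesis nD : ~ vanishes X D.
Hypothesis Y_coord : forall x y, X x -> meval x D != 0 -> tangent x y ->
  (forall i, i \in Y -> y i = 0) -> forall i, y i = 0.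

(** If all relations for the variable j over S were inseparable, the line moving only the j-th
    coordinate would satisfy them modulo ['X^2] and extend to an arc on X. Its velocity would be a
    tangent vector with zero coordinates in Y but j-th coordinate 1. *)
Lemma separable_relation S j : Y \subset S -> j \notin S ->
  arcs_extend X (j |: S) ->
  exists P, [/\ restr (j |: S) P = P, vanishes X P &
    ~ vanishes X (univ S j P)^`().[mvar j]].
Proof.
move=> YS jS [w [nw ext]]; apply: contrapT => nex.
have dI P : restr (j |: S) P = P -> vanishes X P ->
    vanishes X (univ S j P)^`().[mvar j].
  by move=> PS IP; apply: contrapT => nI; apply: nex; exists P.
have /nvanishesP[x Xx] : ~ vanishes X (w * D) by case/X_prime.
rewrite mevalM mulf_eq0 negb_or => /andP[wx Dx].
pose v i := (x i)%:P + (i == j)%:R *: 'X.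
have vS i : i \in S -> v i = (x i)%:P.
  move=> iS; rewrite /v; case: eqP => [ij|_]; last by rewrite scale0r addr0.
  by move: jS; rewrite -ij iS.
have vj : v j = (x j)%:P + 'X by rewrite /v eqxx scale1r.
have pv (Q : {poly (mpoly n L)}) : map_poly (restr S) Q = Q ->
    (map_poly (pev v) Q).[(x j)%:P] = (meval x Q.[mvar j])%:P.
  move=> QS; rewrite -pev_const -(horner_map (pev (fun i => (x i)%:P))) /= pev_var.
  congr (_.[_]); apply/polyP => k; rewrite !coef_map /=.
  exact: mmap_restr_eq (restr_coef k QS) vS.
have [||v' [v'S v'x v'I]] := ext x Xx wx 2 v isT.
- move=> i; rewrite !inE => /predU1P[->|iS].
    by rewrite vj hornerD hornerC hornerX addr0.
  by rewrite vS // hornerC.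
- move=> f fS If; pose Q := univ S j f.
  have QS : map_poly (restr S) Q = Q by apply: restr_univ.
  have fE : f = Q.[mvar j] by rewrite univ_horner.
  rewrite fE -(horner_map (pev v)) /= pev_var vj.
  have [q ->] := horner_taylor1 (map_poly (pev v) Q) (x j)%:P 'X.
  have dQS : map_poly (restr S) Q^`() = Q^`() by rewrite -deriv_map QS.
  rewrite deriv_map !pv // -fE If // dI // polyC0 mul0r !add0r.
  exact: dvdp_mull.
pose y i := (v' i)`_1.
have y0 : forall i, y i = 0.
  apply: (Y_coord Xx Dx); last first.
    move=> i iY; have iS : i \in S by apply: (fintype.subsetP YS).
    by rewrite /y v'S ?vS ?coefC // !inE iS orbT.
  apply/tangentP => // f If.
  suff xy : forall i, 'X^2 %| ((x i)%:P + y i *: 'X) - v' i.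
    by have := dvdp_add (dvdp_pev_sub f xy) (v'I f If); rewrite subrK.
  move=> i; apply/dvdp_XnP => k k2; rewrite coefB coefD coefC coefZ coefX.
  case: k k2 => [|[|//]] _ /=; rewrite ?mulr0 ?mulr1 ?add0r ?subrr //.
  by rewrite addr0 -horner_coef0 v'x subrr.
have : y j = 1.
  by rewrite /y v'S ?vj ?coefD ?coefC ?coefX ?add0r // !inE eqxx.
by rewrite y0 => /eqP; rewrite eq_sym oner_eq0.
Qed.

Lemma descend_to_coordinates : arcs_extend X Y /\ eliminates_to X Y.
Proof.
suff H m S : Y \subset S -> #|~: S| = m -> arcs_extend X S /\ eliminates_to X S.
  exact: H (fintype.subxx _) erefl.
elim: m S => [|m IH] S YS.
  move/eqP; rewrite cards_eq0 => /eqP/(congr1 (@finset.setC _)); rewrite finset.setCK finset.setC0 => ->.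
  by split; [apply: arcs_extend_setT|apply: eliminates_to_setT].
move=> cS; have /card_gt0P[j] : (0 < #|~: S|)%N by rewrite cS.
rewrite inE => jS.
have [||aj ej] := IH (j |: S).
- by apply: (fintype.subset_trans YS); apply: finset.subsetUr.
- by move: cS; rewrite (cardsD1 j) inE jS => -[<-]; rewrite finset.setCU finset.setIC -finset.setDE.
have [P [PS IP dP]] := separable_relation YS jS aj.
by split; [apply: (extend_variable X_prime X_nonempty jS PS IP dP)
  |apply: (eliminate_variable X_prime X_nonempty jS PS IP dP)].
Qed.

End Descent.

(** * Algebraic independence of local coordinates *)

Section RestrictionCoefficients.
Variables (R : comNzRingType) (n : nat).
Implicit Types (S : {set 'I_n}) (f : mpoly n R).

Lemma restr_monomial S (m : multinom n) :
  restr S (mpolyX R m) = if [forall i, (i \notin S) ==> (m i == 0%N)] then mpolyX R m else 0.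
Proof.
rewrite [LHS]mmapX /mmap1; case: ifP => [/forallP H|/negbT].
  rewrite mpolyXE_id; apply: eq_bigr => i _; case: ifP => // /negbT iS.
  by have := H i; rewrite iS => /eqP ->; rewrite !expr0.
rewrite negb_forall => /existsP[i]; rewrite negb_imply => /andP[iS mi].
by rewrite (bigD1 i) //= (negPf iS) expr0n (negPf mi) mul0r.
Qed.

Lemma mcoeff_restr S f m :
  mcoeff m (restr S f) = if [forall i, (i \notin S) ==> (m i == 0%N)] then mcoeff m f else 0.
Proof.
rewrite [in LHS](mpolyE f) rmorph_sum raddf_sum /=.
rewrite [in RHS](mpolyE f) raddf_sum /=.
have E k : mcoeff m (restr S (mcoeff k f *: mpolyX R k)) =
    if [forall i, (i \notin S) ==> (m i == 0%N)] then mcoeff m (mcoeff k f *: mpolyX R k) else 0.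
  rewrite -mul_mpolyC rmorphM /= restrC restr_monomial !mcoeffCM.
  case: ifP => [kS|kS]; case: ifP => [mS|mS] //; rewrite ?mcoeffX ?mcoeff0 ?mulr0 //.
    by case: eqP => [km|_]; rewrite ?mulr0 //; move: kS; rewrite km mS.
  by case: eqP => [km|_]; rewrite ?mulr0 //; move: kS; rewrite km mS.
rewrite (eq_bigr _ (fun k _ => E k)).
by case: ifP => // _; apply: big1.
Qed.

Lemma restr_mderiv S f i : restr S f = f -> restr S (mderiv i f) = mderiv i f.
Proof.
move=> fS; apply/mpolyP => m; rewrite mcoeff_restr; case: ifP => // /negbT.
rewrite negb_forall => /existsP[k]; rewrite negb_imply => /andP[kS mk].
rewrite mcoeff_deriv -fS mcoeff_restr; case: ifP => [/forallP/(_ k)|]; last by rewrite mul0rn.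
by rewrite kS mnmDE addn_eq0 (negPf mk).
Qed.

Lemma mderiv_restr_eq0 S f i : restr S f = f -> i \notin S -> mderiv i f = 0.
Proof.
move=> <- iS; apply/mpolyP => m; rewrite mcoeff0 mcoeff_deriv mcoeff_restr.
case: ifP => [/forallP/(_ i)|]; last by rewrite mul0rn.
by rewrite iS mnmDE mnm1E eqxx addn1.
Qed.

End RestrictionCoefficients.

Lemma closed_root (L : closedFieldType) (k : nat) (c : L) :
  (0 < k)%N -> exists b, b ^+ k = c.
Proof.
move=> k0; have [b Hb] := @solve_monicpoly L k (fun i => if i == 0%N then c else 0) k0.
exists b; rewrite Hb; case: k k0 {Hb} => // k _; rewrite big_ord_recl expr0 mulr1.
by rewrite big1 ?addr0 // => i _; rewrite mul0r.
Qed.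

(** Vanishing derivatives of a non-constant polynomial force a positive characteristic p and
    exponents divisible by p. The coefficients have p-th roots in L, and the Frobenius map is
    additive. *)
Lemma mderiv_eq0_root (L : closedFieldType) (n : nat) (S : {set 'I_n}) (P : mpoly n L) :
  restr S P = P -> (forall i, mderiv i P = 0) -> P <> mpolyC n (mcoeff (@mnm0 n) P) ->
  exists p Q, [/\ P = Q ^+ p, restr S Q = Q & (mmeasure (@mdeg n) Q < mmeasure (@mdeg n) P)%N].
Proof.
move=> PS dP nC.
have mP m i : mcoeff m P != 0 -> (m i)%:R = 0 :> L.
  have [-> //|mi0] := posnP (m i) => Pm.
  have Ui : mnm_add (mnm_sub m (mnm1 i)) (mnm1 i) = m.
    apply/mnmP => k; rewrite mnmDE mnmBE mnm1E.
    by case: eqP => [<-|_] /=; rewrite ?subn0 ?addn0 // subnK.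
  have := congr1 (mcoeff (mnm_sub m (mnm1 i))) (dP i).
  rewrite mcoeff_deriv Ui mcoeff0 mnmBE mnm1E eqxx -subSn // subSS subn0.
  by move=> /eqP; rewrite -(mulr_natr (mcoeff m P)) mulf_eq0 (negPf Pm) => /eqP.
have [m [Pm m0]] : exists m, mcoeff m P != 0 /\ m != @mnm0 n.
  apply: contrapT => nex; apply: nC; apply/mpolyP => m; rewrite mcoeffC.
  case: eqP => [->|/eqP m0]; first by rewrite mulr1.
  rewrite mulr0; apply/eqP; apply: contrapT => /negP Pm.
  by apply: nex; exists m.
have [i mi] : exists i, (0 < m i)%N.
  apply: contrapT => nex; move/negP: m0; apply; apply/eqP/mnmP => i; rewrite mnm0E.
  by apply/eqP; rewrite -leqn0 leqNgt; apply/negP => mi; apply: nex; exists i.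
have [p chp] : exists p, p \in [pchar L].
  by apply: (natf0_pchar mi); rewrite mP.
have p_pr : prime p by apply: pcharf_prime chp.
have p0 : (0 < p)%N by apply: prime_gt0.
have dvd k j : mcoeff k P != 0 -> (p %| k j)%N.
  by move=> Pk; rewrite (dvdn_pcharf chp) mP.
have /boolp.choice[r Hr] : forall c : L, exists b, b ^+ p = c by move=> c; apply: closed_root.
pose dm (k : multinom n) : multinom n := mpoly.Multinom [tuple (k i %/ p)%N | i < n].
have dmE k j : dm k j = (k j %/ p)%N by rewrite multinomE tnth_mktuple.
pose Q := \sum_(k <- msupp P) r (mcoeff k P) *: mpolyX L (dm k).
have supp k : k \in msupp P -> mcoeff k P != 0 by rewrite mcoeff_msupp.
have dmK k : k \in msupp P -> mnm_muln (dm k) p = k.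
  by move=> /supp kP; apply/mnmP => j; rewrite mulmnE dmE divnK // dvd.
exists p, Q; split.
- have chA : p \in [pchar mpoly n L] by rewrite pchar_lalg.
  rewrite -(pFrobenius_autE chA) rmorph_sum /= [LHS](mpolyE P).
  rewrite big_seq [RHS]big_seq; apply: eq_bigr => k kP.
  by rewrite pFrobenius_autE exprZn Hr mpolyXn dmK.
- rewrite /Q rmorph_sum /= big_seq [RHS]big_seq; apply: eq_bigr => k kP.
  rewrite -mul_mpolyC rmorphM /= restrC restr_monomial; case: ifP => //.
  move/negbT; rewrite negb_forall => /existsP[j]; rewrite negb_imply => /andP[jS].
  rewrite dmE => kj; have := supp _ kP; rewrite -PS mcoeff_restr.
  case: ifP; last by rewrite eqxx.
  by move/forallP/(_ j); rewrite jS => /eqP kj0; move: kj; rewrite kj0 div0n.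
have szP : (1 < mmeasure (@mdeg n) P)%N.
  apply: (@leq_ltn_trans (mdeg m)); first by rewrite lt0n mdeg_eq0.
  by apply: msize_mdeg_lt; rewrite mcoeff_msupp.
apply: (@leq_ltn_trans (mmeasure (@mdeg n) P).-1); last by rewrite prednK // ltnW.
apply: leq_trans (msize_sum _ _ _) _; rewrite big_seq.
elim/big_ind: _ => // [a b|k kP]; first by rewrite geq_max => -> ->.
apply: leq_trans (msizeZ_le _ _) _; rewrite msizeX.
have : (mdeg k < mmeasure (@mdeg n) P)%N by apply: msize_mdeg_lt.
rewrite -{1}(dmK k kP) mdegMn.
have := prime_gt1 p_pr; move: (mdeg _) => a p1 lt.
have : (a * 2 <= a * p)%N by rewrite leq_mul2l p1 orbT.
by move: szP lt; lia.
Qed.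

Section AlgebraicIndependence.
Variables (L : closedFieldType) (n : nat) (X : set ('I_n -> L)).
Hypothesis X_prime : forall f g, vanishes X (f * g) -> vanishes X f \/ vanishes X g.
Hypothesis X_nonempty : ~ vanishes X 1.
Variables (Y : {set 'I_n}) (D : mpoly n L).
Hypothesis nD : ~ vanishes X D.
Hypothesis Y_tangent : forall x, X x -> meval x D != 0 -> forall i, i \in Y ->
  exists y, [/\ tangent X x y, y i = 1 & forall k, k \in Y -> k != i -> y k = 0].

(* The derivatives of a relation of minimal degree vanish, hence it is a p-th
   power, as L is perfect. *)
Lemma coordinates_independent P : restr Y P = P -> vanishes X P -> P = 0.
Proof.
move=> PY IP; apply: contrapT => P0.
have [Q [[QY IQ Q0] Qmin]] : exists Q, [/\ restr Y Q = Q, vanishes X Q & Q <> 0] /\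
    forall Q', [/\ restr Y Q' = Q', vanishes X Q' & Q' <> 0] ->
    (mmeasure (@mdeg n) Q <= mmeasure (@mdeg n) Q')%N.
  by apply: min_witness; exists P.
have IdQ i : vanishes X (mderiv i Q).
  have [iY|iY] := boolP (i \in Y); last first.
    by rewrite (mderiv_restr_eq0 QY) //; apply: vanishes0.
  suff : vanishes X (D * mderiv i Q) by case/X_prime.
  move=> x Xx; rewrite mevalM; have [->|Dx] := eqVneq (meval x D) 0.
    by rewrite mul0r.
  have [y [ty yi yk]] := Y_tangent Xx Dx iY.
  have := ty _ IQ; rewrite (bigD1 i) //= yi mulr1 big1 ?addr0 => [->|k ki].
    by rewrite mulr0.
  have [kY|kY] := boolP (k \in Y); first by rewrite yk ?mulr0.
  by rewrite (mderiv_restr_eq0 QY) // meval0 mul0r.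
have dQ i : mderiv i Q = 0.
  apply: contrapT => dQ; have := Qmin _ (And3 (restr_mderiv i QY) (IdQ i) dQ).
  rewrite leqNgt => /negP; apply.
  have := @mpolySpred n L (@mdeg n) Q; have -> : Q != 0 by apply/eqP.
  move=> /(_ isT) ->; rewrite ltnS.
  apply/bigmax_leqP_seq => m mQ _.
  move: mQ; rewrite mcoeff_msupp mcoeff_deriv => Qm.
  have : (mdeg (mnm_add m (mnm1 i)) < mmeasure (@mdeg n) Q)%N.
    apply: msize_mdeg_lt; rewrite mcoeff_msupp.
    by apply: contraNneq Qm => ->; rewrite mul0rn.
  by rewrite mdegD mdeg1 addn1 => H; rewrite -ltnS (leq_trans H) // leqSpred.
have [QC|QC] := pselect (Q = mpolyC n (mcoeff (@mnm0 n) Q)).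
  have [x Xx _] := nvanishesP X_nonempty.
  by have := IQ x Xx; rewrite QC mevalC => c0; apply: Q0; rewrite QC c0 mpolyC0.
have [p [Q' [QE Q'Y szQ']]] := mderiv_eq0_root QY dQ QC.
have IQ' : vanishes X Q'.
  by apply: (@vanishesX _ _ X X_prime X_nonempty _ p); rewrite -QE.
have Q'0 : Q' <> 0.
  move=> Q'0; case: p QE => [|p] QE; last by apply: Q0; rewrite QE Q'0 expr0n.
  by apply: X_nonempty; rewrite -(expr0 Q') -QE.
by have := Qmin _ (And3 Q'Y IQ' Q'0); rewrite leqNgt szQ'.
Qed.

End AlgebraicIndependence.

(** * Irreducibility of homogeneous connected closed sets *)

Local Notation msz p := (mmeasure (@mdeg _) p).

Section LinearSubstitution.
Variables (L : fieldType) (n : nat).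
Implicit Types (M : 'M[L]_n) (f : mpoly n L) (v : 'I_n -> L).

Definition act M v : 'I_n -> L := fun k => \sum_l v l * M l k.

Definition linear_subst M : mpoly n L -> mpoly n L :=
  mmap (mpolyC n (R := L)) (fun k => \sum_l mpolyC n (M l k) * mvar l).
HB.instance Definition _ M := GRing.RMorphism.on (linear_subst M).

Lemma mmap_linear_subst (T : comRingType) (h : {rmorphism L -> T}) M w f :
  mmap h w (linear_subst M f) = mmap h (fun k => \sum_l h (M l k) * w l) f.
Proof.
rewrite mmap_mmap; apply: mmap_eq => k; rewrite rmorph_sum /=.
by apply: eq_bigr => l _; rewrite rmorphM /= mmapC mmap_var.
Qed.

Lemma meval_linear_subst M v f : meval v (linear_subst M f) = meval (act M v) f.
Proof.
rewrite [LHS]mmap_linear_subst; apply: mmap_eq => k.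
by apply: eq_bigr => l _; rewrite /= mulrC.
Qed.

(** Allows translates of a set cut out in bounded degree to be cut out with the same bound. *)
Lemma msize_linear_subst M f : (msz (linear_subst M f) <= msz f)%N.
Proof.
have ML (p q : mpoly n L) : (msz (p * q) <= (msz p + msz q).-1)%N.
  have [->|p0] := eqVneq p 0; first by rewrite mul0r msize0.
  have [->|q0] := eqVneq q 0; first by rewrite mulr0 msize0.
  by rewrite msizeM.
rewrite [in X in (X <= _)%N](mpolyE f) rmorph_sum /=.
apply: leq_trans (msize_sum _ _ _) _; rewrite big_seq.
elim/big_ind: _ => // [a b|m mf]; first by rewrite geq_max => -> ->.
rewrite -mul_mpolyC rmorphM /= /linear_subst mmapC mul_mpolyC.
apply: leq_trans (msizeZ_le _ _) _; apply: leq_trans (msize_mdeg_lt mf).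
rewrite mmapX /mmap1 mdegE.
elim/big_ind2: _ => [|a p b q Hp Hq|i _]; first by rewrite msize1.
  by apply: leq_trans (ML _ _) _; lia.
have s1 : (msz (\sum_l mpolyC n (M l i) * mvar l) <= 2)%N.
  apply: leq_trans (msize_sum _ _ _) _; elim/big_ind: _ => // [a b|l _].
    by rewrite geq_max => -> ->.
  by rewrite mul_mpolyC; apply: leq_trans (msizeZ_le _ _) _; rewrite msizeX mdeg1.
elim: (m i) => [|e IH]; first by rewrite expr0 msize1.
by rewrite exprS; apply: leq_trans (ML _ _) _; lia.
Qed.

End LinearSubstitution.

Section Irreducibility.
Variables (L : fieldType) (n : nat) (X : set ('I_n -> L)).
Implicit Types (p q f : mpoly n L) (x y : 'I_n -> L) (Z : set ('I_n -> L)).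

Hypothesis X_homogeneous : forall x y, X x -> X y -> exists M M' : 'M[L]_n,
  [/\ forall v, X v -> X (act M v) /\ X (act M' v),
    forall v, X v -> act M' (act M v) = v /\ act M (act M' v) = v & act M x = y].
Hypothesis X_connected : forall S1 S2 : set (mpoly n L),
  (forall x, X x -> (forall p, S1 p -> meval x p = 0) \/
                    (forall p, S2 p -> meval x p = 0)) ->
  (forall x, X x -> (forall p, S1 p -> meval x p = 0) ->
                    (forall p, S2 p -> meval x p = 0) -> False) ->
  (forall x, X x -> ~ forall p, S1 p -> meval x p = 0) \/
  (forall x, X x -> ~ forall p, S2 p -> meval x p = 0).
Hypothesis X_nonempty : exists x, X x.

Section BoundedDegree.
Variable k : nat.

(* With bounded degrees all equations lie in a finite-dimensional space, so that
   the decomposition into irreducible pieces terminates by a rank argument. *)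
Definition cut_out Z := exists W : set (mpoly n L),
  (forall p, W p -> (msz p <= k)%N) /\
  forall x, Z x <-> X x /\ forall p, W p -> meval x p = 0.

(** A list is used instead of a product of two polynomials because products would leave the degree
    bound. The empty list makes Z non-empty. *)
Definition irreducible_set Z := forall s : seq (mpoly n L),
  (forall p, p \in s -> (msz p <= k)%N) ->
  (forall x, Z x -> exists2 p, p \in s & meval x p = 0) ->
  exists2 p, p \in s & forall x, Z x -> meval x p = 0.

(** The largest such t is the dimension of the space of functions on Z given by polynomials within
    the degree bound. *)
Let independent Z t := exists (p : 'I_t -> mpoly n L) (x : 'I_t -> 'I_n -> L),
  [/\ forall i, (msz (p i) <= k)%N, forall i, Z (x i) &
    \matrix_(i, j) meval (x j) (p i) \in unitmx].

Lemma independent_bound Z t : independent Z t -> (t <= #|{: bmultinom n k}|)%N.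
Proof.
move=> [p [x [pk _ U]]]; set d := #|_|.
rewrite -[X in (X <= _)%N](mxrank_unit U).
have -> : \matrix_(i, j) meval (x j) (p i) =
    (\matrix_(i < t, a < d) mcoeff (enum_val a : bmultinom n k) (p i)) *m
    (\matrix_(a < d, j < t) mmap1 (x j) (enum_val a : bmultinom n k)).
  apply/matrixP => i j; rewrite !mxE /meval (mmapE k) ?pk //.
  rewrite (reindex (@enum_val _ [pred _ : bmultinom n k | true])) /=; last first.
    exact: onW_bij (enum_val_bij _).
  by apply: eq_bigr => a _; rewrite !mxE.
exact: mulmx_max_rank.
Qed.

(** Since p vanishes at the old points but not at x, adding both gives a block triangular matrix:
    the dimension drops strictly on a proper piece. *)
Lemma independentS Z p x t : cut_out Z -> (msz p <= k)%N -> Z x -> meval x p != 0 ->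
  independent [set y | Z y /\ meval y p = 0]%classic t -> independent Z t.+1.
Proof.
move=> _ pk Zx px [q [y [qk Zy U]]]; rewrite -addn1.
exists (fun i => match fintype.split i with inl a => q a | inr _ => p end).
exists (fun i => match fintype.split i with inl a => y a | inr _ => x end).
split=> [i|i|]; do ?by case: fintype.split => // a; case: (Zy a).
pose b : 'cV[L]_t := \col_i meval x (q i).
suff -> : (\matrix_(i, j) meval (match fintype.split j with inl a => y a | inr _ => x end)
    (match fintype.split i with inl a => q a | inr _ => p end) : 'M[L]_(t + 1)) =
    block_mx (\matrix_(i, j) meval (y j) (q i)) b 0 (meval x p)%:M.
  rewrite unitmxE det_ublock det_scalar1 unitrM -unitmxE U unitfE /=.
  exact: px.
apply/matrixP => i j; rewrite -[i]splitK -[j]splitK.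
case: (fintype.split i) => a; case: (fintype.split j) => c; rewrite mxE !unsplitK /=.
- by rewrite block_mxEul mxE.
- by rewrite block_mxEur mxE.
- by rewrite block_mxEdl mxE; case: (Zy c).
- by rewrite block_mxEdr !ord1 mxE.
Qed.

Lemma cut_outI Z p : (msz p <= k)%N -> cut_out Z ->
  cut_out [set y | Z y /\ meval y p = 0]%classic.
Proof.
move=> pk [W [Wk WZ]]; exists [set q | W q \/ q = p]%classic; split.
  by move=> q [/Wk//|->].
move=> x; split=> [[/WZ[Xx Wx] px]|[Xx Wx]].
  by split=> // q [/Wx|->].
split; last by apply: Wx; right.
by apply/WZ; split=> // q Wq; apply: Wx; left.
Qed.

Definition component_family m (F : nat -> set ('I_n -> L)) Z :=
  (forall i, (i < m)%N -> cut_out (F i) /\ irreducible_set (F i)) /\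
  forall x, Z x <-> exists2 i, (i < m)%N & F i x.

Lemma component_familyU m1 m2 F1 F2 Z1 Z2 :
  component_family m1 F1 Z1 -> component_family m2 F2 Z2 ->
  exists m F, component_family m F [set x | Z1 x \/ Z2 x]%classic.
Proof.
move=> [I1 U1] [I2 U2]; exists (m1 + m2)%N.
exists (fun i => if (i < m1)%N then F1 i else F2 (i - m1)%N); split=> [i im|x].
  by case: ltnP => im1; [apply: I1|apply: I2; lia].
split=> [[/U1[i im Fx]|/U2[i im Fx]]|[i im]].
- by exists i; [lia|rewrite im].
- by exists (m1 + i)%N; [lia|rewrite ltnNge leq_addr /= addKn].
- case: ltnP => im1 Fx; first by left; apply/U1; exists i.
  by right; apply/U2; exists (i - m1)%N => //; lia.
Qed.

Lemma decomposition Z : cut_out Z -> exists m F, component_family m F Z.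
Proof.
suff H b Z' : cut_out Z' -> (forall t, independent Z' t -> (t < b)%N) ->
    exists m F, component_family m F Z'.
  by move=> cZ; apply: (H #|{: bmultinom n k}|.+1) => // t /independent_bound.
elim: b Z' => [|b IH] {}Z cZ Zb.
  suff /Zb : independent Z 0 by [].
  exists (fun _ => 0), (fun _ _ => 0); split=> [[]|[]|] //.
  by rewrite unitmxE det_mx00 unitr1.
have [Zirr|] := pselect (irreducible_set Z).
  exists 1%N, (fun _ => Z); split=> [i _|x]; first by split.
  by split=> [Zx|[i _]//]; exists 0%N.
move=> /existsNP[s /not_implyP[sk /not_implyP[sZ nsZ]]].
have pZ p : p \in s -> exists2 x, Z x & meval x p != 0.
  move=> ps; apply: contrapT => nex; apply: nsZ; exists p => // x Zx.
  by apply/eqP; apply: contrapT => /negP px; apply: nex; exists x.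
suff [m [F [I U]]] : exists m F, component_family m F
    [set x | exists2 p, p \in s & Z x /\ meval x p = 0]%classic.
  exists m, F; split=> // x; rewrite -U /=; split=> [Zx|[p _ []//]].
  by have [p ps px] := sZ _ Zx; exists p.
elim: s sk pZ {sZ nsZ} => [|p s IHs] sk pZ.
  exists 0%N, (fun _ => Z); split=> // x; split=> [[p]|[i]] //.
have [|q qs|m1 [F1 fam1]] := IHs.
- by move=> q qs; apply: sk; rewrite inE qs orbT.
- by apply: pZ; rewrite inE qs orbT.
have pk : (msz p <= k)%N by apply: sk; rewrite inE eqxx.
have [|t It|m2 [F2 fam2]] := IH [set y | Z y /\ meval y p = 0]%classic.
- exact: cut_outI.
- have [x Zx px] := pZ p (mem_head _ _).
  by have := Zb _ (independentS cZ pk Zx px It).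
have [m [F [I U]]] := component_familyU fam2 fam1.
exists m, F; split=> // x; rewrite -U /=; split.
  by move=> [q]; rewrite inE => /predU1P[->|qs] Zq; [left|right; exists q].
by move=> [Zp|[q qs Zq]]; [exists p => //; rewrite mem_head|exists q; rewrite // inE qs orbT].
Qed.

(** Otherwise, one equation of each [F i] not vanishing on Z yields a list that covers Z while no
    member vanishes on Z. *)
Lemma irreducible_subset m (F : nat -> set ('I_n -> L)) Z :
  (forall i, (i < m)%N -> cut_out (F i)) -> irreducible_set Z ->
  (forall x, Z x -> exists2 i, (i < m)%N & F i x) ->
  exists2 i, (i < m)%N & forall x, Z x -> F i x.
Proof.
move=> cF Zirr ZF; apply: contrapT => nex.
have ZX x : Z x -> X x.
  by move=> /ZF[i im]; have [W [_ WF]] := cF i im; move=> /WF[].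
have /boolp.choice[p Hp] : forall i, exists p, (i < m)%N -> [/\ (msz p <= k)%N,
    forall x, F i x -> meval x p = 0 & exists2 x, Z x & meval x p != 0].
  move=> i; have [im|im] := boolP (i < m)%N; last by exists 0.
  have [W [Wk WF]] := cF i im.
  have [x [Zx nFx]] : exists x, Z x /\ ~ F i x.
    apply: contrapT => nx; apply: nex; exists i => // x Zx.
    by apply: contrapT => nFx; apply: nx; exists x.
  have [q [Wq qx]] : exists q, W q /\ meval x q != 0.
    apply: contrapT => nq; apply: nFx; apply/WF; split; first exact: ZX.
    by move=> q Wq; apply/eqP; apply: contrapT => /negP qx; apply: nq; exists q.
  exists q => _; split; [exact: Wk| |by exists x].
  by move=> y /WF[_]; apply.
have [q||q qs qZ] := Zirr [seq p i | i <- iota 0 m].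
- by case/mapP => i; rewrite mem_iota => /= im ->; case: (Hp i im).
- move=> x /ZF[i im Fx]; exists (p i); first by apply: map_f; rewrite mem_iota.
  by case: (Hp i im) => _ /(_ _ Fx).
move: qs qZ => /mapP[i]; rewrite mem_iota /= => im -> pZ.
by have [_ _ [x /pZ ->]] := Hp i im; rewrite eqxx.
Qed.

Lemma translate_irreducible (M M' : 'M[L]_n) Z :
  (forall v, X v -> X (act M v) /\ X (act M' v)) ->
  (forall v, X v -> act M' (act M v) = v /\ act M (act M' v) = v) ->
  cut_out Z -> irreducible_set Z ->
  cut_out [set y | X y /\ Z (act M y)]%classic /\
  irreducible_set [set y | X y /\ Z (act M y)]%classic.
Proof.
move=> MX MK [W [Wk WZ]] Zirr; split.
  exists [set linear_subst M p | p in W]%classic; split.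
    by move=> _ [p Wp <-]; apply: leq_trans (msize_linear_subst _ _) (Wk _ Wp).
  move=> x; split=> [[Xx /WZ[_ Wx]]|[Xx Wx]].
    by split=> // _ [p Wp <-]; rewrite meval_linear_subst Wx.
  split=> //; apply/WZ; split; first by case: (MX x Xx).
  by move=> p Wp; rewrite -meval_linear_subst; apply: Wx; exists p.
move=> s sk sZ.
have [q||q qs qZ] := Zirr [seq linear_subst M' p | p <- s].
- by case/mapP => p ps ->; apply: leq_trans (msize_linear_subst _ _) (sk _ ps).
- move=> x Zx; have Xx : X x by case/WZ: Zx.
  have [p ps px] : exists2 p, p \in s & meval (act M' x) p = 0.
    by apply: sZ; split; [case: (MX x Xx)|case: (MK x Xx) => _ ->].
  by exists (linear_subst M' p); [apply: map_f|rewrite meval_linear_subst].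
case/mapP: qs qZ => p ps -> pZ; exists p => // x [Xx Zx].
by have := pZ _ Zx; rewrite meval_linear_subst; case: (MK x Xx) => ->.
Qed.

(** A point lying on a single component can be moved to any other point, so the components are
    pairwise disjoint closed sets, and connectedness leaves only one. *)
Lemma irreducible_X : irreducible_set X.
Proof.
have cX : cut_out X by exists set0; split=> // x; split=> [|[]].
have [m [[F [I U]] mmin]] : exists m, (exists F, component_family m F X) /\
    forall m', (exists F, component_family m' F X) -> (m <= m')%N.
  have [m [F fam]] := decomposition cX.
  by apply: (@min_witness nat (fun m => exists F, component_family m F X) id); exists m, F.
have FX i x : (i < m)%N -> F i x -> X x by move=> im Fx; apply/U; exists i.
(* By minimality of the number of components, each has a point of its own. *)
have own i : (i < m)%N -> exists2 x, F i x &
    forall j, (j < m)%N -> F j x -> j = i.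
  move=> im; apply: contrapT => nex.
  have Fi x : F i x -> exists j, [/\ (j < m)%N, F j x & j <> i].
    move=> Fx; apply: contrapT => nj; apply: nex; exists x => // j jm Fj.
    by apply: contrapT => ji; apply: nj; exists j.
  suff /mmin : exists G, component_family m.-1 G X by case: m im {I U mmin FX nex Fi} => // m _; rewrite ltnn.
  exists (fun j => F (bump i j)); split=> [j jm|x].
    by apply: I; move: jm; rewrite /bump; case: leqP; lia.
  rewrite U; split=> [[j jm Fj]|[j jm Fj]]; last first.
    by exists (bump i j) => //; move: jm; rewrite /bump; case: leqP; lia.
  have [j' [j'm Fj' j'i]] : exists j, [/\ (j < m)%N, F j x & j <> i].
    by have [ji|ji] := eqVneq j i; [apply: Fi; rewrite -ji|exists j; split=> //; apply/eqP].
  exists (unbump i j'); first by rewrite /unbump; case: ltnP; lia.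
  by rewrite unbumpK // inE; apply/eqP.
have disj i j x : (i < m)%N -> (j < m)%N -> F i x -> F j x -> i = j.
  move=> im jm Fix Fjx.
  have [x0 Fx0 x0u] := own i im.
  have [M [M' [MX MK Mx]]] := X_homogeneous (FX _ _ im Fx0) (FX _ _ im Fix).
  (* If [F a] contains x, its inverse image [T a] contains x0, which lies on [F i] alone; hence
     [T a] is inside [F i]. Moving [F i] back by M, all components through x land in a single
     one. *)
  pose T a := [set y | X y /\ F a (act M y)]%classic.
  have Ti a : (a < m)%N -> F a x -> forall y, T a y -> F i y.
    move=> am Fax; have [cFa iFa] := I a am.
    have [_ iT] := translate_irreducible MX MK cFa iFa.
    have [|y [Xy _]|i' i'm Ti'] := irreducible_subset (m := m) (F := F) _ iT.
    - by move=> b bm; case: (I b bm).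
    - by apply/U.
    rewrite -(x0u i' i'm) //; apply: Ti'; split; first exact: FX Fx0.
    by rewrite Mx.
  have MX' v : X v -> X (act M' v) /\ X (act M v) by move=> /MX[].
  have MK' v : X v -> act M (act M' v) = v /\ act M' (act M v) = v by move=> /MK[].
  have [cFi iFi] := I i im.
  have [_ iT'] := translate_irreducible MX' MK' cFi iFi.
  have [|y [Xy _]|l lm Tl] := irreducible_subset (m := m) (F := F) _ iT'.
  - by move=> b bm; case: (I b bm).
  - by apply/U.
  have sub a : (a < m)%N -> F a x -> forall y, F a y -> F l y.
    move=> am Fax y Fy; have Xy := FX _ _ am Fy.
    apply: Tl; split=> //; apply: (Ti a am Fax); split; first by case: (MX y Xy).
    by case: (MK y Xy) => _ ->.
  have ul a : (a < m)%N -> F a x -> l = a.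
    by move=> am Fax; have [y Fy yu] := own a am; apply: yu => //; apply: sub Fy.
  by rewrite -(ul i im Fix) (ul j jm Fjx).
have [x Xx] := X_nonempty.
have [i0 i0m _] := (U x).1 Xx.
have m1 : m = 1%N.
  apply/eqP; rewrite eqn_leq (leq_ltn_trans _ i0m) // andbT leqNgt; apply/negP => m2.
  have m0 : (0 < m)%N by apply: leq_trans m2.
  have [[W0 [_ W0F]] _] := I 0%N m0.
  have /boolp.choice[W HW] : forall j, exists W : set (mpoly n L), (j < m)%N ->
      forall x, F j x <-> X x /\ forall p, W p -> meval x p = 0.
    move=> j; have [jm|jm] := boolP (j < m)%N; last by exists set0.
    by have [[W [_ WF]] _] := I j jm; exists W.
  (* Products of one equation from each component other than [F 0] cut out the union of these
     components. *)
  pose S2 := [set \prod_(1 <= j < m) q j | q in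
    [set q : nat -> mpoly n L | forall j, (0 < j < m)%N -> W j (q j)]]%classic.
  have S2F y j : (0 < j < m)%N -> F j y -> forall p, S2 p -> meval y p = 0.
    move=> /andP[j0 jm] Fy _ [q Wq <-]; rewrite rmorph_prod /=.
    apply/eqP; rewrite prodf_seq_eq0; apply/hasP; exists j.
      by rewrite mem_index_iota j0.
    by apply/eqP; case/(HW j jm): Fy => _; apply; apply: Wq; rewrite j0.
  have FS2 y : X y -> (forall p, S2 p -> meval y p = 0) -> exists2 j, (0 < j < m)%N & F j y.
    move=> Xy S2y; apply: contrapT => nex.
    have /boolp.choice[q Hq] : forall j, exists q, (0 < j < m)%N -> W j q /\ meval y q != 0.
      move=> j; have [jm|jm] := boolP (0 < j < m)%N; last by exists 0.
      apply: contrapT => nq; apply: nex; exists j => //.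
      have /andP[_ jm'] := jm; apply/HW => //; split=> // p Wp; apply/eqP.
      by apply: contrapT => /negP py; apply: nq; exists p.
    have : meval y (\prod_(1 <= j < m) q j) = 0.
      by apply: S2y; exists q => // j /Hq[].
    rewrite rmorph_prod /= => /eqP; rewrite prodf_seq_eq0 => /hasP[j].
    by rewrite mem_index_iota => /Hq[_ /negPf ->].
  have [|||] := X_connected (S1 := W0) (S2 := S2).
  - move=> y Xy; have [j jm Fy] := (U y).1 Xy.
    case: j jm Fy => [|j] jm Fy; first by left; case/W0F: Fy.
    by right; apply: (S2F _ _ _ Fy).
  - move=> y Xy W0y /(FS2 _ Xy)[j /andP[j0 jm] Fy].
    have F0 : F 0%N y by apply/W0F.
    by have := disj _ _ _ m0 jm F0 Fy => j00; rewrite -j00 in j0.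
  - move=> H; have [y Fy _] := own _ m0; have [Xy W0y] := (W0F y).1 Fy.
    exact: H Xy W0y.
  - move=> H; have [y Fy _] := own _ m2; apply: (H y); first exact: FX Fy.
    exact: (S2F _ 1%N).
have XF : X = F 0%N.
  apply/seteqP; split=> y; first by move/U => [i]; rewrite m1 ltnS leqn0 => /eqP ->.
  by move=> Fy; apply/U; exists 0%N; rewrite ?m1.
by rewrite XF; case: (I 0%N); rewrite ?m1.
Qed.

End BoundedDegree.

Theorem vanishes_prime f g : vanishes X (f * g) -> vanishes X f \/ vanishes X g.
Proof.
move=> Ifg; have [p|x Xx|p] := irreducible_X (k := maxn (msz f) (msz g)) (s := [:: f; g]).
- by rewrite !inE => /orP[]/eqP ->; rewrite leq_max leqnn ?orbT.
- have /eqP := Ifg x Xx; rewrite mevalM mulf_eq0 => /orP[]/eqP E.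
    by exists f; rewrite // inE eqxx.
  by exists g; rewrite // !inE eqxx orbT.
by rewrite !inE => /orP[]/eqP ->; [left|right].
Qed.

End Irreducibility.

(** * Arcs in a matrix group *)

Definition vec (R : Type) (n : nat) (A : 'M[R]_n) : 'I_(n * n) -> R := mxvec A 0.

Lemma vecK (R : nzRingType) n (A : 'M[R]_n) : vec_mx (\row_k vec A k) = A.
Proof. by rewrite -[RHS]mxvecK; congr vec_mx; apply/rowP => k; rewrite mxE. Qed.

Lemma vec_inj (R : nzRingType) n (A B : 'M[R]_n) : vec A =1 vec B -> A = B.
Proof. by move=> AB; rewrite -(vecK A) -(vecK B); congr vec_mx; apply/rowP => k; rewrite !mxE AB. Qed.

Lemma vec_of_row (R : nzRingType) n (v : 'I_(n * n) -> R) : vec (vec_mx (\row_k v k)) = v.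
Proof. by apply/funext => k; rewrite /vec vec_mxK mxE. Qed.

Lemma vec_map (R S : Type) n (h : R -> S) (A : 'M[R]_n) k : vec (map_mx h A) k = h (vec A k).
Proof. by rewrite /vec; case/mxvec_indexP: k => i j; rewrite !mxvecE mxE. Qed.

Lemma vecD (R : nzRingType) n (A B : 'M[R]_n) k : vec (A + B) k = vec A k + vec B k.
Proof. by rewrite /vec linearD mxE. Qed.

Lemma vecZ (R : comNzRingType) n a (A : 'M[R]_n) k : vec (a *: A) k = a * vec A k.
Proof. by rewrite /vec linearZ mxE. Qed.

Lemma act_mulmx (L : fieldType) n (A C : 'M[L]_n) :
  act (lin_mx (mulmx A)) (vec C) = vec (A *m C).
Proof. by apply/funext => k; rewrite /vec -mul_vec_lin mxE. Qed.

Lemma unitmx_ker (L : fieldType) n (T : 'M[L]_n) :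
  (forall s : 'rV_n, s *m T = 0 -> s = 0) -> T \in unitmx.
Proof.
move=> H; rewrite unitmxE unitfE; apply/negP => /det0P[v v0 vT].
by rewrite (H _ vT) eqxx in v0.
Qed.

Definition mxcong (L : fieldType) n k (A B : 'M[{poly L}]_n) :=
  forall i j, 'X^k %| A i j - B i j.

Lemma mxcong_vec (L : fieldType) n k (A B : 'M[{poly L}]_n) :
  mxcong k A B <-> forall i, 'X^k %| vec A i - vec B i.
Proof.
split=> H; first by move=> i; rewrite /vec; case/mxvec_indexP: i => i j; rewrite !mxvecE.
by move=> i j; have := H (mxvec_index i j); rewrite /vec !mxvecE.
Qed.

Section MatrixGroupArcs.
Variables (L : closedFieldType) (n : nat) (G : set 'M[L]_n).

Definition points : set ('I_(n * n) -> L) := [set vec A | A in G]%classic.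

Hypothesis G1 : G 1%:M.
Hypothesis GM : forall A B, G A -> G B -> G (A *m B).
Hypothesis GV : forall A, G A -> G (invmx A).
Hypothesis GU : forall A, G A -> A \in unitmx.

Lemma points_homogeneous x y : points x -> points y -> exists M M' : 'M[L]_(n * n),
  [/\ forall v, points v -> points (act M v) /\ points (act M' v),
    forall v, points v -> act M' (act M v) = v /\ act M (act M' v) = v & act M x = y].
Proof.
move=> [A GA <-] [B GB <-].
have [C [GC CA]] : exists C, G C /\ C *m A = B.
  exists (B *m invmx A); rewrite -mulmxA mulVmx ?mulmx1 ?GU //; split=> //.
  by apply: GM => //; apply: GV.
exists (lin_mx (mulmx C)), (lin_mx (mulmx (invmx C))); split.
- move=> _ [D GD <-]; rewrite !act_mulmx; split; [exists (C *m D)|exists (invmx C *m D)] => //.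
    exact: GM.
  by apply: GM => //; apply: GV.
- by move=> _ [D GD <-]; rewrite !act_mulmx !mulmxA mulVmx ?mulmxV ?mul1mx ?GU.
- by rewrite act_mulmx CA.
Qed.

Definition arc M (c : 'M[{poly L}]_n) :=
  forall f, vanishes points f -> 'X^M %| pev (vec c) f.

Lemma arc_const M A : G A -> arc M (map_mx polyC A).
Proof.
move=> GA f If; rewrite (pev_eq (w := fun i => (vec A i)%:P)) => [|i]; last exact: vec_map.
by rewrite pev_const If ?polyC0 ?dvdp0 //; exists A.
Qed.

Lemma arc_cong M b c : mxcong M b c -> arc M c -> arc M b.
Proof.
move=> /mxcong_vec bc ac f If.
by rewrite -(subrK (pev (vec c) f) (pev _ f)) dvdp_add ?ac // dvdp_pev_sub.
Qed.

Lemma arc_comp M c s m : (0 < m)%N -> arc M c -> arc M (map_mx (comp_poly (s *: 'X^m)) c).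
Proof.
move=> m0 ac f If; rewrite (pev_eq (w := fun i => vec c i \Po (s *: 'X^m))) => [|i]; last exact: vec_map.
rewrite -pev_comp; have /dvdpP[u ->] := ac f If.
rewrite comp_polyM comp_Xn_poly exprZn -exprM; apply: dvdp_mull.
rewrite -mul_polyC; apply: dvdp_mull; apply: dvdp_exp2l.
by rewrite leq_pmull.
Qed.

(** Expand f(b w) in powers of the parameter of b. For fixed B in G, f(w B) is an equation of G, so
    f(b B) vanishes to order M. Hence the coefficients of order less than M are equations of G in w,
    which the arc c satisfies. *)
Lemma arc_mul M b c : arc M b -> arc M c -> arc M (b *m c).
Proof.
move=> ab ac f If.
pose N := (n * n)%N; pose A := mpoly N L.
pose Mb : 'M[{poly L}]_N := lin_mx (mulmx b).
(* [Phi f] is f(b w) with indeterminate entries of w; the polynomial variable is the parameter of b.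
   Evaluating it at ['X] identifies it with the parameter of w. *)
pose Phi : A -> {poly A} := mmap (polyC \o mpolyC N (R := L))
  (fun k => \sum_l (mvar l)%:P * map_poly (mpolyC N (R := L)) (Mb l k)).
have PhiE (w : 'M[{poly L}]_n) : (map_poly (pev (vec w)) (Phi f)).['X] = pev (vec (b *m w)) f.
  rewrite -[LHS]/((horner_eval 'X \o map_poly (pev (vec w))) (Phi f)).
  rewrite /Phi (@rmorph_mmap _ _ _ _ _ (horner_eval 'X \o map_poly (pev (vec w))) polyC); last first.
    by move=> a; rewrite /= map_polyC /= pevC /horner_eval hornerC.
  apply: mmap_eq => k; rewrite /= rmorph_sum /= /horner_eval horner_sum.
  rewrite /vec -[b *m w]/(mulmx b w) -mul_vec_lin mxE.
  apply: eq_bigr => l _; rewrite rmorphM /= map_polyC /= pev_var hornerM hornerC.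
  congr (_ * _); rewrite -map_poly_comp.
  rewrite (eq_map_poly (g := polyC)) => [|a]; last by rewrite /= pevC.
  by rewrite -[LHS]/(Mb l k \Po 'X) comp_polyXr.
have cI k : (k < M)%N -> vanishes points (Phi f)`_k.
  move=> kM _ [B GB <-].
  have E : map_poly (meval (vec B)) (Phi f) = pev (vec (b *m map_mx polyC B)) f.
    rewrite -PhiE -[LHS]comp_polyXr /comp_poly -map_poly_comp; congr (_.[_]).
    apply: eq_map_poly => g /=; rewrite -pev_const; apply: pev_eq => i.
    by rewrite vec_map.
  have fB : vanishes points (linear_subst (lin_mx (mulmxr B)) f).
    move=> _ [C GC <-]; rewrite meval_linear_subst.
    have -> : act (lin_mx (mulmxr B)) (vec C) = vec (C *m B).
      by apply/funext => i; rewrite /vec -[C *m B]/(mulmxr B C) -mul_vec_lin mxE.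
    by apply: If; exists (C *m B) => //; apply: GM.
  have := ab _ fB; rewrite /pev mmap_linear_subst.
  rewrite (mmap_eq _ (w := vec (b *m map_mx polyC B))) => [|i]; last first.
    rewrite /vec -[b *m _]/(mulmxr (map_mx polyC B) b) -mul_vec_lin mxE.
    apply: eq_bigr => l _; rewrite mulrC; congr (_ * _).
    rewrite -(@map_lin_mx _ _ polyC _ _ _ _ (mulmxr B)) ?mxE // => C /=.
    exact: map_mxM.
  rewrite -/(pev _ _) -E => /dvdp_XnP/(_ k kM).
  by rewrite coef_map.
rewrite -PhiE horner_coef; elim/big_rec: _ => [|k g _ Hg]; first exact: dvdp0.
apply: dvdp_add => //; rewrite coef_map.
have [kM|Mk] := ltnP k M; first by apply: dvdp_mulr; apply: ac; apply: cI.
by apply: dvdp_mull; apply: dvdp_exp2l.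
Qed.

End MatrixGroupArcs.

(** * Local coordinates at the identity *)

Lemma mderiv_map (R S : comNzRingType) (h : {rmorphism R -> S}) n k (f : mpoly n R) :
  mderiv k (map_mpoly h f) = map_mpoly h (mderiv k f).
Proof.
by apply/mpolyP => m; rewrite mcoeff_deriv !mcoeff_map_mpoly mcoeff_deriv raddfMn.
Qed.

Lemma mmap_map_mpoly (R S : comNzRingType) (T : comRingType) (h : {rmorphism R -> S})
    (g : {rmorphism S -> T}) n (v : 'I_n -> T) (f : mpoly n R) :
  mmap g v (map_mpoly h f) = mmap (g \o h) v f.
Proof.
have := @mpoly_rmorph_eq n R T (mmap g v \o map_mpoly h) (mmap (g \o h) v).
by apply => [c|i] /=; rewrite ?map_mpolyC ?map_mpolyX ?mmapC ?mmap_var.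
Qed.

Lemma meval_map_mpoly (R S : comNzRingType) (h : {rmorphism R -> S}) n
    (v : 'I_n -> R) (f : mpoly n R) :
  meval (h \o v) (map_mpoly h f) = h (meval v f).
Proof. by rewrite /meval mmap_map_mpoly (@rmorph_mmap _ _ _ _ _ h h). Qed.

Lemma vec1_map (R S : nzRingType) (h : {rmorphism R -> S}) n :
  vec (1%:M : 'M[S]_n) = h \o vec (1%:M : 'M[R]_n).
Proof. by apply/funext => k /=; rewrite -(vec_map h) map_mx1. Qed.

Section GroupCoordinates.
Variables (F : fieldType) (L : closedFieldType) (iota : {rmorphism F -> L}).
Variables (n : nat) (G : set 'M[L]_n).
Local Notation N := (n * n)%N.
Local Notation X := (points G).

Hypothesis G1 : G 1%:M.
Hypothesis GM : forall A B, G A -> G B -> G (A *m B).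
Hypothesis GV : forall A, G A -> G (invmx A).
Hypothesis GU : forall A, G A -> A \in unitmx.
Hypothesis G_prime : forall f g, vanishes X (f * g) -> vanishes X f \/ vanishes X g.
Hypothesis G_defined : forall p, vanishes X p ->
  exists s : seq (mpoly N L * mpoly N F),
    (forall cq, cq \in s -> vanishes X (map_mpoly iota cq.2)) /\
    p = \sum_(cq <- s) cq.1 * map_mpoly iota cq.2.

Lemma X1 : X (vec 1%:M). Proof. by exists 1%:M. Qed.

Lemma X_nonempty : ~ vanishes X 1.
Proof. by move=> /(_ _ X1); rewrite meval1 => /eqP; rewrite oner_eq0. Qed.

Definition grad (R : comNzRingType) (f : mpoly N R) k : R := meval (vec 1%:M) (mderiv k f).

Lemma gradD (R : comNzRingType) (f g : mpoly N R) k : grad (f + g) k = grad f k + grad g k.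
Proof. by rewrite /grad mderivD mevalD. Qed.

Lemma gradZ (R : comNzRingType) c (f : mpoly N R) k : grad (c *: f) k = c * grad f k.
Proof. by rewrite /grad mderivZ mevalZ. Qed.

Lemma gradB (R : comNzRingType) (f g : mpoly N R) k : grad (f - g) k = grad f k - grad g k.
Proof. by rewrite gradD -scaleN1r gradZ mulN1r. Qed.

Lemma grad_sum (R : comNzRingType) I (r : seq I) (P : pred I) (f : I -> mpoly N R) k :
  grad (\sum_(i <- r | P i) f i) k = \sum_(i <- r | P i) grad (f i) k.
Proof.
apply: (big_morph (fun h => grad h k)) => [g h|]; first exact: gradD.
by rewrite /grad mderiv0 meval0.
Qed.

Lemma grad_map (f : mpoly N F) k : grad (map_mpoly iota f) k = iota (grad f k).
Proof. by rewrite /grad mderiv_map (vec1_map iota) meval_map_mpoly. Qed.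

Local Notation vanishesF f := (vanishes X (map_mpoly iota f)).

Lemma vanishesF_lin c f g : vanishesF f -> vanishesF g -> vanishesF (f - c *: g).
Proof.
move=> If Ig; rewrite rmorphB /= -mul_mpolyC rmorphM /=.
by apply: vanishesB => //; apply: vanishesMl.
Qed.

(* Equations over F of the group whose gradients at 1 span those of all
   equations, in reduced echelon form: the coordinates outside [Z] are local
   coordinates at 1. *)
Definition pivots (Z : {set 'I_N}) (f : 'I_N -> mpoly N F) :=
  [/\ forall i, i \in Z -> vanishesF (f i),
    forall i j, i \in Z -> j \in Z -> grad (f i) j = (i == j)%:R &
    forall g, vanishesF g -> forall k,
      grad g k = \sum_(i in Z) grad g i * grad (f i) k].

(** Z is taken of maximal size. An equation whose gradient is outside the span keeps, after
    reduction by the pivots, a non-zero derivative at some k outside Z and would serve as a further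
    pivot. *)
Lemma pivots_exist : exists Z f, pivots Z f.
Proof.
pose P (Z : {set 'I_N}) := exists f, (forall i, i \in Z -> vanishesF (f i)) /\
  forall i j, i \in Z -> j \in Z -> grad (f i) j = (i == j)%:R.
have [Z [[f [fI fZ]] Zmax]] : exists Z, P Z /\ forall Z', P Z' -> (N - #|Z| <= N - #|Z'|)%N.
  by apply: min_witness; exists finset.set0, (fun _ => 0); split=> [i|i j]; rewrite inE.
exists Z, f; split=> // g Ig k.
pose g' := g - \sum_(i in Z) grad g i *: f i.
have g'E j : grad g' j = grad g j - \sum_(i in Z) grad g i * grad (f i) j.
  by rewrite gradB grad_sum; congr (_ - _); apply: eq_bigr => i _; rewrite gradZ.
have Ig' : vanishesF g'.
  rewrite rmorphB rmorph_sum /=; apply: vanishesB => //.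
  elim/big_rec: _ => [|i h iZ Ih]; first exact: vanishes0.
  apply: vanishesD => //; rewrite -mul_mpolyC rmorphM /=.
  by apply: vanishesMl; apply: fI.
have g'Z j : j \in Z -> grad g' j = 0.
  move=> jZ; rewrite g'E (bigD1 j) //= fZ // eqxx mulr1 big1 ?addr0 ?subrr // => i /andP[iZ ij].
  by rewrite fZ // (negPf ij) mulr0.
apply/eqP; rewrite -subr_eq0 -g'E; apply: contrapT => /negP gk.
have kZ : k \notin Z by apply: contra gk => /g'Z ->; rewrite eqxx.
pose b := (grad g' k)^-1 *: g'.
have Ib : vanishesF b by rewrite /b -mul_mpolyC rmorphM /=; apply: vanishesMl.
have bk : grad b k = 1 by rewrite gradZ mulVf.
have bZ j : j \in Z -> grad b j = 0 by move=> jZ; rewrite gradZ (g'Z j jZ) mulr0.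
have : P (k |: Z).
  exists (fun i => if i == k then b else f i - grad (f i) k *: b); split=> [i|i j].
    rewrite !inE; case: eqP => //= _ iZ; apply: vanishesF_lin => //; exact: fI.
  rewrite !inE; case: (eqVneq i k) => [->|ik] /= iZ; case: (eqVneq j k) => [->|jk] /= jZ.
  - by rewrite bk.
  - by rewrite bZ // eq_sym (negPf jk).
  - by rewrite gradB gradZ bk mulr1 subrr (negPf ik).
  - by rewrite gradB gradZ bZ // mulr0 subr0 fZ.
move/Zmax; rewrite cardsU1 kZ /=.
have : (#|k |: Z| <= N)%N by rewrite -[X in (_ <= X)%N](card_ord N) max_card.
by rewrite cardsU1 kZ /= add1n => zN; rewrite leqNgt ltn_sub2l.
Qed.

Variables (Z : {set 'I_N}) (f : 'I_N -> mpoly N F).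
Hypothesis Zf : pivots Z f.

(** Here generation of the ideal over F is decisive: p is a combination of equations over F, and at
    1 the terms with differentiated cofactors drop out. *)
Lemma grad_span p k : vanishes X p ->
  grad p k = \sum_(i in Z) grad p i * iota (grad (f i) k).
Proof.
move=> Ip; have [_ _ Zspan] := Zf; have [s [sI pE]] := G_defined Ip.
have E j : grad p j = \sum_(cq <- s) meval (vec 1%:M) cq.1 * iota (grad cq.2 j).
  rewrite pE grad_sum big_seq [RHS]big_seq; apply: eq_bigr => cq cqs.
  rewrite /grad mderivM mevalD !mevalM (sI _ cqs _ X1) mulr0 add0r.
  by congr (_ * _); apply: grad_map.
rewrite E; under [RHS]eq_bigr do rewrite E mulr_suml.
rewrite exchange_big /= big_seq [RHS]big_seq; apply: eq_bigr => cq cqs.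
rewrite [in LHS](Zspan _ (sI _ cqs)) rmorph_sum mulr_sumr; apply: eq_bigr => i _.
by rewrite rmorphM mulrA.
Qed.

(** Completes free coordinates, given as a row supported outside Z, to a tangent vector at 1; the
    entries in the columns of Z solve the linearised equations in echelon form. *)
Definition kernel_param : 'M[L]_N := \matrix_(j, k)
  if j \in Z then 0 else if k \in Z then - iota (grad (f k) j) else (j == k)%:R.

Lemma kernel_paramE (s : 'rV[L]_N) k : k \notin Z -> (forall j, j \in Z -> s 0 j = 0) ->
  (s *m kernel_param) 0 k = s 0 k.
Proof.
move=> kZ sZ; rewrite mxE (bigD1 k) //= mxE (negPf kZ) eqxx mulr1 big1 ?addr0 // => j jk.
by rewrite mxE (negPf kZ) (negPf jk) if_same mulr0.
Qed.

Lemma tangent_kernel_param (s : 'rV[L]_N) : (forall j, j \in Z -> s 0 j = 0) ->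
  tangent X (vec 1%:M) ((s *m kernel_param) 0).
Proof.
move=> sZ p Ip; rewrite (bigID (mem Z)) /=.
have -> : \sum_(i < N | i \in Z) meval (vec 1%:M) (mderiv i p) * (s *m kernel_param) 0 i =
    - \sum_(j < N | j \notin Z) s 0 j * grad p j.
  under [in RHS]eq_bigr do rewrite grad_span // mulr_sumr.
  rewrite exchange_big /= -sumrN; apply: eq_bigr => i iZ.
  rewrite mxE (bigID (mem Z)) /= big1 ?add0r => [|j jZ]; last by rewrite mxE jZ mulr0.
  rewrite mulr_sumr -sumrN; apply: eq_bigr => j jZ.
  by rewrite mxE (negPf jZ) iZ !mulrN /grad mulrCA.
rewrite addrC -sumrB big1 // => j jZ.
by rewrite kernel_paramE // mulrC subrr.
Qed.

(** The columns outside Z are unit vectors, so invertibility at a point implies that a tangent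
    vector there is determined by its coordinates outside Z. *)
Definition jacobian : 'M[mpoly N L]_N := \matrix_(j, i)
  if i \in Z then mderiv j (map_mpoly iota (f i)) else (i == j)%:R.

Lemma meval_det_jacobian x : meval x (\det jacobian) = \det (map_mx (meval x) jacobian).
Proof. by rewrite det_map_mx. Qed.

Lemma jacobian1 : meval (vec 1%:M) (\det jacobian) != 0.
Proof.
have [_ fZ _] := Zf.
rewrite meval_det_jacobian -unitfE -unitmxE; apply: unitmx_ker => s sJ.
have E i : (s *m map_mx (meval (vec 1%:M)) jacobian) 0 i = 0 by rewrite sJ mxE.
have nZ i : i \notin Z -> s 0 i = 0.
  move=> iZ; have := E i; rewrite mxE (bigD1 i) //= big1 => [|j ji].
    by rewrite !mxE (negPf iZ) eqxx rmorph1 mulr1 addr0.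
  by rewrite !mxE (negPf iZ) eq_sym (negPf ji) rmorph0 mulr0.
apply/rowP => i; rewrite mxE; have [iZ|] := boolP (i \in Z); last exact: nZ.
have := E i; rewrite mxE (bigD1 i) //= big1 => [|j ji].
  by rewrite !mxE iZ -/(grad _ _) grad_map fZ // eqxx rmorph1 mulr1 addr0.
have [jZ|/nZ ->] := boolP (j \in Z); last by rewrite mul0r.
by rewrite !mxE iZ -/(grad _ _) grad_map fZ // eq_sym (negPf ji) rmorph0 mulr0.
Qed.

Lemma jacobian_nvanishes : ~ vanishes X (\det jacobian).
Proof. by move=> /(_ _ X1) /eqP; rewrite (negPf jacobian1). Qed.

Lemma coordinates_tangent x y : X x -> meval x (\det jacobian) != 0 -> tangent X x y ->
  (forall i, i \in ~: Z -> y i = 0) -> forall i, y i = 0.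
Proof.
have [fI _ _] := Zf.
move=> Xx; rewrite meval_det_jacobian -unitfE -unitmxE => U ty yZ i.
suff /rowP/(_ i) : \row_k y k = 0 by rewrite !mxE.
apply: (can_inj (mulmxK U)); rewrite mul0mx; apply/rowP => k; rewrite !mxE.
have [kZ|kZ] := boolP (k \in Z).
  by rewrite -[RHS](ty _ (fI k kZ)); apply: eq_bigr => j _; rewrite !mxE kZ mulrC.
rewrite (bigD1 k) //= !mxE yZ ?inE // mul0r add0r big1 // => j jk.
by rewrite !mxE (negPf kZ) eq_sym (negPf jk) rmorph0 mulr0.
Qed.

Lemma tangent_arc (A T : 'M[L]_n) : G A ->
  tangent X (vec A) (vec T) <-> arc G 2 (map_mx polyC A + 'X *: map_mx polyC T).
Proof.
move=> GA; have XA : X (vec A) by exists A.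
have E p : pev (vec (map_mx polyC A + 'X *: map_mx polyC T)) p =
    pev (fun i => (vec A i)%:P + vec T i *: 'X) p.
  by apply: pev_eq => i; rewrite vecD vecZ !vec_map mulrC mul_polyC.
by split=> [/(tangentP _ XA) H p Ip|H]; [rewrite E H|apply/tangentP => // p Ip; rewrite -E H].
Qed.

(** A tangent vector is an arc modulo ['X^2], and multiplying by a constant arc again gives an
    arc. *)
Lemma tangent_translate (A B T : 'M[L]_n) : G A -> G B ->
  tangent X (vec A) (vec T) -> tangent X (vec (B *m A)) (vec (B *m T)).
Proof.
move=> GA GB /tangent_arc -/(_ GA) aT; apply/tangent_arc; first exact: GM.
have := arc_mul GM (arc_const 2 GB) aT.
by rewrite mulmxDr -scalemxAr -!map_mxM.
Qed.

(** A dimension count: the tangent vectors at 1, parametrised by the free coordinates, are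
    translated to A. The map back to the free coordinates is injective there, hence bijective. The
    matrix [T] is padded by the identity on Z to be square. *)
Lemma coordinate_tangent_exists x : X x -> meval x (\det jacobian) != 0 ->
  forall i, i \in ~: Z ->
  exists y, [/\ tangent X x y, y i = 1 & forall k, k \in ~: Z -> k != i -> y k = 0].
Proof.
move=> [A GA <-] DA i iZ.
pose Q := kernel_param *m lin_mx (mulmx A).
pose T : 'M[L]_N := \matrix_(j, k) if k \in Z then (j == k)%:R else Q j k.
have tA (s : 'rV[L]_N) : (forall j, j \in Z -> s 0 j = 0) -> tangent X (vec A) ((s *m Q) 0).
  move=> /tangent_kernel_param; pose W := vec_mx (s *m kernel_param).
  have -> : (s *m kernel_param) 0 = vec W by rewrite /vec vec_mxK.
  move=> /(tangent_translate G1 GA); rewrite mulmx1.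
  suff -> : (s *m Q) 0 = vec (A *m W) by [].
  by rewrite /vec -[A *m W]/(mulmx A W) -mul_vec_lin vec_mxK mulmxA.
have sT (s : 'rV[L]_N) : (forall k, k \in Z -> (s *m T) 0 k = s 0 k).
  move=> k kZ; rewrite mxE (bigD1 k) //= mxE kZ eqxx mulr1 big1 ?addr0 // => j jk.
  by rewrite mxE kZ (negPf jk) mulr0.
have sT' (s : 'rV[L]_N) : (forall k, k \notin Z -> (s *m T) 0 k = (s *m Q) 0 k).
  by move=> k kZ; rewrite mxE [RHS]mxE; apply: eq_bigr => j _; rewrite mxE (negPf kZ).
have U : T \in unitmx.
  apply: unitmx_ker => s s0.
  have sZ k : k \in Z -> s 0 k = 0 by move=> kZ; rewrite -sT // s0 mxE.
  have Q0 : s *m Q = 0.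
    apply/rowP => k; rewrite [RHS]mxE; move: k; apply: (coordinates_tangent _ DA (tA _ sZ)).
      by exists A.
    by move=> k; rewrite inE => kZ; rewrite -sT' // s0 mxE.
  have K0 : s *m kernel_param = 0.
    pose W := vec_mx (s *m kernel_param).
    have WE : s *m kernel_param = mxvec W by rewrite vec_mxK.
    suff W0 : A *m W = 0 by rewrite WE -[W](mulKmx (GU GA)) W0 mulmx0 linear0.
    apply: (can_inj mxvecK); rewrite linear0 -[A *m W]/(mulmx A W) -mul_vec_lin -WE.
    by rewrite -mulmxA.
  apply/rowP => k; rewrite mxE; have [/sZ//|kZ] := boolP (k \in Z).
  by rewrite -kernel_paramE // K0 mxE.
pose s : 'rV[L]_N := delta_mx 0 i *m invmx T.
have sE : s *m T = delta_mx 0 i by rewrite mulmxKV.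
have sZ j : j \in Z -> s 0 j = 0.
  move=> jZ; rewrite -sT // sE mxE eqxx /=; case: eqP => // ji.
  by move: iZ; rewrite inE -ji jZ.
exists ((s *m Q) 0); split; first exact: tA.
  by rewrite -sT' ?sE ?mxE ?eqxx //; move: iZ; rewrite inE.
by move=> k; rewrite inE => kZ ki; rewrite -sT' // sE mxE (negPf ki) andbF.
Qed.

Lemma group_arcs_extend : arcs_extend X (~: Z).
Proof. by case: (descend_to_coordinates G_prime X_nonempty jacobian_nvanishes coordinates_tangent). Qed.

Lemma group_eliminates_to : eliminates_to X (~: Z).
Proof. by case: (descend_to_coordinates G_prime X_nonempty jacobian_nvanishes coordinates_tangent). Qed.

Lemma group_coordinates_independent P : restr (~: Z) P = P -> vanishes X P -> P = 0.
Proof.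
exact: (coordinates_independent G_prime X_nonempty jacobian_nvanishes coordinate_tangent_exists).
Qed.

End GroupCoordinates.

(** * Arcs with prescribed local coordinates *)

Section MatrixCongruence.
Variables (L : fieldType) (n : nat).
Implicit Types (A B C D : 'M[{poly L}]_n) (k m : nat).

Lemma mxcong_refl k A : mxcong k A A.
Proof. by move=> i j; rewrite subrr dvdp0. Qed.

Lemma mxcong_sym k A B : mxcong k A B -> mxcong k B A.
Proof. by move=> AB i j; rewrite -opprB dvdpNr. Qed.

Lemma mxcong_trans k B A C : mxcong k A B -> mxcong k B C -> mxcong k A C.
Proof. by move=> AB BC i j; have := dvdp_add (AB i j) (BC i j); rewrite addrA subrK. Qed.

Lemma mxcong_le k m A B : (m <= k)%N -> mxcong k A B -> mxcong m A B.
Proof. by move=> mk AB i j; apply: dvdp_trans (AB i j); apply: dvdp_exp2l. Qed.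

Lemma mxcongD k A B C D : mxcong k A B -> mxcong k C D -> mxcong k (A + C) (B + D).
Proof. by move=> AB CD i j; rewrite !mxE opprD addrACA dvdp_add. Qed.

Lemma mxcongM k A B C D : mxcong k A B -> mxcong k C D -> mxcong k (A *m C) (B *m D).
Proof.
move=> AB CD i j; rewrite !mxE -sumrB; elim/big_rec: _ => [|l p _ Hp]; first exact: dvdp0.
apply: dvdp_add => //.
have -> : A i l * C l j - B i l * D l j = (A i l - B i l) * C l j + B i l * (C l j - D l j).
  by ring.
by apply: dvdp_add; [apply: dvdp_mulr|apply: dvdp_mull].
Qed.

Lemma mxcongXn m k A B : mxcong k A B -> mxcong (m + k) ('X^m *: A) ('X^m *: B).
Proof. by move=> AB i j; rewrite !mxE -mulrBr exprD dvdp_mul. Qed.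

Lemma mxcong_comp k m (s : L) A B : mxcong k A B ->
  mxcong (m * k) (map_mx (comp_poly (s *: 'X^m)) A) (map_mx (comp_poly (s *: 'X^m)) B).
Proof.
move=> AB i j; rewrite !mxE -comp_polyB; have /dvdpP[u ->] := AB i j.
rewrite comp_polyM comp_Xn_poly exprZn -exprM; apply: dvdp_mull.
by rewrite -mul_polyC; apply: dvdp_mull.
Qed.

Lemma mxcong_linear A : mxcong 1 A 1%:M ->
  mxcong 2 A (1%:M + 'X *: map_mx polyC (map_mx (coefp 1) A)).
Proof.
move=> A1 i j; apply/dvdp_XnP => k k2.
have := A1 i j => /dvdp_XnP/(_ 0%N isT).
rewrite !mxE !coefB -polyC1 -polyCMn !coefD coefXM !coefC /=.
case: k k2 => [|[|//]] _ /=; first by rewrite addr0.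
by move=> _; rewrite add0r subrr.
Qed.

End MatrixCongruence.

Section PrescribedCoordinates.
Variables (F : fieldType) (L : closedFieldType) (iota : {rmorphism F -> L}).
Variables (n : nat) (G : set 'M[L]_n).
Local Notation N := (n * n)%N.
Local Notation X := (points G).

Hypothesis G1 : G 1%:M.
Hypothesis GM : forall A B, G A -> G B -> G (A *m B).
Hypothesis GV : forall A, G A -> G (invmx A).
Hypothesis GU : forall A, G A -> A \in unitmx.
Hypothesis G_prime : forall f g, vanishes X (f * g) -> vanishes X f \/ vanishes X g.
Hypothesis G_defined : forall p, vanishes X p ->
  exists s : seq (mpoly N L * mpoly N F),
    (forall cq, cq \in s -> vanishes X (map_mpoly iota cq.2)) /\
    p = \sum_(cq <- s) cq.1 * map_mpoly iota cq.2.
Variables (Z : {set 'I_N}) (f : 'I_N -> mpoly N F).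
Hypothesis Zf : pivots iota G Z f.

Lemma arc_le M m c : (m <= M)%N -> arc G M c -> arc G m c.
Proof. by move=> mM ac p Ip; apply: dvdp_trans (ac p Ip); apply: dvdp_exp2l. Qed.

(** The free coordinates are algebraically independent, so a line in them meets no condition and
    extends to an arc on G through a generic point A. Multiplication by the inverse of A moves the
    arc to 1. *)
Lemma coordinate_arcs M : (0 < M)%N -> exists A (c : 'I_N -> 'M[{poly L}]_n),
  [/\ G A, meval (vec A) (\det (jacobian iota Z f)) != 0 &
  forall i, i \in ~: Z -> [/\ arc G M (c i), mxcong 1 (c i) 1%:M &
    forall k, k \in ~: Z -> vec (A *m map_mx (coefp 1) (c i)) k = (k == i)%:R]].
Proof.
move=> M0.
have [w [nw ext]] := group_arcs_extend G1 G_prime Zf.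
have nD := jacobian_nvanishes G1 Zf.
have /nvanishesP[_ [A GA <-]] : ~ vanishes X (w * \det (jacobian iota Z f)).
  by case/G_prime.
rewrite mevalM mulf_eq0 negb_or => /andP[wA DA]; exists A.
suff /boolp.choice[c Hc] : forall i, exists c : 'M[{poly L}]_n, i \in ~: Z ->
    [/\ arc G M c, mxcong 1 c 1%:M &
    forall k, k \in ~: Z -> vec (A *m map_mx (coefp 1) c) k = (k == i)%:R].
  by exists c.
move=> i; have [iZ|iZ] := boolP (i \in ~: Z); last by exists 0.
pose v k := (vec A k)%:P + (k == i)%:R *: 'X.
have XA : X (vec A) by exists A.
have [||v' [v'Z v'0 v'I]] := ext _ XA wA M v M0.
- by move=> k _; rewrite hornerD hornerC hornerZ hornerX mulr0 addr0.
- move=> p pZ Ip.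
  rewrite (group_coordinates_independent G1 GM GU G_prime G_defined Zf pZ Ip).
  by rewrite rmorph0 dvdp0.
pose V : 'M[{poly L}]_n := vec_mx (\row_k v' k).
have vecV : vec V = v' by apply: vec_of_row.
exists (map_mx polyC (invmx A) *m V) => _; split.
- apply: (arc_mul GM (arc_const _ (GV GA))) => p Ip.
  by rewrite vecV v'I.
- have VA : mxcong 1 V (map_mx polyC A).
    apply/mxcong_vec => k; rewrite vecV vec_map expr1 -['X]subr0 -polyC0 dvdp_XsubCl.
    by rewrite /root hornerD hornerN hornerC v'0 subrr.
  have := mxcongM (mxcong_refl 1 (map_mx polyC (invmx A))) VA.
  by rewrite -map_mxM mulVmx ?GU // map_mx1.
move=> k kZ.
have -> : A *m map_mx (coefp 1) (map_mx polyC (invmx A) *m V) = map_mx (coefp 1) V.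
  rewrite -[RHS]mul1mx -(mulmxV (GU GA)) -mulmxA; congr (_ *m _).
  apply/matrixP => a b; rewrite !mxE /= coef_sum; apply: eq_bigr => l _.
  by rewrite !mxE coefCM.
by rewrite vec_map vecV /= v'Z // coefD coefC coefZ coefX mulr1 add0r.
Qed.

(** After the substitution of [s i *: 'X^m], the arc [c i] is 1 plus a multiple of its velocity
    modulo ['X^(m.+1)]. As b is 1 at the origin, multiplication by such arcs adds these terms at
    order m. *)
Lemma arc_adjust M m (c : 'I_N -> 'M[{poly L}]_n) (s : 'I_N -> L) (l : seq 'I_N) b :
  (0 < m)%N -> arc G M b -> mxcong 1 b 1%:M ->
  (forall i, i \in l -> arc G M (c i) /\ mxcong 1 (c i) 1%:M) ->
  exists b', arc G M b' /\ mxcong m.+1 b'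
    (b + 'X^m *: map_mx polyC (\sum_(i <- l) s i *: map_mx (coefp 1) (c i))).
Proof.
move=> m0 ab b1; elim: l => [|i l IH] cl.
  exists b; split=> //; rewrite big_nil.
  by rewrite map_mx0 scaler0 addr0; apply: mxcong_refl.
have [|b' [ab' bb']] := IH; first by move=> j jl; apply: cl; rewrite inE jl orbT.
have [ai ci] := cl i (mem_head _ _).
exists (b' *m map_mx (comp_poly (s i *: 'X^m)) (c i)); split.
  by apply: (arc_mul GM) => //; apply: arc_comp.
pose tau := map_mx (coefp 1) (c i).
have b'1 : mxcong 1 b' 1%:M.
  apply: mxcong_trans (mxcong_le (ltn0Sn m) bb') _ => x y.
  rewrite !mxE; have := b1 x y; rewrite !mxE => H.
  rewrite addrAC; apply: dvdp_add => //; apply: dvdp_mulr.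
  by apply: dvdp_exp2l.
have ci' : mxcong m.+1 (map_mx (comp_poly (s i *: 'X^m)) (c i))
    (1%:M + 'X^m *: map_mx polyC (s i *: tau)).
  have := mxcong_comp m (s i) (mxcong_linear ci).
  move/(mxcong_le (m := m.+1)); rewrite muln2 -addnn -addn1 leq_add2l => /(_ m0) H.
  apply: mxcong_trans H _ => x y; rewrite !mxE.
  rewrite comp_polyD comp_polyM comp_polyX comp_polyC rmorphMn rmorph1 /=.
  rewrite -mul_polyC polyCM; set e := ('X^m : {poly L}).
  rewrite [X in _ %| X](_ : _ = 0) ?dvdp0 //; ring.
apply: mxcong_trans (mxcongM (mxcong_refl _ b') ci') _.
rewrite mulmxDr mulmx1 big_cons raddfD /= scalerDr [X in mxcong _ _ (_ + X)]addrC addrA.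
apply: mxcongD => //; rewrite -scalemxAr -addn1; apply: mxcongXn.
by rewrite -[X in mxcong _ _ X]mul1mx; apply: mxcongM => //; apply: mxcong_refl.
Qed.

Lemma arc_with_coordinates M (u : 'I_N -> L) : exists c,
  [/\ arc G M c, mxcong 1 c 1%:M &
  forall k, k \in ~: Z -> 'X^M %| vec c k - ((vec 1%:M k)%:P + u k *: 'X)].
Proof.
have a1 m : arc G m 1%:M by rewrite -(map_mx1 (polyC : {rmorphism L -> {poly L}})); apply: arc_const.
have vec1 k : vec (1%:M : 'M[{poly L}]_n) k = (vec 1%:M k)%:P.
  by rewrite (vec1_map (polyC : {rmorphism L -> {poly L}})).
have base k : 'X^1 %| vec (1%:M : 'M[{poly L}]_n) k - ((vec 1%:M k)%:P + u k *: 'X).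
  by rewrite vec1 opprD addrA subrr add0r expr1 dvdpNr -mul_polyC dvdp_mull.
have [M2|M2] := leqP M 1.
  exists 1%:M; split=> // [|k _]; first exact: mxcong_refl.
  by apply: dvdp_trans (base k); apply: dvdp_exp2l.
have [A [c [GA DA Hc]]] := coordinate_arcs (ltnW M2).
pose tau i := map_mx (coefp 1) (c i).
have tau_tangent i : i \in ~: Z -> tangent X (vec 1%:M) (vec (tau i)).
  move=> /Hc[ai ci _]; apply/(tangent_arc _ G1).
  apply: arc_cong (arc_le M2 ai).
  by apply: mxcong_sym; rewrite map_mx1; apply: mxcong_linear.
pose T : 'M[L]_N := \matrix_(i, k)
  if k \in Z then (i == k)%:R else if i \in Z then 0 else vec (tau i) k.
have sTZ (s : 'rV[L]_N) k : k \in Z -> (s *m T) 0 k = s 0 k.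
  move=> kZ; rewrite mxE (bigD1 k) //= mxE kZ eqxx mulr1 big1 ?addr0 // => j jk.
  by rewrite mxE kZ (negPf jk) mulr0.
have sTnZ (s : 'rV[L]_N) k : k \notin Z -> (s *m T) 0 k =
    vec (\sum_(i in ~: Z) s 0 i *: tau i) k.
  move=> kZ; rewrite mxE (bigID (mem Z)) /= big1 ?add0r => [|i iZ]; last first.
    by rewrite mxE (negPf kZ) iZ mulr0.
  rewrite /vec linear_sum summxE; apply: eq_big => [i|i iZ]; first by rewrite inE.
  by rewrite mxE (negPf kZ) (negPf iZ) linearZ [in RHS]mxE.
(* The velocities [tau i] are independent, as A times them has unit free coordinates; and tangent
   vectors at 1 are determined by their own free coordinates. So any correction of the free
   coordinates is a combination of the velocities. *)
have U : T \in unitmx.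
  apply: unitmx_ker => s s0.
  have sZ k : k \in Z -> s 0 k = 0 by move=> kZ; rewrite -sTZ // s0 mxE.
  pose W := \sum_(i in ~: Z) s 0 i *: tau i.
  have vecW k : vec W k = \sum_(i in ~: Z) s 0 i * vec (tau i) k.
    by rewrite /W /vec linear_sum summxE; apply: eq_bigr => i _; rewrite linearZ mxE.
  have tW : tangent X (vec 1%:M) (vec W).
    move=> p Ip; under eq_bigr => k _ do rewrite vecW mulr_sumr.
    rewrite exchange_big /= big1 // => i iZ.
    have := tau_tangent i iZ p Ip; move/(congr1 ( *%R (s 0 i))); rewrite mulr0 mulr_sumr => H; apply: etrans H.
    by apply: eq_bigr => k _; rewrite mulrCA.
  have W0 : W = 0.
    apply: vec_inj => k; rewrite [RHS](_ : _ = 0); last by rewrite /vec linear0 mxE.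
    move: k; apply: (coordinates_tangent Zf (X1 G1) (jacobian1 Zf) tW) => k.
    by rewrite inE => kZ; rewrite -sTnZ // s0 mxE.
  apply/rowP => k; rewrite mxE; have [/sZ //|kZ] := boolP (k \in Z).
  have kZ' : k \in ~: Z by rewrite inE.
  have : vec (A *m W) k = 0 by rewrite W0 mulmx0 /vec linear0 mxE.
  rewrite /W mulmx_sumr /vec linear_sum summxE (bigD1 k) //= big1 ?addr0.
    rewrite -scalemxAr linearZ mxE -/(vec _ _).
    by have [_ _ ->] := Hc k kZ'; rewrite // eqxx mulr1.
  move=> i /andP[iZ ik]; rewrite -scalemxAr linearZ mxE -/(vec _ _).
  by have [_ _ ->] := Hc i iZ; rewrite // eq_sym (negPf ik) mulr0.
suff H m : (0 < m)%N -> (m <= M)%N -> exists c, [/\ arc G M c, mxcong 1 c 1%:M &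
    forall k, k \in ~: Z -> 'X^m %| vec c k - ((vec 1%:M k)%:P + u k *: 'X)].
  exact: H (ltnW M2) (leqnn M).
elim: m => // [[|m]] IH _ mM.
  by exists 1%:M; split=> //; apply: mxcong_refl.
have [b [ab b1 bu]] := IH isT (ltnW mM).
(* The error of the free coordinates at order [m.+1], padded by 0 on Z to match [T]. *)
pose delta : 'rV[L]_N := \row_k if k \in Z then 0 else
  ((vec 1%:M k)%:P + u k *: 'X - vec b k)`_m.+1.
pose s := delta *m invmx T.
have sT : s *m T = delta by rewrite mulmxKV.
have [|b' [ab' bb']] := @arc_adjust M m.+1 c (s 0) (enum (~: Z)) b isT ab b1.
  by move=> i; rewrite mem_enum => /Hc[].
exists b'; split=> //.
  apply: mxcong_trans (mxcong_le (ltn0Sn m.+1) bb') _ => x y.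
  rewrite !mxE; have := b1 x y; rewrite !mxE => H.
  rewrite addrAC; apply: dvdp_add => //; apply: dvdp_mulr.
  by apply: dvdp_exp2l.
move=> k; rewrite inE => kZ.
have /mxcong_vec/(_ k) := bb'.
have -> : vec (b + 'X^(m.+1) *: map_mx polyC (\sum_(i <- enum (~: Z)) s 0 i *: tau i)) k =
    vec b k + delta 0 k *: 'X^(m.+1).
  rewrite vecD vecZ vec_map -sT sTnZ // big_enum /= mulrC mul_polyC.
  by congr (_ + vec _ _ *: _); apply: eq_bigl => i; rewrite inE.
move=> H; rewrite -(subrK (vec b k + delta 0 k *: 'X^(m.+1)) (vec b' k)) -addrA.
apply: dvdp_add => //; apply/dvdp_XnP => j; rewrite ltnS leq_eqVlt => /predU1P[->|jm].
  rewrite coefB coefD coefZ coefXn eqxx mulr1 mxE (negPf kZ) coefB.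
  ring.
have := bu k; rewrite inE kZ => /(_ isT)/dvdp_XnP/(_ j jm).
by rewrite !coefB (coefD (vec b k)) (coefZ (delta 0 k)) coefXn (ltn_eqF jm) mulr0 addr0.
Qed.

End PrescribedCoordinates.

(** * Formal curves with prescribed local coordinates *)

Section FormalCurve.
Variables (F : fieldType) (N : nat) (Z : {set 'I_N}) (f : 'I_N -> mpoly N F).
Variable x0 : 'I_N -> F.
Hypothesis fx0 : forall i, i \in Z -> meval x0 (f i) = 0.
Hypothesis fZ : forall i j, i \in Z -> j \in Z ->
  meval x0 (mderiv j (f i)) = (i == j)%:R.
Variable u : 'I_N -> F.

(* Newton iteration: the coordinates in [Z] are corrected by the coefficients
   that obstruct the equations [f i = 0] at the next order, whereas the other
   coordinates remain equal to [x0 j + u j * t]. *)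
Fixpoint curve k : 'I_N -> {poly F} := match k with
  | 0 => fun j => (x0 j)%:P
  | k.+1 => fun j => curve k j + (if j \in Z then
      - (pev (curve k) (f j))`_k.+1 -
        (if k == 0%N then \sum_(l in ~: Z) meval x0 (mderiv l (f j)) * u l else 0)
      else if k == 0%N then u j else 0) *: 'X^(k.+1)
  end.

Lemma curve_coef_gt k m j : (k < m)%N -> (curve k j)`_m = 0.
Proof.
elim: k => [|k IH] km /=; first by rewrite coefC gtn_eqF.
by rewrite coefD IH ?(ltnW km) // coefZ coefXn (gtn_eqF km) // mulr0 addr0.
Qed.

Lemma curve_coef_stable k m j : (m <= k)%N -> (curve k j)`_m = (curve m j)`_m.
Proof.
elim: k => [|k IH]; first by rewrite leqn0 => /eqP ->.
rewrite leq_eqVlt => /predU1P[-> //|mk].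
by rewrite /= coefD coefZ coefXn (ltn_eqF mk) mulr0 addr0 IH.
Qed.

Lemma curve_horner0 k j : (curve k j).[0] = x0 j.
Proof. by rewrite horner_coef0 curve_coef_stable //= coefC eqxx. Qed.

Lemma curve_free k j : j \notin Z -> curve k.+1 j = (x0 j)%:P + u j *: 'X.
Proof.
move=> jZ; elim: k => [|k IH]; first by rewrite /= (negPf jZ) expr1.
rewrite -IH -[LHS]/(curve k.+1 j + (if j \in Z then _ else 0) *: 'X^(k.+2)).
by rewrite (negPf jZ) scale0r addr0.
Qed.

Lemma curve_kills k i : i \in Z -> 'X^(k.+1) %| pev (curve k) (f i).
Proof.
move=> iZ; elim: k => [|k IH]; first by rewrite /= pev_const fx0 // polyC0 dvdp0.
pose y j := if j \in Z then - (pev (curve k) (f j))`_k.+1 -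
        (if k == 0%N then \sum_(l in ~: Z) meval x0 (mderiv l (f j)) * u l else 0)
      else if k == 0%N then u j else 0.
have := pev_taylor (curve k) y (f i) (ltn0Sn k).
have -> : pev (fun j => curve k j + y j *: 'X^(k.+1)) (f i) = pev (curve k.+1) (f i) by [].
set S := \sum_j _.
have -> : S = - (pev (curve k) (f i))`_k.+1.
  have -> : S = \sum_j meval x0 (mderiv j (f i)) * y j.
    apply: eq_bigr => j _; congr (_ * _); apply: mmap_eq => l; exact: curve_horner0.
  rewrite (bigID (mem Z)) /= (bigD1 i) //= fZ // eqxx mul1r big1 ?addr0; last first.
    by move=> j /andP[jZ ji]; rewrite fZ // eq_sym (negPf ji) mul0r.
  (* The free coordinates move at order one only; there, their contribution cancels the sum
     subtracted in the recursion. *)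
  rewrite /y iZ; case: eqP => k0; last first.
    rewrite subr0 big1 ?addr0 // => j jZ; rewrite (negPf jZ); by rewrite mulr0.
  apply: etrans (addr0 _); rewrite -addrA; congr (_ + _); apply/eqP.
  rewrite addrC subr_eq0; apply/eqP; apply: eq_big => [j|j jZ]; first by rewrite inE.
  by rewrite (negPf jZ).
move/dvdp_XnP => H; apply/dvdp_XnP => m mk.
move/dvdp_XnP in IH; have := H m mk; rewrite coefB coefD coefZ coefXn => /eqP.
rewrite subr_eq0 => /eqP ->.
move: mk; rewrite ltnS leq_eqVlt => /predU1P[->|mk]; first by rewrite eqxx mulr1 subrr.
by rewrite (IH m mk) (ltn_eqF mk) mulr0 addr0.
Qed.

End FormalCurve.

Lemma pev_map (F L : fieldType) (iota : {rmorphism F -> L}) n (v : 'I_n -> {poly F}) f :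
  pev (fun i => map_poly iota (v i)) (map_mpoly iota f) = map_poly iota (pev v f).
Proof.
rewrite /pev mmap_map_mpoly.
rewrite [RHS](@rmorph_mmap _ _ _ _ polyC (map_poly iota) (polyC \o iota)) //.
by move=> c; rewrite /= map_polyC.
Qed.

(** At the lowest order where the arcs could differ, the difference is supported on Z, and the
    gradients of the equations, being the identity there, force it to vanish. *)
Lemma implicit_function_unique (L : fieldType) N (Z : {set 'I_N}) (f : 'I_N -> mpoly N L)
    (x0 : 'I_N -> L) M (v w : 'I_N -> {poly L}) :
  (forall i j, i \in Z -> j \in Z -> meval x0 (mderiv j (f i)) = (i == j)%:R) ->
  (forall j, (v j).[0] = x0 j) -> (forall j, (w j).[0] = x0 j) ->
  (forall j, j \notin Z -> 'X^M %| v j - w j) ->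
  (forall i, i \in Z -> 'X^M %| pev v (f i)) ->
  (forall i, i \in Z -> 'X^M %| pev w (f i)) ->
  forall j, 'X^M %| v j - w j.
Proof.
move=> fZ v0 w0 vwY vf wf.
suff H m : (m <= M)%N -> forall j, 'X^m %| v j - w j by exact: H.
elim: m => [_ j|[_ _ j|m IH mM j]]; first by rewrite expr0 dvd1p.
  by rewrite expr1 -['X]subr0 -polyC0 dvdp_XsubCl /root hornerD hornerN v0 w0 subrr.
have {}IH := IH (ltnW mM).
pose y j := (v j - w j)`_m.+1.
have coef0 (p : {poly L}) : 'X^M %| p -> p`_m.+1 = 0 by move/dvdp_XnP; apply.
have vwy l : 'X^(m.+2) %| v l - (w l + y l *: 'X^(m.+1)).
  apply/dvdp_XnP => k; rewrite ltnS leq_eqVlt opprD addrA coefB coefZ coefXn.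
  case/predU1P => [->|km]; first by rewrite eqxx mulr1 subrr.
  by rewrite (ltn_eqF km) mulr0 subr0; move/dvdp_XnP: (IH l); apply.
have yY l : l \notin Z -> y l = 0 by move=> /vwY/coef0.
have yZ i : i \in Z -> y i = 0.
  move=> iZ.
  have := pev_taylor w y (f i) (ltn0Sn m).
  move/(dvdp_add (dvdp_pev_sub (f i) vwy)); rewrite addrA subrK.
  move/dvdp_XnP/(_ m.+1 (ltnSn _)).
  rewrite coefB coefD coefZ coefXn eqxx mulr1 (coef0 _ (vf i iZ)) (coef0 _ (wf i iZ)).
  rewrite sub0r add0r => /eqP; rewrite oppr_eq0 => /eqP <-.
  have -> : (fun i => (w i).[0]) = x0 by apply/funext.
  rewrite (bigD1 i) //= big1 ?addr0 => [|l li]; first by rewrite fZ // eqxx mul1r.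
  have [lZ|/yY ->] := boolP (l \in Z); last by rewrite mulr0.
  by rewrite fZ // eq_sym (negPf li) mul0r.
have y0 l : y l = 0 by have [/yZ|/yY] := boolP (l \in Z).
by have := vwy j; rewrite y0 scale0r addr0.
Qed.

(** A non-zero polynomial in one variable has finitely many roots; the infinitely many values of
    [h \o z] are used in one variable at a time. *)
Lemma meval_grid_eq0 (F : Type) (L : fieldType) (h : F -> L) N (z : nat -> F)
    (c : mpoly N L) : injective (h \o z) ->
  (forall v : 'I_N -> F, meval (h \o v) c = 0) -> c = 0.
Proof.
move=> z_inj; rewrite -(restr_setT c); move: [set: _] => S.
have [m] := ubnP #|S|; elim: m S c => // m IH S c Sm cv.
have [S0|[j jS]] := set_0Vmem S.
  have [x cE] : exists x, restr S c = mpolyC N x.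
    rewrite S0; elim/mpoly_ring_ind: c {cv} => [x|i|p q [x px] [y qy]|p q [x px] [y qy]].
    - by exists x; rewrite restrC.
    - by exists 0; rewrite restr_var inE mpolyC0.
    - by exists (x + y); rewrite rmorphD /= px qy mpolyCD.
    - by exists (x * y); rewrite rmorphM /= px qy mpolyCM.
  by have := cv (fun=> z 0%N); rewrite cE mevalC => ->; rewrite mpolyC0.
pose T := S :\ j; have ST : j |: T = S by rewrite finset.setD1K.
pose Q := univ T j (restr S c).
have QE : Q.[mvar j] = restr S c by apply: univ_horner; rewrite ST restr_restr.
suff Q0 : Q = 0 by rewrite -QE Q0 horner0.
apply/polyP => k; rewrite coef0.
have Qk : restr T Q`_k = Q`_k by apply: restr_coef; apply: restr_univ.
rewrite -Qk; apply: IH => [|v]; first by move: Sm; rewrite (cardsD1 j S) jS /T; lia.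
rewrite Qk; pose q := map_poly (meval (h \o v)) Q.
suff q0 : q = 0 by have := coef0 L k; rewrite -q0 coef_map.
apply: (@roots_geq_poly_eq0 _ q (mkseq (h \o z) (size q))).
- apply/allP => _ /mapP[i _ ->]; rewrite /root.
  pose v' l := if l == j then z i else v l.
  have v'Q : map_poly (meval (h \o v')) Q = q.
    apply/polyP => l; rewrite !coef_map /=.
    apply: (@mmap_restr_eq _ _ _ _ T); first by apply: restr_coef; apply: restr_univ.
    by move=> e /=; rewrite /v' !inE => /andP[/negPf ->].
  have -> : (h \o z) i = meval (h \o v') (mvar j) by rewrite mevalXU /= /v' eqxx.
  by rewrite -v'Q (horner_map (meval (h \o v'))) /= QE; apply/eqP; apply: cv.
- by rewrite map_inj_uniq ?iota_uniq.
- by rewrite size_mkseq.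
Qed.

Section CurvesInGroup.
Variables (F : fieldType) (L : closedFieldType) (iota : {rmorphism F -> L}).
Variables (n : nat) (G : set 'M[L]_n).
Local Notation N := (n * n)%N.
Local Notation X := (points G).

Hypothesis G1 : G 1%:M.
Hypothesis GM : forall A B, G A -> G B -> G (A *m B).
Hypothesis GV : forall A, G A -> G (invmx A).
Hypothesis GU : forall A, G A -> A \in unitmx.
Hypothesis G_prime : forall f g, vanishes X (f * g) -> vanishes X f \/ vanishes X g.
Hypothesis G_defined : forall p, vanishes X p ->
  exists s : seq (mpoly N L * mpoly N F),
    (forall cq, cq \in s -> vanishes X (map_mpoly iota cq.2)) /\
    p = \sum_(cq <- s) cq.1 * map_mpoly iota cq.2.
Variables (Z : {set 'I_N}) (f : 'I_N -> mpoly N F).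
Hypothesis Zf : pivots iota G Z f.

Local Notation gcurve u k := (curve Z f (vec 1%:M) u k).
Local Notation gcurveL u k := (fun j => map_poly iota (gcurve u k j)).

Lemma pivots_at1 i : i \in Z -> meval (vec 1%:M) (f i) = 0.
Proof.
case: Zf => fI _ _ iZ; have := fI i iZ _ (X1 G1).
by rewrite (vec1_map iota) meval_map_mpoly => /eqP; rewrite fmorph_eq0 => /eqP.
Qed.

Lemma gcurve_horner0 u k j : (map_poly iota (gcurve u k j)).[0] = vec 1%:M j.
Proof. by rewrite -(rmorph0 iota) horner_map curve_horner0 (vec1_map iota). Qed.

Lemma curve_arc u k p : vanishes X p -> 'X^(k.+1) %| pev (gcurveL u k) p.
Proof.
(* Order 0 is apart, since the free coordinates take their linear form only after one iteration. *)
have [->|] := posnP k.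
  move=> Ip; rewrite (pev_eq _ (w := fun j => (vec 1%:M j)%:P)).
    by rewrite pev_const Ip ?polyC0 ?dvdp0 //; apply: X1.
  by move=> j /=; rewrite map_polyC /= (vec1_map iota).
case: k => // k _ Ip.
have [c [ac c1 cu]] := arc_with_coordinates G1 GM GV GU G_prime G_defined Zf k.+2 (iota \o u).
suff H j : 'X^(k.+2) %| map_poly iota (gcurve u k.+1 j) - vec c j.
  rewrite -(subrK (pev (vec c) p) (pev _ p)) dvdp_add ?ac //.
  exact: dvdp_pev_sub.
case: Zf => fI fZ _.
move: j; apply: (@implicit_function_unique _ _ Z (fun i => map_mpoly iota (f i)) (vec 1%:M)).
- move=> i j iZ jZ; rewrite mderiv_map (vec1_map iota) meval_map_mpoly.
  by rewrite -[meval _ _]/(grad (f i) j) fZ // rmorph_nat.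
- exact: gcurve_horner0.
- move=> j; have /mxcong_vec/(_ j) := c1.
  rewrite expr1 -['X]subr0 -polyC0 dvdp_XsubCl /root hornerD hornerN subr_eq0 => /eqP ->.
  by rewrite (vec1_map (polyC : {rmorphism L -> {poly L}})) hornerC.
- move=> j jZ; rewrite curve_free // rmorphD /= map_polyC /= map_polyZ map_polyX.
  by have := cu j; rewrite inE (vec1_map iota) -opprB dvdpNr; apply.
- move=> i iZ; rewrite pev_map.
  have := curve_kills pivots_at1 fZ u k.+1 iZ.
  by move/dvdpP => [q ->]; rewrite rmorphM /= map_polyXn dvdp_mull.
- by move=> i iZ; apply: ac; apply: fI.
Qed.

(** If p did not vanish on G, some multiple c of it modulo the ideal would be a non-zero polynomial
    in the free coordinates. Along a curve these coordinates are exactly linear, so c vanishes on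
    whole lines through the origin of the coordinates, and the parameter may be set to 1 without any
    convergence. *)
Lemma vanishes_of_curves (z : nat -> F) p : injective z ->
  (forall u k, 'X^(k.+1) %| pev (gcurve u k) p) -> vanishes X (map_mpoly iota p).
Proof.
move=> z_inj Hp; apply: contrapT => nIp.
have [c [cY nIc [q Iq]]] := group_eliminates_to G1 G_prime Zf nIp.
apply: nIc; suff -> : c = 0 by apply: vanishes0.
have iz : injective (iota \o z) by move=> a b /= /fmorph_inj/z_inj.
apply: (meval_grid_eq0 iz) => v.
pose u j := v j - vec 1%:M j.
pose P := pev (fun j => (vec 1%:M j)%:P + (iota (u j)) *: 'X) c.
suff P0 : P = 0.
  have : P.[1] = 0 by rewrite P0 horner0.
  rewrite horner_pev => H; rewrite -[RHS]H; apply: mmap_eq => j.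
  by rewrite /= hornerD hornerC hornerZ hornerX mulr1 /u rmorphB /= (vec1_map iota) /= addrC subrK.
have PE k : P = pev (gcurveL u k.+1) c.
  apply: (@mmap_restr_eq _ _ _ _ (~: Z)) => // j; rewrite inE => jZ.
  by rewrite curve_free // (rmorphD (map_poly iota)) /= map_polyC map_polyZ map_polyX (vec1_map iota).
apply/polyP => m; rewrite coef0.
have /dvdp_XnP/(_ m) : 'X^(m.+2) %| P; last by apply; lia.
rewrite (PE m) -(subrK (q * map_mpoly iota p) c) (rmorphD (pev _)).
apply: dvdp_add; first exact: curve_arc.
rewrite (rmorphM (pev _)) /=; apply: dvdp_mull; rewrite pev_map.
by have /dvdpP[r ->] := Hp u m.+1; rewrite rmorphM /= map_polyXn dvdp_mull.
Qed.

End CurvesInGroup.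

(** * Analysis over a local field *)

Lemma expr_arbitrarily_small (R : realType) (q e : R) : 0 <= q -> q < 1 -> 0 < e ->
  exists k0, forall k, (k0 <= k)%N -> q ^+ k < e.
Proof.
move=> q0 q1 e0; have /cvg_expr/cvgr0_norm_lt/(_ e e0)[k0 _ H] : `|q| < 1 by rewrite ger0_norm.
by exists k0 => k kk0; have := H k kk0; rewrite ger0_norm // exprn_ge0.
Qed.

Section LocalField.
Variables (R : realType) (F : nonArchLocalFieldType R).
Implicit Types (x y : F) (C q e : R).

Lemma absv0 : absv (0 : F) = 0. Proof. exact/absv_eq0. Qed.

Lemma absv_gt0 x : (0 < absv x) = (x != 0).
Proof.
rewrite lt_neqAle absv_ge0 andbT eq_sym; congr (~~ _).
by apply/eqP/eqP => [/absv_eq0 //|->]; apply: absv0.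
Qed.

Lemma absvX x k : absv (x ^+ k) = absv x ^+ k.
Proof. by elim: k => [|k IH]; rewrite ?expr0 ?absv1 // !exprS absvM IH. Qed.

Lemma absv_dist x y : absv (x - y) = absv (y - x).
Proof. by rewrite -opprB absvN. Qed.

Lemma absvD_le x y C : absv x <= C -> absv y <= C -> absv (x + y) <= C.
Proof. by move=> xC yC; apply: le_trans (absvD x y) _; rewrite ge_max xC. Qed.

Lemma absvB_le x y C : absv x <= C -> absv y <= C -> absv (x - y) <= C.
Proof. by move=> xC yC; apply: absvD_le; rewrite ?absvN. Qed.

Lemma absv_sum_le I (r : seq I) (P : pred I) (f : I -> F) C : 0 <= C ->
  (forall i, P i -> absv (f i) <= C) -> absv (\sum_(i <- r | P i) f i) <= C.
Proof.
move=> C0 fC; elim/big_rec: _ => [|i x /fC fi xC]; first by rewrite absv0.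
exact: absvD_le.
Qed.

Lemma absv_small_exists : exists w : F, 0 < absv w /\ absv w < 1.
Proof.
have [x [x0 x1]] := @absv_nontrivial R F; have ax : 0 < absv x by rewrite absv_gt0.
have [lt|le] := ltP (absv x) 1; first by exists x.
exists x^-1; rewrite absvV // invr_gt0; split=> //.
by rewrite invf_lt1 // lt_neqAle eq_sym x1.
Qed.

Lemma absv_infinite : exists z : nat -> F, injective z.
Proof.
have [w [w0 w1]] := absv_small_exists.
exists (fun k => w ^+ k) => i j /(congr1 absv); rewrite !absvX.
by apply: ieexprIn => //; rewrite lt_eqF.
Qed.

(** Completeness comes from local compactness: differences are scaled by t into a compact
    neighbourhood of 0, where the sequence clusters. The ultrametric inequality keeps the rate
    without loss. The case q = 0 is apart because the balls must have positive radius. *)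
Lemma complete_geometric (y : nat -> F) C q : 0 < C -> 0 <= q -> q < 1 ->
  (forall k, absv (y k.+1 - y k) <= C * q ^+ k) ->
  exists x, forall k, absv (x - y k) <= C * q ^+ k.
Proof.
move=> C0; rewrite le_eqVlt => /predU1P[<-|q0] q1 yC.
  exists (y 1%N) => -[|k]; first exact: yC.
  have -> : y k.+1 = y 1%N.
    elim: k => // k <-; apply/eqP; rewrite -subr_eq0 -(negbK (_ == 0)) -absv_gt0 -leNgt.
    by apply: le_trans (yC _) _; rewrite expr0n mulr0.
  by rewrite subrr absv0 expr0n mulr0.
have ydist k m : absv (y (k + m)%N - y k) <= C * q ^+ k.
  elim: m => [|m IH]; first by rewrite addn0 subrr absv0 mulr_ge0 ?exprn_ge0 // ltW.
  rewrite addnS -(subrK (y (k + m)%N) (y _.+1)) -addrA; apply: absvD_le => //.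
  apply: le_trans (yC _) _; rewrite ler_pM2l // exprD ler_piMr ?exprn_ge0 ?exprn_ile1 //; exact: ltW.
have [U U0 [cU _]] : compact_near (within setT (nbhs (0 : F))) := @lfield_locally_compact R F 0 I.
have {}U0 : nbhs (0 : F) U by apply: (@filterS _ (nbhs (0 : F)) _ (fun x => [set: F]%classic x -> U x)) U0 => x; apply.
move: U0; rewrite absv_nbhs => -[e /= e0 eU].
have [w [w0 w1]] := absv_small_exists.
have [k0 wk] := expr_arbitrarily_small (ltW w0) w1 (divr_gt0 e0 C0).
pose t := w ^+ k0; have t0 : 0 < absv t by rewrite absvX exprn_gt0.
have tC : absv t * C < e by rewrite absvX -ltr_pdivlMr // wk.
pose z k := t * (y k - y 0%N).
have zU k : U (z k).
  apply: eU => /=; rewrite sub0r absvN absvM; apply: le_lt_trans tC.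
  by rewrite ler_pM2l //; have := ydist 0%N k; rewrite expr0 mulr1.
have [|p [_ zp]] := cU (z @ \oo)%classic _; first by exists 0%N => // k _; apply: zU.
exists (t^-1 * p + y 0%N) => k.
have Ck : 0 < absv t * (C * q ^+ k) by rewrite !mulr_gt0 // exprn_gt0.
have tail : (z @ \oo)%classic [set z m | m in [set m | (k <= m)%N]]%classic.
  by exists k => // m km; exists m.
have ball : nbhs p [set x | absv (p - x) < absv t * (C * q ^+ k)]%classic.
  by rewrite absv_nbhs; exists (absv t * (C * q ^+ k)).
have [_ [[m km <-] pm]] := zp _ _ tail ball.
rewrite -(ler_pM2l t0) -absvM.
have t'0 : t != 0 by rewrite -absv_gt0.
have -> : t * (t^-1 * p + y 0%N - y k) = (p - z m) + t * (y m - y k) by rewrite /z; field.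
apply: absvD_le; first exact: ltW.
by rewrite absvM ler_pM2l // -(subnKC km); apply: ydist.
Qed.

End LocalField.

(** * Growth of the coefficients *)

Section CoefficientBounds.
Variables (R : realType) (F : nonArchLocalFieldType R).
Implicit Types (p q : {poly F}) (B C e : R).

(** For B > 0: the Gauss norm of p on the disc of radius B^-1 is at most C. *)
Definition coef_bound B C p := forall m, absv p`_m <= C * B ^+ m.

Lemma coef_boundD B C p q : coef_bound B C p -> coef_bound B C q -> coef_bound B C (p + q).
Proof. by move=> bp bq m; rewrite coefD; apply: absvD_le. Qed.

Lemma coef_boundM B C D p q : 0 <= B -> 0 <= C -> 0 <= D ->
  coef_bound B C p -> coef_bound B D q -> coef_bound B (C * D) (p * q).
Proof.
move=> B0 C0 D0 bp bq m; rewrite coefM; apply: absv_sum_le => [|i _].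
  by rewrite !mulr_ge0 ?exprn_ge0.
have -> : B ^+ m = B ^+ i * B ^+ (m - i) by rewrite -exprD subnKC // -ltnS.
rewrite absvM mulrACA.
by apply: ler_pM; rewrite ?absv_ge0.
Qed.

Lemma coef_bound_le B C D p : 0 <= B -> C <= D -> coef_bound B C p -> coef_bound B D p.
Proof. by move=> B0 CD bp m; apply: le_trans (bp m) _; rewrite ler_wpM2r ?exprn_ge0. Qed.

Lemma coef_bound0 B C : 0 <= B -> 0 <= C -> coef_bound B C 0.
Proof. by move=> B0 C0 m; rewrite coef0 absv0 mulr_ge0 ?exprn_ge0. Qed.

Lemma coef_boundC B C (c : F) : 0 <= B -> absv c <= C -> coef_bound B C c%:P.
Proof.
move=> B0 cC m; rewrite coefC; case: eqP => [->|_]; first by rewrite mulr1.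
by rewrite absv0 mulr_ge0 ?exprn_ge0 // (le_trans _ cC) ?absv_ge0.
Qed.

Lemma coef_boundZ B C (c : F) p : 0 <= C ->
  coef_bound B C p -> coef_bound B (absv c * C) (c *: p).
Proof. by move=> C0 bp m; rewrite coefZ absvM -mulrA ler_wpM2l ?absv_ge0. Qed.

Lemma coef_bound_horner B C k p (a : F) : 0 <= B -> 0 <= C -> B * absv a <= 1 ->
  (forall m, (m < k)%N -> p`_m = 0) -> coef_bound B C p ->
  absv p.[a] <= C * (B * absv a) ^+ k.
Proof.
move=> B0 C0 a1 p0 bp; have Ba0 : 0 <= B * absv a by rewrite mulr_ge0 ?absv_ge0.
rewrite horner_coef; apply: absv_sum_le => [|i _]; first by rewrite mulr_ge0 ?exprn_ge0.
have [ik|ki] := ltnP i k; first by rewrite p0 // mul0r absv0 mulr_ge0 ?exprn_ge0.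
rewrite absvM absvX; apply: le_trans (ler_wpM2r _ (bp i)) _; rewrite ?exprn_ge0 ?absv_ge0 //.
rewrite -mulrA -exprMn ler_wpM2l // -(subnKC ki) exprD ler_piMr ?exprn_ge0 //.
exact: exprn_ile1.
Qed.

Variable N : nat.
Implicit Types (v w : 'I_N -> {poly F}) (P : mpoly N F).

(** The constant depends on P only, so one constant serves the partial sums of all orders. *)
Lemma pev_coef_bound P : exists2 C, 1 <= C & forall B v, 1 <= B ->
  (forall j, coef_bound B 1 (v j)) -> coef_bound B C (pev v P).
Proof.
elim/mpoly_ring_ind: P => [c|i|P Q [C C1 HC] [D D1 HD]|P Q [C C1 HC] [D D1 HD]].
- exists (Num.max 1 (absv c)) => [|B v B1 _]; first by rewrite le_max lexx.
  by rewrite pevC; apply: coef_boundC; [apply: le_trans B1|rewrite le_max lexx orbT].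
- by exists 1 => // B v _ Bv; rewrite pev_var.
- exists (Num.max C D) => [|B v B1 Bv]; first by rewrite le_max C1.
  have B0 := le_trans ler01 B1; rewrite rmorphD /=; apply: coef_boundD.
    by apply: coef_bound_le (HC _ _ _ Bv); rewrite // le_max lexx.
  by apply: coef_bound_le (HD _ _ _ Bv); rewrite // le_max lexx orbT.
- exists (C * D) => [|B v B1 Bv]; first by rewrite mulr_ege1.
    have B0 := le_trans ler01 B1; rewrite rmorphM /=.
  by apply: coef_boundM; rewrite ?(le_trans ler01) //; [apply: HC|apply: HD].
Qed.

Variable x0 : 'I_N -> F.

Definition linear_part v P : {poly F} :=
  \sum_j meval x0 (mderiv j P) *: (v j - (x0 j)%:P).

(* The quadratic remainder gains a factor [B^-1], which absorbs the constants in
   the recursive estimate of the coefficients of a curve. *)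
Lemma pev_linear_bound P : exists2 C, 1 <= C & forall B v, 1 <= B ->
  (forall j, coef_bound (B ^+ 2) (B ^- 1) (v j - (x0 j)%:P)) ->
  coef_bound (B ^+ 2) (C * B ^- 1) (pev v P - (meval x0 P)%:P) /\
  coef_bound (B ^+ 2) (C * B ^- 2) (pev v P - (meval x0 P)%:P - linear_part v P).
Proof.
have B21 B : 1 <= B -> B ^- 2 <= B ^- 1.
  move=> B1; have B0 : 0 < B := lt_le_trans ltr01 B1.
  by rewrite lef_pV2 ?posrE ?exprn_gt0 // expr1 expr2 ler_pMr.
have Bp B k : 1 <= B -> 0 <= B ^- k.
  by move=> B1; rewrite invr_ge0 exprn_ge0 // (le_trans ler01).
have Bs B : 1 <= B -> 0 <= B ^+ 2 by move=> B1; rewrite exprn_ge0 // (le_trans ler01).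
elim/mpoly_ring_ind: P => [c|i|P Q [C C1 HC] [D D1 HD]|P Q [C C1 HC] [D D1 HD]].
- exists 1 => // B v B1 _; rewrite pevC mevalC subrr.
  rewrite /linear_part big1 => [|j _]; last by rewrite mderivC meval0 scale0r.
  by rewrite subr0; split; apply: coef_bound0; rewrite ?mul1r ?Bp ?Bs //.
- exists 1 => // B v B1 Bv; rewrite pev_var mevalXU /linear_part (bigD1 i) //= big1 => [|j ji].
    rewrite mderivX mnm1E eqxx scale1r mnm_subid mpolyX0 meval1 scale1r addr0 subrr !mul1r.
    by split; [exact: Bv|apply: coef_bound0; rewrite ?Bp ?Bs //].
  by rewrite mderivX mnm1E eq_sym (negPf ji) scale0r meval0 scale0r.
- exists (Num.max C D) => [|B v B1 Bv]; first by rewrite le_max C1.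
  have [sP rP] := HC B v B1 Bv; have [sQ rQ] := HD B v B1 Bv.
  have -> : pev v (P + Q) - (meval x0 (P + Q))%:P =
      (pev v P - (meval x0 P)%:P) + (pev v Q - (meval x0 Q)%:P).
    by rewrite (rmorphD (pev v)) mevalD polyCD /= opprD addrACA.
  have -> : linear_part v (P + Q) = linear_part v P + linear_part v Q.
    by rewrite -big_split; apply: eq_bigr => j _ /=; rewrite mderivD mevalD scalerDl.
  split; last rewrite opprD addrACA; apply: coef_boundD.
  + by apply: coef_bound_le sP; rewrite ?Bs // ler_wpM2r ?Bp // le_max lexx.
  + by apply: coef_bound_le sQ; rewrite ?Bs // ler_wpM2r ?Bp // le_max lexx orbT.
  + by apply: coef_bound_le rP; rewrite ?Bs // ler_wpM2r ?Bp // le_max lexx.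
  + by apply: coef_bound_le rQ; rewrite ?Bs // ler_wpM2r ?Bp // le_max lexx orbT.
pose a := meval x0 P; pose b := meval x0 Q.
pose M := Num.max 1 (absv a) * Num.max 1 (absv b).
have ma : 1 <= Num.max 1 (absv a) by rewrite le_max lexx.
have mb : 1 <= Num.max 1 (absv b) by rewrite le_max lexx.
have C0 := le_trans ler01 C1; have D0 := le_trans ler01 D1.
have aD : absv a * D <= M * (C * D).
  rewrite mulrA ler_wpM2r // /M -mulrA -[X in X <= _]mulr1.
  apply: ler_pM; rewrite ?absv_ge0 ?le_max ?lexx ?orbT //.
  by rewrite mulr_ege1.
have bC : absv b * C <= M * (C * D).
  rewrite [C * D]mulrC mulrA ler_wpM2r // /M mulrAC -[X in X <= _]mul1r.
  apply: ler_pM; rewrite ?absv_ge0 ?le_max ?lexx ?orbT //.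
  by rewrite mulr_ege1.
have CD : C * D <= M * (C * D).
  by rewrite -[X in X <= _]mul1r ler_wpM2r ?mulr_ge0 // mulr_ege1.
exists (M * (C * D)) => [|B v B1 Bv].
  by rewrite !mulr_ege1.
have [sP rP] := HC B v B1 Bv; have [sQ rQ] := HD B v B1 Bv.
set s := pev v P - _ in sP rP; set t := pev v Q - _ in sQ rQ.
have st : coef_bound (B ^+ 2) (M * (C * D) * B ^- 2) (s * t).
  have := coef_boundM (Bs _ B1) _ _ sP sQ; rewrite mulrACA -expr2 exprVn.
  rewrite !mulr_ge0 ?Bp // => /(_ isT isT); apply: coef_bound_le; first exact: Bs.
  by rewrite ler_wpM2r ?Bp.
rewrite rmorphM mevalM polyCM /=.
have -> : pev v P * pev v Q - a%:P * b%:P = a *: t + b *: s + s * t.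
  by rewrite /s /t -!mul_polyC -/a -/b; ring.
have -> : linear_part v (P * Q) = a *: linear_part v Q + b *: linear_part v P.
  rewrite !scaler_sumr -big_split; apply: eq_bigr => j _ /=.
  by rewrite mderivM mevalD !mevalM scalerDl !scalerA addrC [b * _]mulrC.
split.
  apply: coef_boundD; first apply: coef_boundD.
  - apply: coef_bound_le (coef_boundZ _ _ sQ); rewrite ?Bs ?mulr_ge0 ?Bp //.
    by rewrite [X in X <= _]mulrA ler_wpM2r ?Bp.
  - apply: coef_bound_le (coef_boundZ _ _ sP); rewrite ?Bs ?mulr_ge0 ?Bp //.
    by rewrite [X in X <= _]mulrA ler_wpM2r ?Bp.
  - apply: coef_bound_le st; rewrite ?Bs // ler_wpM2l ?B21 //.
    by apply: le_trans CD; rewrite mulr_ge0.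
have -> : a *: t + b *: s + s * t - (a *: linear_part v Q + b *: linear_part v P) =
    a *: (t - linear_part v Q) + b *: (s - linear_part v P) + s * t.
  by rewrite -!mul_polyC; ring.
apply: coef_boundD => //; apply: coef_boundD.
- apply: coef_bound_le (coef_boundZ _ _ rQ); rewrite ?Bs ?mulr_ge0 ?Bp //.
  by rewrite [X in X <= _]mulrA ler_wpM2r ?Bp.
- apply: coef_bound_le (coef_boundZ _ _ rP); rewrite ?Bs ?mulr_ge0 ?Bp //.
  by rewrite [X in X <= _]mulrA ler_wpM2r ?Bp.
Qed.

End CoefficientBounds.

Section CurveBound.
Variables (R : realType) (F : nonArchLocalFieldType R) (N : nat).
Variables (Z : {set 'I_N}) (f : 'I_N -> mpoly N F) (x0 u : 'I_N -> F).

(** B dominates the remainder constants [C j] and the first-order data u and t. At order one the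
    bound is B itself; at later orders a coefficient comes from the quadratic remainder, whose spare
    factor B^-1 absorbs [C j]. *)
Lemma curve_bound : exists2 B : R, 1 <= B & forall k j,
  coef_bound (B ^+ 2) (B ^- 1) (curve Z f x0 u k j - (x0 j)%:P).
Proof.
have /boolp.choice[C HC] : forall i, exists C : R, 1 <= C /\ forall B v, 1 <= B ->
    (forall j, coef_bound (B ^+ 2) (B ^- 1) (v j - (x0 j)%:P)) ->
    coef_bound (B ^+ 2) (C * B ^- 2)
      (pev v (f i) - (meval x0 (f i))%:P - linear_part x0 v (f i)).
  move=> i; have [C C1 HC] := pev_linear_bound x0 (f i).
  by exists C; split=> // B v B1 /(HC B v B1)[].
pose t j := \sum_(l in ~: Z) meval x0 (mderiv l (f j)) * u l.
pose B := 1 + \sum_j (C j + absv (u j) + absv (t j)).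
have C0 j : 0 <= C j := le_trans ler01 (proj1 (HC j)).
have le_B j : C j + absv (u j) + absv (t j) <= B.
  rewrite /B (bigD1 j) //= addrCA lerDl addr_ge0 // sumr_ge0 // => i _.
  by rewrite !addr_ge0 ?absv_ge0.
have B1 : 1 <= B by rewrite lerDl sumr_ge0 // => i _; rewrite !addr_ge0 ?absv_ge0.
have B0 : 0 < B := lt_le_trans ltr01 B1.
have CB j : C j <= B by apply: le_trans (le_B j); rewrite -addrA lerDl addr_ge0 ?absv_ge0.
have uB j : absv (u j) <= B by apply: le_trans (le_B j); rewrite addrAC lerDr addr_ge0 ?absv_ge0.
have tB j : absv (t j) <= B by apply: le_trans (le_B j); rewrite lerDr addr_ge0 ?absv_ge0.
exists B => //; elim=> [|k IH] j.
  by rewrite /= subrr; apply: coef_bound0; rewrite ?invr_ge0 ?exprn_ge0 // ltW.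
rewrite /= addrAC; apply: coef_boundD => //.
set c := (if j \in Z then _ else _).
suff cB : absv c <= B ^- 1 * B ^+ 2 ^+ k.+1.
  move=> m; rewrite coefZ coefXn; case: eqP => [->|_]; first by rewrite mulr1.
  by rewrite mulr0 absv0 mulr_ge0 ?invr_ge0 ?exprn_ge0 // ltW.
have BE : B ^- 1 * B ^+ 2 ^+ k.+1 = B * (B ^+ 2) ^+ k.
  by rewrite expr1 [in LHS]exprS {1}expr2 !mulrA mulVf ?mul1r // gt_eqF.
have Bk : 1 <= (B ^+ 2) ^+ k by rewrite !exprn_ege1.
have small y : absv y <= B -> absv y <= B ^- 1 * B ^+ 2 ^+ k.+1.
  by move=> yB; rewrite BE; apply: le_trans yB _; rewrite ler_peMr // ltW.
rewrite /c; case: ifP => [jZ|_]; last first.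
  by case: ifP => _; apply: small; rewrite ?uB // absv0 ltW.
apply: absvB_le; last by case: ifP => _; apply: small; rewrite ?tB // absv0 ltW.
rewrite absvN; have [_ HCj] := HC j; have /(_ k.+1) := HCj B _ B1 IH.
have curve0 l : (curve Z f x0 u k l)`_k.+1 = 0 by apply: curve_coef_gt.
(* After k iterations the curve has degree at most k, so its linear part does not reach order
   [k.+1]. *)
have lin0 : (linear_part x0 (curve Z f x0 u k) (f j))`_k.+1 = 0.
  rewrite /linear_part coef_sum big1 // => l _.
  by rewrite coefZ coefB curve0 coefC subr0 mulr0.
rewrite !coefB coefC lin0 /= !subr0 => H.
apply: le_trans H _; rewrite ler_wpM2r ?exprn_ge0 ?(ltW B0) //.
rewrite -exprVn expr2 mulrA ler_piMl ?invr_ge0 ?(ltW B0) //.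
by rewrite ler_pdivrMr // mul1r.
Qed.

End CurveBound.

Section LocalFieldMatrices.
Variables (R : realType) (F : nonArchLocalFieldType R).

Lemma mx_bounded m n (A : 'M[F]_(m, n)) : exists2 C : R, 1 <= C &
  forall i j, absv (A i j) <= C.
Proof.
exists (1 + \sum_i \sum_j absv (A i j)) => [|i j].
  by rewrite lerDl sumr_ge0 // => i _; rewrite sumr_ge0 // => j _; apply: absv_ge0.
rewrite (bigD1 i) //= (bigD1 j) //= addrCA -!addrA lerDl !addr_ge0 ?ler01 //.
all: rewrite ?sumr_ge0 // => k _; rewrite ?absv_ge0 // sumr_ge0 // => l _; exact: absv_ge0.
Qed.

(** A row in the kernel is the coefficient list of a polynomial of degree less than K with the K
    distinct roots [w ^+ e.+1]. *)
Lemma power_matrix_unit K (w : F) : 0 < absv w -> absv w < 1 ->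
  \matrix_(i < K, e < K) (w ^+ e.+1) ^+ i.+1 \in unitmx.
Proof.
move=> w0 w1; apply: unitmx_ker => s /rowP s0.
have wn0 : w != 0 by rewrite -absv_gt0.
have w_inj : injective (fun k => w ^+ k).
  move=> i j /(congr1 absv); rewrite !absvX.
  by apply: ieexprIn => //; rewrite lt_eqF.
pose p := \sum_(i < K) s 0 i *: 'X^i.
have pK : (size p <= K)%N.
  apply: leq_trans (size_sum _ _ _) _; apply/bigmax_leqP => i _; apply: leq_trans (size_scale_leq _ _) _.
  by rewrite size_polyXn.
have p0 : p = 0.
  apply: (@roots_geq_poly_eq0 _ p (mkseq (fun e => w ^+ e.+1) K)); last by rewrite size_mkseq.
  - apply/allP => y /mapP[e]; rewrite mem_iota => /= eK {y}->; rewrite /root.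
    have := s0 (Ordinal eK); rewrite !mxE => /eqP H.
    have /mulIf/inj_eq <- : w ^+ e.+1 != 0 by rewrite expf_neq0.
    rewrite mul0r -(eqP H) horner_sum mulr_suml; apply/eqP/eq_bigr => i _.
    by rewrite !mxE hornerZ hornerXn -mulrA -exprSr.
  - by rewrite map_inj_uniq ?iota_uniq // => i j /w_inj[].
apply/rowP => i; have := congr1 (fun p : {poly F} => p`_i) p0.
rewrite coef0 coef_sum (bigD1 i) //= big1 ?addr0 => [|j ji].
  by rewrite coefZ coefXn eqxx mulr1 mxE.
by rewrite coefZ coefXn -val_eqE eq_sym in ji *; rewrite (negPf ji) mulr0.
Qed.

(** Once the rank of the first K rows is maximal, every later row is a combination of them; its
    coordinates come from one fixed pseudo-inverse and so grow at most geometrically. The row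
    [psi 0] is left out, as functionals are applied to differences with it. *)
Lemma row_span_bound N (psi : nat -> 'I_N -> F) (B : R) : 1 <= B ->
  (forall m j, absv (psi m j) <= B ^+ m) ->
  exists K (c : nat -> 'I_K -> F) (D : R), [/\ 1 <= D,
    forall m i, absv (c m i) <= D ^+ m.+1 &
    forall m j, psi m.+1 j = \sum_i c m i * psi i.+1 j].
Proof.
move=> B1 psiB; pose P k : 'M[F]_(k, N) := \matrix_(i, j) psi i.+1 j.
pose v m : 'rV[F]_N := \row_j psi m.+1 j.
have vP k m : (m < k)%N -> (v m <= P k)%MS.
  move=> mk; have -> : v m = row (Ordinal mk) (P k) by apply/rowP => j; rewrite !mxE.
  exact: row_sub.
have [K [_ Kmax]] : exists k, True /\ forall k', True ->
    (N - \rank (P k) <= N - \rank (P k'))%N by apply: min_witness; exists 0%N.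
have PP k k' : (k <= k')%N -> (P k <= P k')%MS.
  move=> kk'; apply/row_subP => i.
  have -> : row i (P k) = v i by apply/rowP => j; rewrite !mxE.
  exact: vP (leq_trans (ltn_ord i) kk').
have vK m : (v m <= P K)%MS.
  have [k' Kk' mk'] : exists2 k', (K <= k')%N & (m < k')%N.
    by exists (K + m.+1)%N; rewrite ?leq_addr // addnS ltnS leq_addl.
  apply: submx_trans (vP _ _ mk') _.
  rewrite -(mxrank_leqif_sup (PP _ _ Kk')) eqn_leq mxrankS ?PP //=.
  by have := Kmax k' I; have := rank_leq_col (P k'); have := rank_leq_col (P K); lia.
have [C C1 HC] := mx_bounded (pinvmx (P K)).
exists K, (fun m i => (v m *m pinvmx (P K)) 0 i), (B * C); split=> [|m i|m j].
- exact: mulr_ege1.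
- have C0 := le_trans ler01 C1; have B0 := le_trans ler01 B1.
  rewrite mxE exprMn; apply: absv_sum_le => [|j _]; first by rewrite mulr_ge0 ?exprn_ge0.
  rewrite absvM; apply: ler_pM; rewrite ?absv_ge0 //; first by rewrite mxE psiB.
  by apply: le_trans (HC _ _) _; rewrite exprS ler_peMr // exprn_ege1.
- have := mulmxKpV (vK m) => /rowP/(_ j); rewrite [RHS]mxE => <-; rewrite mxE.
  by apply: eq_bigr => i _; rewrite [P K i j]mxE.
Qed.

End LocalFieldMatrices.

(** * Convergent series and formal identities *)

Section ConvergentSeries.
Variables (R : realType) (F : nonArchLocalFieldType R) (N : nat).
Variables (psi : nat -> 'I_N -> F) (B : R).
Hypothesis B1 : 1 <= B.
Hypothesis psiB : forall m j, absv (psi m j) <= B ^+ m.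
Implicit Types (a b : F) (x : 'I_N -> F) (P : mpoly N F).

Definition psum k j : {poly F} := \poly_(m < k.+1) psi m j.

(* The explicit rate of convergence determines the sum [x] of the series. *)
Definition limit_at a x := forall k j, absv (x j - (psum k j).[a]) <= (B * absv a) ^+ k.

Let B0 : 0 <= B := le_trans ler01 B1.

Lemma Babsv_ge0 a : 0 <= B * absv a.
Proof. by rewrite mulr_ge0 ?absv_ge0. Qed.

Lemma psum_bound k j : coef_bound B 1 (psum k j).
Proof.
move=> m; rewrite coef_poly mul1r; case: ifP => _; first exact: psiB.
by rewrite absv0 exprn_ge0.
Qed.

Lemma psum_le1 k j a : B * absv a <= 1 -> absv (psum k j).[a] <= 1.
Proof. by move=> a1; have := coef_bound_horner (k := 0%N) B0 ler01 a1 _ (psum_bound k j); rewrite expr0 mulr1; apply. Qed.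

Lemma psumS k j : psum k.+1 j = psum k j + psi k.+1 j *: 'X^(k.+1).
Proof.
apply/polyP => m; rewrite coefD !coef_poly coefZ coefXn ltnS.
rewrite leq_eqVlt; case: eqP => [->|_] /=; first by rewrite ltnn mulr1 add0r.
by rewrite ltnS mulr0 addr0.
Qed.

Lemma limit_exists a : B * absv a < 1 -> exists x, limit_at a x.
Proof.
move=> a1; suff /boolp.choice[x Hx] : forall j, exists y : F, forall k,
    absv (y - (psum k j).[a]) <= (B * absv a) ^+ k by exists x => k j.
move=> j; have [k|y Hy] := complete_geometric (y := fun k => (psum k j).[a]) ltr01
  (Babsv_ge0 a) a1; last by exists y => k; have := Hy k; rewrite mul1r.
rewrite mul1r psumS hornerD addrC addKr hornerZ hornerXn absvM absvX.
apply: le_trans (ler_wpM2r _ (psiB _ _)) _; first by rewrite exprn_ge0 ?absv_ge0.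
by rewrite -exprMn exprS ler_piMl ?exprn_ge0 ?Babsv_ge0 // ltW.
Qed.

Lemma limit_le1 a x j : B * absv a <= 1 -> limit_at a x -> absv (x j) <= 1.
Proof.
move=> a1 /(_ 0%N j) H; rewrite -(subrK (psum 0 j).[a] (x j)).
by apply: absvD_le; rewrite ?psum_le1.
Qed.

Lemma limit0 x : limit_at 0 x -> x =1 psi 0%N.
Proof.
move=> H j; apply/eqP; rewrite -subr_eq0 -[_ == 0]negbK -absv_gt0 -leNgt.
(* Order 1 is used because at order 0 the bound is 0^0 = 1. *)
have := H 1%N j; rewrite absv0 mulr0 expr1; congr (absv (_ - _) <= _).
by rewrite horner_coef0 coef_poly.
Qed.

Lemma meval_lipschitz P : exists2 C : R, 1 <= C & forall x y d, 0 <= d ->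
  (forall j, absv (x j) <= 1) -> (forall j, absv (y j) <= 1) ->
  (forall j, absv (x j - y j) <= d) ->
  absv (meval x P) <= C /\ absv (meval x P - meval y P) <= C * d.
Proof.
elim/mpoly_ring_ind: P => [c|i|P Q [C C1 HC] [D D1 HD]|P Q [C C1 HC] [D D1 HD]].
- exists (Num.max 1 (absv c)) => [|x y d d0 _ _ _]; first by rewrite le_max lexx.
  rewrite !mevalC subrr absv0 le_max lexx orbT; split=> //.
  by rewrite mulr_ge0 // le_max ler01.
- by exists 1 => // x y d d0 x1 y1 xy; rewrite !mevalXU mul1r.
- exists (Num.max C D) => [|x y d d0 x1 y1 xy]; first by rewrite le_max C1.
  have [xP dP] := HC x y d d0 x1 y1 xy; have [xQ dQ] := HD x y d d0 x1 y1 xy.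
  rewrite !mevalD opprD addrACA; split; apply: absvD_le.
  + by rewrite le_max xP.
  + by rewrite le_max xQ orbT.
  + by apply: le_trans dP _; rewrite ler_wpM2r // le_max lexx.
  + by apply: le_trans dQ _; rewrite ler_wpM2r // le_max lexx orbT.
- exists (C * D) => [|x y d d0 x1 y1 xy]; first exact: mulr_ege1.
  have [xP dP] := HC x y d d0 x1 y1 xy; have [xQ dQ] := HD x y d d0 x1 y1 xy.
  have yy j : absv (y j - y j) <= d by rewrite subrr absv0.
  have [yQ _] := HD y y d d0 y1 y1 yy.
  have C0 := le_trans ler01 C1; have D0 := le_trans ler01 D1.
  rewrite !mevalM; split; first by rewrite absvM ler_pM ?absv_ge0.
  set p := meval x P in xP dP *; set p' := meval y P in dP *.
  set q := meval x Q in xQ dQ *; set q' := meval y Q in yQ dQ *.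
  have -> : p * q - p' * q' = p * (q - q') + (p - p') * q' by ring.
  apply: absvD_le; first by rewrite absvM -mulrA ler_pM ?absv_ge0.
  by rewrite absvM mulrAC ler_pM ?absv_ge0.
Qed.

Lemma limit_approximation P : exists2 C : R, 1 <= C & forall k a x, B * absv a <= 1 ->
  limit_at a x -> absv (meval x P - (pev (psum k) P).[a]) <= C * (B * absv a) ^+ k.
Proof.
have [C C1 HC] := meval_lipschitz P; exists C => // k a x a1 xa; rewrite horner_pev.
have [||||_ //] := HC x (fun i => (psum k i).[a]) ((B * absv a) ^+ k).
- by rewrite exprn_ge0 ?Babsv_ge0.
- by move=> j; apply: limit_le1 xa.
- by move=> j; apply: psum_le1.
- by move=> j; apply: xa.
Qed.

Lemma le0_of_geometric (y C q : R) : 0 <= C -> 0 <= q -> q < 1 ->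
  (forall k, y <= C * q ^+ k) -> y <= 0.
Proof.
move=> C0 q0 q1 yC; rewrite leNgt; apply/negP => y0.
have C1 : 0 < C + 1 by rewrite ltr_wpDl.
have [k0 /(_ _ (leqnn k0))] := expr_arbitrarily_small q0 q1 (divr_gt0 y0 C1).
rewrite ltr_pdivlMr // mulrC => H; have := le_lt_trans (yC k0) _; move/(_ y).
suff: C * q ^+ k0 < y by move=> /[swap] /[apply]; rewrite ltxx.
by apply: le_lt_trans H; rewrite ler_wpM2r ?exprn_ge0 // lerDl.
Qed.

Lemma limit_vanishes P a x : B * absv a < 1 -> limit_at a x ->
  (forall k, 'X^k %| pev (psum k) P) -> meval x P = 0.
Proof.
move=> a1 xa Pk; have [C C1 HC] := limit_approximation P.
have [D D1 HD] := pev_coef_bound P.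
apply/eqP; rewrite -[_ == 0]negbK -absv_gt0 -leNgt.
have CD0 : 0 <= Num.max C D by rewrite le_max (le_trans ler01).
apply: (le0_of_geometric CD0 (Babsv_ge0 a) a1) => k.
rewrite -(subrK (pev (psum k) P).[a] (meval x P)); apply: absvD_le.
  apply: le_trans (HC k a x (ltW a1) xa) _.
  by rewrite ler_wpM2r ?exprn_ge0 ?Babsv_ge0 // le_max lexx.
apply: (coef_bound_horner B0 CD0 (ltW a1)); first exact/dvdp_XnP.
apply: coef_bound_le (HD B (psum k) B1 (psum_bound k)) => //.
by rewrite le_max lexx orbT.
Qed.

(** Identity principle: if [q_m] is the lowest coefficient in question, then |q_m| |a|^m is at most
    a constant times (B |a|)^(m+1), for all small a, and letting a tend to 0 gives [q_m = 0]. *)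
Lemma formal_vanishing P (rho : R) : 0 < rho ->
  (forall a x, absv a <= rho -> B * absv a < 1 -> limit_at a x -> meval x P = 0) ->
  forall k, 'X^k %| pev (psum k) P.
Proof.
move=> rho0 HP k; have [C C1 HC] := limit_approximation P.
have [D D1 HD] := pev_coef_bound P.
apply/dvdp_XnP => m; have [n] := ubnP m; elim: n m => // n IH m mn mk.
set q := pev (psum k) P.
have qm l : (l < m)%N -> q`_l = 0 by move=> lm; apply: IH; lia.
apply/eqP; rewrite -[_ == 0]negbK -absv_gt0 -leNgt.
have [w [w0 w1]] := absv_small_exists F.
have [k1 wk1] := expr_arbitrarily_small (ltW w0) w1 rho0.
have Bi : 0 < B^-1 by rewrite invr_gt0 (lt_le_trans ltr01).
have [k2 wk2] := expr_arbitrarily_small (ltW w0) w1 Bi.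
have M0 : 0 <= Num.max C D by rewrite le_max (le_trans ler01).
have c0 : 0 <= Num.max C D * B ^+ m.+1 * absv w ^+ (k1 + k2).
  by rewrite !mulr_ge0 ?exprn_ge0 ?absv_ge0.
apply: (le0_of_geometric c0 (ltW w0) w1) => i.
(* [k1] brings a into the disc of radius [rho], [k2] into the disc of convergence, and i is free to
   grow. *)
pose a := w ^+ (k1 + k2 + i).
have a_rho : absv a <= rho by rewrite absvX ltW // wk1 //; lia.
have Ba : B * absv a < 1.
  by rewrite absvX mulrC -ltr_pdivlMr ?div1r ?wk2 ?(lt_le_trans ltr01) //; lia.
have [x xa] := limit_exists Ba.
have a0 : 0 < absv a ^+ m by rewrite absvX !exprn_gt0.
rewrite -(ler_pM2r a0) -absvX -absvM.
have -> : Num.max C D * B ^+ m.+1 * absv w ^+ (k1 + k2) * absv w ^+ i * absv (a ^+ m) =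
    Num.max C D * (B * absv a) ^+ m.+1.
  have aE : absv w ^+ (k1 + k2) * absv w ^+ i = absv a by rewrite /a absvX (exprD _ (k1 + k2) i).
  by rewrite absvX exprMn [absv a ^+ m.+1]exprS -[_ * absv w ^+ i]mulrA aE; ring.
have -> : q`_m * a ^+ m = q.[a] - (q - q`_m *: 'X^m).[a].
  by rewrite hornerD hornerN hornerZ hornerXn subKr.
apply: absvB_le.
  have := HC k a x (ltW Ba) xa; rewrite (HP a x) // sub0r absvN => H.
  apply: le_trans H _; apply: ler_pM; rewrite ?exprn_ge0 ?Babsv_ge0 //; first exact: le_trans C1.
    by rewrite le_max lexx.
  by apply: ler_wiXn2l; rewrite ?Babsv_ge0 // ltW.
apply: (coef_bound_horner B0 M0 (ltW Ba)).
  move=> l; rewrite ltnS leq_eqVlt => /predU1P[->|lm].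
    by rewrite coefB coefZ coefXn eqxx mulr1 subrr.
  by rewrite coefB coefZ coefXn (ltn_eqF lm) mulr0 subr0 qm.
move=> l; rewrite coefB coefZ coefXn; case: eqP => [->|_].
  by rewrite mulr1 subrr absv0 mulr_ge0 ?exprn_ge0.
rewrite mulr0 subr0; apply: le_trans (HD B (psum k) B1 (psum_bound k) l) _.
by rewrite ler_wpM2r ?exprn_ge0 // le_max lexx orbT.
Qed.

End ConvergentSeries.

(** * Uniform comparison of two discs *)

Section Doubling.
Variables (R : realType) (F : nonArchLocalFieldType R) (N : nat).
Variables (psi : nat -> 'I_N -> F) (B : R).
Hypothesis B1 : 1 <= B.
Hypothesis psiB : forall m j, absv (psi m j) <= B ^+ m.
Implicit Types (a b : F) (x l : 'I_N -> F).

Let B0 : 0 <= B := le_trans ler01 B1.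

(* The coefficients of all orders lie in the span of finitely many of them, with
   controlled coordinates; for small arguments the tail of the series is thus
   dominated by its head, which is recovered from values at smaller arguments by
   inverting a matrix of Vandermonde type. *)
Lemma doubling (w : F) : 0 < absv w -> absv w < 1 ->
  exists c rho : R, [/\ 1 <= c, 0 < rho, B * rho < 1 &
  forall l a (r : R), a != 0 -> 0 < r -> absv a <= rho ->
  (forall b x, absv b <= absv w * absv a -> limit_at psi B b x ->
    absv (\sum_j l j * (x j - psi 0%N j)) <= r) ->
  forall x, limit_at psi B a x -> absv (\sum_j l j * (x j - psi 0%N j)) <= c * r].
Proof.
move=> w0 w1.
have [K [c [D [D1 cD psic]]]] := row_span_bound B1 psiB.
pose V : 'M[F]_K := \matrix_(i, e) (w ^+ e.+1) ^+ i.+1.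
have VU : V \in unitmx by apply: power_matrix_unit.
have [C C1 HC] := mx_bounded (invmx V).
have D0 : 0 < D := lt_le_trans ltr01 D1.
have C0 : 0 < C := lt_le_trans ltr01 C1.
(* E dominates B, D and [C * D ^+ K.+1], so the single choice E * rho = 1/2 gives convergence, decay
   of the tail and the final absorption. *)
pose E := B * (C * D ^+ K.+1).
have E1 : 1 <= E by rewrite !mulr_ege1 // exprn_ege1.
have E0 : 0 < E := lt_le_trans ltr01 E1.
have DE : D <= C * D ^+ K.+1.
  by rewrite exprS mulrCA ler_peMr ?(ltW D0) // mulr_ege1 // exprn_ege1.
have CDE : C * D ^+ K.+1 <= E by rewrite ler_peMl // mulr_ge0 ?exprn_ge0 ?ltW.
have BE : B <= E by rewrite ler_peMr // mulr_ege1 // exprn_ege1.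
pose rho := (2 * E)^-1.
have rho0 : 0 < rho by rewrite invr_gt0 mulr_gt0.
have Er : E * rho = 2^-1 by rewrite /rho invfM mulrCA divff ?mulr1 // gt_eqF.
have half1 : (2^-1 : R) < 1 by rewrite invf_lt1 ?ltr1n.
have small y : 0 <= y -> y <= E -> y * rho < 1.
  by move=> y0 yE; apply: le_lt_trans half1; rewrite -Er ler_pM2r.
exists C, rho; split=> //; first exact: small.
move=> l a r a0 r0 a_rho Hb x xa.
have aa0 : 0 < absv a by rewrite absv_gt0.
have scale y : 0 <= y -> y <= E -> y * absv a < 1.
  by move=> y0 yE; apply: le_lt_trans (small y y0 yE); rewrite ler_wpM2l.
have Ba : B * absv a < 1 by apply: scale.
have Da : D * absv a < 1 by apply: scale; [exact: ltW|apply: le_trans CDE].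
have CDa : C * D ^+ K.+1 * absv a < 1 by apply: scale; rewrite // mulr_ge0 ?exprn_ge0 ?ltW.
have a1 : absv a <= 1 by apply/ltW/(le_lt_trans _ Da); rewrite ler_peMl ?absv_ge0.
pose s m := \sum_j l j * psi m j.
have sE m : s m.+1 = \sum_i c m i * s i.+1.
  rewrite /s; under eq_bigr => j _ do rewrite psic mulr_sumr.
  rewrite exchange_big; apply: eq_bigr => i _; rewrite mulr_sumr.
  by apply: eq_bigr => j _; rewrite mulrCA.
pose T := \big[Num.max/0]_(i < K) absv (s i.+1 * a ^+ i.+1).
have T0 : 0 <= T by apply: bigmax_ge_id.
have leT (i : 'I_K) : absv (s i.+1 * a ^+ i.+1) <= T by apply: le_bigmax.
pose eps := D ^+ K.+1 * absv a.
have eps0 : 0 <= eps by rewrite mulr_ge0 ?exprn_ge0 ?ltW.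
(* A late term is a combination of the first K terms. The growth D^(m-K) is beaten by |a|^(m-K), and
   one spare factor |a| remains for [eps]. *)
have tail m b : (K <= m)%N -> absv b <= absv a -> absv (s m.+1 * b ^+ m.+1) <= eps * T.
  move=> Km ba; apply: (@le_trans _ _ (absv (s m.+1 * a ^+ m.+1))).
    rewrite !absvM ler_wpM2l ?absv_ge0 // !absvX.
    by rewrite lerXn2r ?nnegrE ?absv_ge0.
  rewrite sE mulr_suml; apply: absv_sum_le => [|i _]; first by rewrite mulr_ge0.
  have im : (i < m)%N by apply: leq_trans Km.
  have -> : c m i * s i.+1 * a ^+ m.+1 = c m i * a ^+ (m - i) * (s i.+1 * a ^+ i.+1).
    have -> : m.+1 = ((m - i) + i.+1)%N by rewrite addnS subnK // ltnW.
    by rewrite exprD; ring.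
  rewrite absvM; apply: ler_pM; rewrite ?absv_ge0 // absvM absvX.
  apply: le_trans (ler_wpM2r _ (cD m i)) _; first by rewrite exprn_ge0 ?absv_ge0.
  have -> : m.+1 = ((m - K) + K.+1)%N by rewrite addnS subnK.
  rewrite [D ^+ _]exprD.
  have -> : (m - i)%N = ((m - K) + (K - i.+1) + 1)%N.
    by move: Km (ltn_ord i); clear; lia.
  rewrite [absv a ^+ _]exprD [absv a ^+ _]exprD expr1.
  rewrite /eps; set P := D ^+ (m - K); set Q := D ^+ K.+1; set p := absv a ^+ (m - K).
  set q := absv a ^+ _; have -> : P * Q * (p * q * absv a) = (P * p * q) * (Q * absv a) by ring.
  rewrite ler_piMl //; apply: mulr_ile1.
  - by rewrite mulr_ge0 ?exprn_ge0 ?absv_ge0 // ltW.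
  - by rewrite exprn_ge0 ?absv_ge0.
  - by rewrite -exprMn exprn_ile1 ?mulr_ge0 ?absv_ge0 ?(ltW D0) ?(ltW Da).
  - by rewrite exprn_ile1 ?absv_ge0.
pose g k b := \sum_(m < k) s m.+1 * b ^+ m.+1.
have gE k b : \sum_j l j * ((psum psi k j).[b] - psi 0%N j) = g k b.
  rewrite /g; under eq_bigr => j _.
    rewrite /psum horner_poly big_ord_recl expr0 mulr1 addrAC subrr add0r mulr_sumr.
    over.
  rewrite exchange_big; apply: eq_bigr => m _; rewrite mulr_suml.
  by apply: eq_bigr => j _; rewrite mulrA.
pose Lam := 1 + \sum_j absv (l j).
have Lam0 : 0 < Lam by rewrite ltr_pwDl // sumr_ge0 // => j _; apply: absv_ge0.
have lLam j : absv (l j) <= Lam.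
  by rewrite /Lam (bigD1 j) //= addrCA lerDl addr_ge0 // sumr_ge0 // => i _; apply: absv_ge0.
have [k0 Hk0] := expr_arbitrarily_small (Babsv_ge0 B1 a) Ba (divr_gt0 r0 Lam0).
pose k := maxn k0 K.
have approx b y : absv b <= absv a -> limit_at psi B b y ->
    absv (\sum_j l j * (y j - psi 0%N j) - g k b) <= r.
  move=> ba yb; rewrite -gE -sumrB; apply: absv_sum_le => [|j _]; first exact: ltW.
  rewrite -mulrBr opprB addrA subrK absvM.
  apply: (@le_trans _ _ (Lam * (B * absv a) ^+ k)).
    apply: ler_pM; rewrite ?absv_ge0 //; apply: le_trans (yb k j) _.
    by rewrite lerXn2r ?nnegrE ?mulr_ge0 ?absv_ge0 // ler_wpM2l.
  by rewrite mulrC -ler_pdivlMr // ltW // Hk0 // leq_maxl.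
have head b : absv b <= absv a ->
    absv (g k b - \sum_(i < K) s i.+1 * b ^+ i.+1) <= eps * T.
  move=> ba; have kE : k = (K + (k - K))%N by rewrite subnKC // leq_maxr.
  rewrite /g kE big_split_ord /= addrAC subrr add0r.
  apply: absv_sum_le => [|i _]; first by rewrite mulr_ge0.
  by apply: tail => //; apply: leq_addr.
(* Inverting V recovers the first K terms from the values at [w ^+ e.+1 * a], up to errors r and
   [eps * T]. Since C * eps < 1, the error in T is absorbed. *)
have Tr : T <= C * r.
  pose y : 'rV[F]_K := \row_i (s i.+1 * a ^+ i.+1).
  have yV e : absv ((y *m V) 0 e) <= Num.max r (eps * T).
    have we : absv (w ^+ e.+1 * a) <= absv w * absv a.
      by rewrite absvM absvX exprS ler_wpM2r ?absv_ge0 // ler_piMr ?absv_ge0 // exprn_ile1 ?absv_ge0 ?ltW.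
    have wea : absv (w ^+ e.+1 * a) <= absv a.
      by apply: le_trans we _; rewrite ler_piMl ?absv_ge0 ?ltW.
    have -> : (y *m V) 0 e = \sum_(i < K) s i.+1 * (w ^+ e.+1 * a) ^+ i.+1.
      rewrite mxE; apply: eq_bigr => i _; rewrite !mxE [in RHS]exprMn; ring.
    have Bwe : B * absv (w ^+ e.+1 * a) < 1 by apply: le_lt_trans Ba; rewrite ler_wpM2l.
    have [z zb] := limit_exists B1 psiB Bwe.
    have H1 := Hb _ z we zb; have H2 := approx _ z wea zb; have H3 := head _ wea.
    set S := \sum_(i < K) _ in H3 *; set g' := g k _ in H2 H3; set t := \sum_j _ in H1 H2.
    have -> : S = t - (t - g') - (g' - S) by ring.
    by apply: absvB_le; [apply: absvB_le|]; rewrite le_max ?H1 ?H2 ?H3 ?orbT.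
  have yT : T <= C * Num.max r (eps * T).
    have R0 : 0 <= C * Num.max r (eps * T) by rewrite mulr_ge0 ?(ltW C0) // le_max (ltW r0).
    apply: bigmax_le => // i _.
    have -> : s i.+1 * a ^+ i.+1 = (y *m V *m invmx V) 0 i by rewrite mulmxK // mxE.
    rewrite mxE; apply: absv_sum_le => // e _.
    by rewrite absvM mulrC ler_pM ?absv_ge0.
  move: yT; rewrite maxEle; case: ifP => // _ H.
  apply: le_trans (_ : 0 <= _); last by rewrite mulr_ge0 ?ltW.
  rewrite leNgt; apply/negP => T1; move: H; rewrite leNgt => /negP; apply.
  by rewrite mulrA /eps mulrA gtr_pMl.
rewrite -(subrK (g k a) (\sum_j _)); apply: absvD_le.
  by apply: le_trans (approx a x (lexx _) xa) _; rewrite ler_peMl // ltW.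
apply: le_trans Tr; rewrite -(subrK (\sum_(i < K) s i.+1 * a ^+ i.+1) (g k a)).
apply: absvD_le; last by apply: absv_sum_le.
apply: le_trans (head a (lexx _)) _; rewrite ler_piMl //.
apply/ltW/(le_lt_trans _ CDa); rewrite -mulrA ler_peMl //.
Qed.

End Doubling.

(** * Linear groups *)

Definition char_coef (R : comNzRingType) n k : mpoly (n * n) R :=
  (char_poly (\matrix_(i, j) mvar (mxvec_index i j)))`_k.

Lemma meval_char_coef (R : comNzRingType) n k (A : 'M[R]_n) :
  meval (vec A) (char_coef R n k) = (char_poly A)`_k.
Proof.
rewrite /char_coef -[LHS]coef_map map_char_poly; congr ((char_poly _)`_k).
by apply/matrixP => i j; rewrite !mxE /= mevalXU /vec mxvecE.
Qed.

Lemma map_char_coef (R S : comNzRingType) (h : {rmorphism R -> S}) n k :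
  map_mpoly h (char_coef R n k) = char_coef S n k.
Proof.
rewrite /char_coef -[LHS]coef_map map_char_poly; congr ((char_poly _)`_k).
by apply/matrixP => i j; rewrite !mxE /= map_mpolyX.
Qed.

Lemma char_poly_conj (F : fieldType) n (g A : 'M[F]_n) : g \in unitmx ->
  char_poly (invmx g *m A *m g) = char_poly A.
Proof.
move=> gU; rewrite /char_poly; pose h := map_mx polyC g; pose h' := map_mx polyC (invmx g).
have h'h : h' *m h = 1%:M by rewrite -map_mxM mulVmx // map_mx1.
have -> : char_poly_mx (invmx g *m A *m g) = h' *m char_poly_mx A *m h.
  rewrite /char_poly_mx mulmxBr mulmxBl !map_mxM scalar_mxC; congr (_ - _).
  by rewrite -mulmxA h'h mulmx1.
by rewrite !det_mulmx mulrAC -det_mulmx h'h det1 mul1r.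
Qed.

Lemma unipotent_of_char_poly (L : closedFieldType) n (A : 'M[L]_n) :
  char_poly A = char_poly (1%:M : 'M[L]_n) -> unipotent A.
Proof.
case: n A => [|n] A cA; first by exists 1%N; apply/matrixP => -[].
exists n.+1; have := Cayley_Hamilton A; rewrite cA char_poly_trig ?scalar_mx_is_trig //.
under eq_bigr => i _ do rewrite mxE eqxx.
rewrite prodr_const card_ord rmorphXn rmorphB /= horner_mx_X horner_mx_C.
by [].
Qed.

Section LinearGroup.
Variables (F : fieldType) (L : closedFieldType) (iota : {rmorphism F -> L}).
Variables (n : nat) (G : linearGroup iota n).
Local Notation N := (n * n)%N.
Local Notation GL := (geometric_points G).
Local Notation X := (points GL).

Lemma linearGroup1 : GL 1%:M. Proof. by case: (linearGroup_subgroup G). Qed.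

Lemma linearGroupM A B : GL A -> GL B -> GL (A *m B).
Proof. by case: (linearGroup_subgroup G) => _ _ GM _; apply: GM. Qed.

Lemma linearGroupV A : GL A -> GL (invmx A).
Proof. by case: (linearGroup_subgroup G) => _ _ _; apply. Qed.

Lemma linearGroupU A : GL A -> A \in unitmx.
Proof. by case: (linearGroup_subgroup G) => GU _ _ _ /GU. Qed.

Lemma vanishing_idealE p : vanishing_ideal G p <-> vanishes X p.
Proof. by split=> [H _ [A GA <-]|H A GA]; [apply: H|apply: H; exists A]. Qed.

Lemma linearGroup_defined p : vanishes X p ->
  exists s : seq (mpoly N L * mpoly N F),
    (forall cq, cq \in s -> vanishes X (map_mpoly iota cq.2)) /\
    p = \sum_(cq <- s) cq.1 * map_mpoly iota cq.2.
Proof.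
move=> /vanishing_idealE/linearGroup_defined_over[s [Hs ->]].
by exists s; split=> // cq /Hs/vanishing_idealE.
Qed.

Hypothesis G_connected : zariski_connected G.

(** Translations make G homogeneous, so connectedness already gives irreducibility. The equations of
    G are added to both systems to obtain closed subsets of GL_n. *)
Lemma linearGroup_prime p q : vanishes X (p * q) -> vanishes X p \/ vanishes X q.
Proof.
apply: vanishes_prime; last by exists (vec 1%:M); exists 1%:M => //; apply: linearGroup1.
- exact: (points_homogeneous linearGroupM linearGroupV linearGroupU).
move=> S1 S2 cover disj.
have [S GS] := linearGroup_closed G.
pose W (T : set (mpoly N L)) := [set A | GL A /\ forall p, T p -> mxeval p A = 0]%classic.
have cW T : zariski_closed (W T).
  exists (S `|` T)%classic; apply/seteqP; split=> A /=.
    rewrite {1}/W /= {1}GS => -[[AU SA] TA]; split=> // r [/SA|/TA] //.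
  move=> [AU STA]; split; last by move=> r Tr; apply: STA; right.
  by rewrite GS; split=> // r Sr; apply: STA; left.
have [] := G_connected (cW S1) (cW S2).
- apply/seteqP; split=> A /=; first by case=> -[].
  by move=> GA; have [H|H] := cover (vec A) (ex_intro2 _ _ A GA erefl); [left|right].
- apply/seteqP; split=> A //= -[[GA H1] [_ H2]].
  exact: (disj (vec A) (ex_intro2 _ _ A GA erefl)).
- move=> W0; left => _ [A GA <-] H; have : W S1 A by [].
  by rewrite W0.
- move=> W0; right => _ [A GA <-] H; have : W S2 A by [].
  by rewrite W0.
Qed.

Lemma unipotent_linearGroup_trivial : reductive G -> (forall A, GL A -> unipotent A) ->
  GL = [set 1%:M]%classic.
Proof.
rewrite /reductive => <- Gu; apply/seteqP; split=> A.
  move=> GA; exists GL => //; split.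
  - exact: linearGroup_subgroup.
  - exact: linearGroup_closed.
  - exact: G_connected.
  - by split=> // A' B GA' GB; do !apply: linearGroupM; rewrite //; apply: linearGroupV.
  - exact: Gu.
by case=> U [_ _ _ [UG _] _] /UG.
Qed.

End LinearGroup.

(** * Congruence subgroups and fairness *)

Section CongruenceSubgroups.
Variables (R : realType) (F : nonArchLocalFieldType R) (L : closedFieldType).
Variables (iota : {rmorphism F -> L}) (n : nat) (G : linearGroup iota n).
Local Notation GF := (rational_points G).
Implicit Types (A B : 'M[F]_n) (e r : R) (h : GF).

Definition near_one e A := forall i j, absv ((A - 1%:M) i j) < e.

Lemma near_one1 e : 0 < e -> near_one e 1%:M.
Proof. by move=> e0 i j; rewrite subrr mxE absv0. Qed.

Lemma near_oneM e A B : 0 < e -> e <= 1 -> near_one e A -> near_one e B -> near_one e (A *m B).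
Proof.
move=> e0 e1 A1 B1 i j.
have -> : A *m B - 1%:M = (A - 1%:M) *m (B - 1%:M) + (A - 1%:M) + (B - 1%:M).
  by rewrite mulmxBl !mulmxBr mulmx1 !mul1mx addrAC subrK addrA subrK.
rewrite mxE; apply: le_lt_trans (absvD _ _) _; rewrite gt_max B1 andbT.
rewrite mxE; apply: le_lt_trans (absvD _ _) _; rewrite gt_max A1 andbT mxE.
elim/big_rec: _ => [|k x _ xe]; first by rewrite absv0.
apply: le_lt_trans (absvD _ _) _; rewrite gt_max xe andbT absvM.
apply: le_lt_trans (B1 k j); rewrite ler_piMl ?absv_ge0 //.
by apply: ltW; apply: lt_le_trans (A1 i k) e1.
Qed.

Lemma open_contains_near_one (U : set GF) : open U -> U 1%g ->
  exists2 r, 0 < r & forall h, near_one r (val h) -> U h.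
Proof.
move=> oU U1.
have [V oV VU] : exists2 V : set 'M[F]_n, open V & (val @^-1` V)%classic = U := oU.
have : nbhs (1%:M : 'M[F]_n) V.
  by apply: open_nbhs_nbhs; split=> //; move: U1; rewrite -VU.
move=> [P P1 PV].
have /boolp.choice[e He] : forall ij : 'I_n * 'I_n, exists e, 0 < e /\
    forall y : F, absv ((1%:M : 'M[F]_n) ij.1 ij.2 - y) < e -> P ij.1 ij.2 y.
  move=> [i j]; have := P1 i j; rewrite absv_nbhs => -[e /= e0 eP].
  by exists e; split.
exists (\big[Num.min/1]_ij e ij).
  by apply: lt_bigmin => // ij _; case: (He ij).
move=> h h1; rewrite -VU; apply: PV => i j; have [_ /=] := He (i, j); apply.
rewrite absv_dist; apply: (@lt_le_trans _ _ (\big[Num.min/1]_ij e ij)).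
  by have := h1 i j; rewrite !mxE.
exact: bigmin_le_cond.
Qed.

(** Imposing the condition on both h and its inverse makes stability under inversion immediate;
    products use the ultrametric inequality and e <= 1. *)
Lemma congruence_open_subgroup (H : set GF) e : 0 < e -> e <= 1 -> open_subgroup H ->
  open_subgroup [set h | [/\ H h, near_one e (val h) & near_one e (val h^-1%g)]]%classic.
Proof.
move=> e0 e1 [oH [H1 HM HV]]; split; last first.
  split=> [|x y [Hx x1 x'1] [Hy y1 y'1]|x [Hx x1 x'1]] /=.
  - by split=> //; rewrite ?invmx1; apply: near_one1.
  - split; first exact: HM.
      exact: (near_oneM e0 e1 x1 y1).
    have -> : invmx (sval x *m sval y) = invmx (sval y) *m invmx (sval x) := congr1 val (invgM x y).
    exact: (near_oneM e0 e1 y'1 x'1).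
  - by split; rewrite /= ?invmxK //; apply: HV.
rewrite openE => x [Hx x1 x'1]; rewrite /interior.
have nearx (f : GF -> GF) : {for x, continuous f} -> near_one e (val (f x)) ->
    \forall t \near x, near_one e (val (f t)).
  move=> fx x1'; suff : \forall t \near x, forall ij : 'I_n * 'I_n,
      absv ((val (f t) - 1%:M) ij.1 ij.2) < e.
    by apply: filterS => t Ht i j; apply: (Ht (i, j)).
  pose P (ij : 'I_n * 'I_n) (t : GF) := absv ((val (f t) - 1%:M) ij.1 ij.2) < e.
  apply: (@filter_forall _ _ P (nbhs x)) => -[i j].
  have : {for x, continuous (fun t => val (f t) i j)}.
    apply: (@continuous_comp _ _ _ f (fun y : GF => val y i j)) => //.
    exact: rational_entry_continuous.
  move/cvg_absvP/(_ e e0); apply: filterS => t xt; rewrite /P !mxE.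
  have -> : val (f t) i j - (i == j)%:R = - (val (f x) i j - val (f t) i j) + (val (f x) - 1%:M) i j.
    by rewrite !mxE; ring.
  by apply: le_lt_trans (absvD _ _) _; rewrite gt_max absvN xt x1'.
near=> t; split.
- near: t; exact: open_nbhs_nbhs.
- near: t; apply: (nearx id) => //; exact: cvg_id.
- near: t; apply: (nearx (fun t => t^-1%g)) => //; exact: rational_inv_continuous.
Unshelve. all: by end_near. Qed.

(** For a smaller subgroup C of H, one inclusion of the intersections is automatic, so a failure of
    strictness is the reverse inclusion. Applied to a conjugate of h in both K and the conjugate of
    H, it puts h in C. The radius r is such that r-closeness to 1 implies membership in K and in
    H. *)
Lemma not_fair_contraction (K : set GF) : open_subgroup K -> ~ fair K ->
  exists2 r : R, 0 < r & forall e : R, 0 < e -> exists2 g : 'M[F]_n, rational_set G g &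
  forall A, rational_set G A -> near_one r A -> near_one r (g *m A *m invmx g) -> near_one e A.
Proof.
move=> oK nfair.
have [H [oH HK bad]] : exists H, [/\ open_subgroup H, (H `<=` K)%classic &
    forall H', open_subgroup H' -> (H' `<=` K)%classic ->
    exists g, ~ (K `&` conj_set g H' `<` K `&` conj_set g H)%classic].
  apply: contrapT => nex; apply: nfair => H oH HK; apply: contrapT => nH'.
  apply: nex; exists H; split=> // H' oH' H'K; apply: contrapT => ng.
  apply: nH'; exists H'; split=> // g; apply: contrapT => ngH.
  by apply: ng; exists g.
have [oK' [K1 _ _]] := oK; have [oH' [H1 _ _]] := oH.
have [r1 r10 HK1] := open_contains_near_one oK' K1.
have [r2 r20 HH1] := open_contains_near_one oH' H1.
exists (Num.min r1 r2) => [|e e0]; first by rewrite lt_min r10.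
have e'0 : 0 < Num.min 1 e by rewrite lt_min ltr01.
have e'1 : Num.min 1 e <= 1 by rewrite ge_min lexx.
have oC := congruence_open_subgroup e'0 e'1 oH.
set C := [set h | _]%classic in oC.
have CH : (C `<=` H)%classic by move=> h [].
have [g ng] := bad C oC (subset_trans CH HK).
exists (val g); first exact: Defs.rationalP.
move=> A GA Ar gAr.
pose h : GF := exist _ A (mem_set GA).
suff : C h.
  by move=> [_ h1 _] i j; apply: lt_le_trans (h1 i j) _; rewrite ge_min lexx orbT.
apply: contrapT => nCh; apply: ng; split.
  by move=> x [Kx [y Cy yx]]; split=> //; exists y => //; apply: CH.
move=> sub.
have Hh : H h by apply: HH1 => i j; apply: lt_le_trans (Ar i j) _; rewrite ge_min lexx orbT.
have Kgh : K (g * h * g^-1)%g.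
  by apply: HK1 => i j; apply: lt_le_trans (gAr i j) _; rewrite ge_min lexx.
have [_ gC] : (K `&` conj_set g C)%classic (g * h * g^-1)%g.
  by apply: sub; split=> //; apply: imageP.
case: gC => y Cy /mulIg/mulgI yh; apply: nCh; rewrite -yh; exact: Cy.
Qed.

End CongruenceSubgroups.

(** * Analytic curves of rational points *)

(** If s A = 0, then s = - s (A - 1), and the largest entry of s would be strictly smaller than
    itself. *)
Lemma near_one_unit (R : realType) (F : nonArchLocalFieldType R) n (A : 'M[F]_n) :
  near_one 1 A -> A \in unitmx.
Proof.
move=> A1; apply: unitmx_ker => s sA; apply/eqP; apply: contrapT => /negP/eqP s0.
have [i1 si1] : exists i, s 0 i != 0.
  apply: contrapT => nex; apply: s0; apply/rowP => i; rewrite mxE.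
  by apply/eqP; apply: contrapT => /negP si; apply: nex; exists i.
have [i0 _ imax] := @Order.TotalTheory.arg_maxP _ _ _ i1 xpredT (fun i => absv (s 0 i)) isT.
have i00 : 0 < absv (s 0 i0) by apply: lt_le_trans (imax i1 isT); rewrite absv_gt0.
suff : absv (s 0 i0) < absv (s 0 i0) by rewrite ltxx.
have {1}-> : s 0 i0 = - (s *m (A - 1%:M)) 0 i0.
  by rewrite mulmxBr sA mulmx1 sub0r mxE opprK.
rewrite absvN mxE; elim/big_rec: _ => [|k x _ xs]; first by rewrite absv0.
apply: le_lt_trans (absvD _ _) _; rewrite gt_max xs andbT absvM.
have [->|sk] := eqVneq (s 0 k) 0; first by rewrite absv0 mul0r.
by apply: lt_le_trans (imax k isT); rewrite gtr_pMr ?absv_gt0.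
Qed.

Definition mxof (R : Type) n (x : 'I_(n * n) -> R) : 'M[R]_n := vec_mx (\row_k x k).

Lemma vec_mxof (R : nzRingType) n (x : 'I_(n * n) -> R) : vec (mxof x) = x.
Proof. exact: vec_of_row. Qed.

Lemma mxofE (R : nzRingType) n (x : 'I_(n * n) -> R) i j : mxof x i j = x (mxvec_index i j).
Proof. by rewrite -[in RHS](vec_mxof x) /vec mxvecE. Qed.

Lemma mxof_vec (R : nzRingType) n (A : 'M[R]_n) : mxof (vec A) = A.
Proof. exact: vecK. Qed.

(** Displays each entry of a conjugated difference as a linear functional of the coordinates, the
    form in which [doubling] applies. *)
Lemma mxof_conjE (R : comNzRingType) n (g g' : 'M[R]_n) (x y : 'I_(n * n) -> R) i j :
  (g *m (mxof x - mxof y) *m g') i j =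
  \sum_k (g *m vec_mx (delta_mx 0 k) *m g') i j * (x k - y k).
Proof.
have -> : mxof x - mxof y = \sum_k (x k - y k) *: vec_mx (delta_mx 0 k).
  have -> : mxof x - mxof y = mxof (fun k => x k - y k).
    by apply/matrixP => a b; rewrite [LHS]mxE [X in _ + X]mxE !mxofE.
  rewrite /mxof [X in vec_mx X]row_sum_delta linear_sum.
  by apply: eq_bigr => k _; rewrite linearZ mxE.
rewrite mulmx_sumr mulmx_suml summxE; apply: eq_bigr => k _.
by rewrite -scalemxAr -scalemxAl mxE mulrC.
Qed.

Section CurvesOfRationalPoints.
Variables (R : realType) (F : nonArchLocalFieldType R) (L : closedFieldType).
Variables (iota : {rmorphism F -> L}) (n : nat) (G : linearGroup iota n).
Local Notation N := (n * n)%N.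
Local Notation GL := (geometric_points G).
Local Notation X := (points GL).
Hypothesis G_connected : zariski_connected GL.
Variables (Z : {set 'I_N}) (f : 'I_N -> mpoly N F).
Hypothesis Zf : pivots iota GL Z f.
Variable u : 'I_N -> F.

Definition curve_coef m j : F := (curve Z f (vec 1%:M) u m j)`_m.

Lemma curve_psum k j : curve Z f (vec 1%:M) u k j = psum curve_coef k j.
Proof.
apply/polyP => m; rewrite coef_poly ltnS; case: leqP => mk; first exact: curve_coef_stable.
exact: curve_coef_gt.
Qed.

Lemma curve_coef0 j : curve_coef 0 j = vec 1%:M j.
Proof. by rewrite /curve_coef /= coefC. Qed.

Lemma curve_coef_bound : exists2 B : R, 1 <= B & forall m j, absv (curve_coef m j) <= B ^+ m.
Proof.
have [B B1 HB] := curve_bound Z f (vec 1%:M) u.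
have B21 : 1 <= B ^+ 2 by rewrite exprn_ege1.
exists (B ^+ 2) => // -[|m] j.
  rewrite curve_coef0 expr0 /vec; case/mxvec_indexP: j => i j.
  by rewrite mxvecE mxE; case: (i == j); rewrite ?absv1 ?absv0.
have := HB m.+1 j m.+1; rewrite coefB coefC subr0 => /le_trans; apply.
apply: ler_piMl; first by rewrite exprn_ge0 // (le_trans ler01 B21).
by rewrite expr1 invf_le1 // (lt_le_trans ltr01).
Qed.

Variable B : R.
Hypothesis B1 : 1 <= B.
Hypothesis psiB : forall m j, absv (curve_coef m j) <= B ^+ m.
Local Notation limit a x := (limit_at curve_coef B a x).

Let B0 : 0 < B := lt_le_trans ltr01 B1.

Lemma limit_dist a x i j : B * absv a <= 1 -> limit a x ->
  absv ((mxof x - 1%:M) i j) <= B * absv a.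
Proof.
move=> a1 xa; rewrite mxE mxofE [X in _ + X](_ : _ = - curve_coef 0 (mxvec_index i j)); last first.
  by rewrite curve_coef0 /vec mxvecE !mxE.
set k := mxvec_index i j; have := xa 1%N k; rewrite expr1 => H.
rewrite -(subrK (psum curve_coef 1 k).[a] (x k)) -addrA; apply: absvD_le => //.
rewrite psumS hornerD hornerZ hornerXn {1}/psum horner_poly big_ord1 expr0 mulr1.
rewrite addrC addKr absvM expr1 ler_wpM2r ?absv_ge0 //.
Qed.

(** Formal equations over F pass to the limit, and they generate the equations over L. Invertibility
    is checked separately, as closed sets are taken inside GL_n. *)
Lemma limit_rational a x : B * absv a < 1 -> limit a x -> rational_set G (mxof x).
Proof.
move=> a1 xa; have xU : mxof x \in unitmx.
  by apply: near_one_unit => i j; apply: le_lt_trans (limit_dist i j (ltW a1) xa) a1.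
have xI (P : mpoly N F) : vanishes X (map_mpoly iota P) -> meval x P = 0.
  move=> IP; apply: (limit_vanishes B1 psiB a1 xa) => k.
  have := curve_arc (linearGroup1 G) (@linearGroupM _ _ _ _ G) (@linearGroupV _ _ _ _ G)
    (@linearGroupU _ _ _ _ G) (linearGroup_prime G_connected) (@linearGroup_defined _ _ _ _ G)
    Zf u k IP.
  rewrite pev_map (pev_eq P (curve_psum k)) => /dvdp_XnP H; apply/dvdp_XnP => m mk.
  by have /eqP := H m (ltnW mk); rewrite coef_map fmorph_eq0 => /eqP.
have [S GS] := linearGroup_closed G.
rewrite /rational_set /= GS; split; first by rewrite map_unitmx.
move=> p Sp; have Ip : vanishes X p.
  by move=> _ [A GA <-]; move: GA; rewrite GS => -[_ /(_ p Sp)].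
have [s [Hs ->]] := linearGroup_defined Ip.
rewrite -[LHS]/(meval (vec _) _) rmorph_sum big_seq big1 //= => cq /Hs Icq.
rewrite mevalM; have -> : vec (map_mx iota (mxof x)) = iota \o x.
  by apply/funext => k; rewrite vec_map vec_mxof.
by rewrite meval_map_mpoly xI // rmorph0 mulr0.
Qed.

(* The doubling property turns smallness of the conjugated curve near the origin
   into smallness on a disc that does not depend on the conjugating element. *)
Lemma contracted_curve (r : R) : 0 < r ->
  (forall e : R, 0 < e -> exists2 g : 'M[F]_n, rational_set G g &
    forall A, rational_set G A -> near_one r A -> near_one r (g *m A *m invmx g) ->
    near_one e A) ->
  exists rho : R, [/\ 0 < rho, B * rho < 1 & forall e : R, 0 < e ->
    exists2 g : 'M[F]_n, g \in unitmx & forall a x, absv a <= rho -> limit a x ->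
    near_one e (invmx g *m mxof x *m g)].
Proof.
move=> r0 bad; have [w [w0 w1]] := absv_small_exists F.
have [c [rho' [c1 rho'0 Brho' double]]] := doubling B1 psiB w0 w1.
have c0 : 0 < c := lt_le_trans ltr01 c1.
have rB : 0 < r / (2 * B) by rewrite divr_gt0 // mulr_gt0.
pose rho := Num.min rho' (r / (2 * B)).
have rho0 : 0 < rho by rewrite lt_min rho'0.
have Brho : B * rho < 1.
  by apply: le_lt_trans Brho'; rewrite ler_pM2l // ge_min lexx.
have half (y : R) : 0 < y -> y / 2 < y.
  by move=> y0; rewrite ltr_pdivrMr // ltr_pMr // ltr1n.
have Brho_r : B * rho < r.
  apply: le_lt_trans (half r r0); apply: (@le_trans _ _ (B * (r / (2 * B)))).
    by rewrite ler_pM2l // ge_min lexx orbT.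
  have vn0 : B != 0 by rewrite gt_eqF.
  have -> : B * (r / (2 * B)) = r / 2 by field.
  exact: lexx.
exists rho; split=> // e e0.
(* The contraction is applied at a level small enough to beat the doubling constant: c * e' < r. *)
pose e' := Num.min e (r / (2 * c)).
have e'0 : 0 < e' by rewrite lt_min e0 divr_gt0 // mulr_gt0.
have ce' : c * e' < r.
  apply: le_lt_trans (half r r0); apply: (@le_trans _ _ (c * (r / (2 * c)))).
    by rewrite ler_pM2l // ge_min lexx orbT.
  have vn0 : c != 0 by rewrite gt_eqF.
  have -> : c * (r / (2 * c)) = r / 2 by field.
  exact: lexx.
have [g Gg Hg] := bad e' e'0.
have gU : g \in unitmx by have := linearGroupU Gg; rewrite map_unitmx.
exists g => //.
pose cj x := invmx g *m mxof x *m g.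
pose l i j k := (invmx g *m vec_mx (delta_mx 0 k) *m g) i j.
have one : mxof (curve_coef 0) = 1%:M.
  by rewrite -[RHS]mxof_vec; congr mxof; apply/funext => j; apply: curve_coef0.
have cjE x : cj x - 1%:M = invmx g *m (mxof x - 1%:M) *m g.
  by rewrite mulmxBr mulmxBl mulmx1 mulVmx.
have cjl x i j : (cj x - 1%:M) i j = \sum_k l i j k * (x k - curve_coef 0 k).
  by rewrite cjE -one mxof_conjE.
have gcj x : g *m cj x *m invmx g = mxof x.
  by rewrite /cj !mulmxA mulmxV // mul1mx -mulmxA mulmxV // mulmx1.
have small (a : F) : absv a <= rho -> B * absv a < 1.
  by move=> ar; apply: le_lt_trans Brho; rewrite ler_pM2l.
have Gcj a x : absv a <= rho -> limit a x -> rational_set G (cj x).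
  move=> /small a1 xa; rewrite /rational_set /= !map_mxM map_invmx.
  by do !apply: linearGroupM => //; [apply: linearGroupV|apply: limit_rational xa].
have improve a x : absv a <= rho -> limit a x -> near_one r (cj x) -> near_one e' (cj x).
  move=> ar xa rx; apply: Hg => //; first exact: Gcj xa.
  rewrite gcj => i j; apply: le_lt_trans (limit_dist i j (ltW (small a ar)) xa) _.
  by apply: le_lt_trans Brho_r; rewrite ler_pM2l.
suff all_near : forall a x, absv a <= rho -> limit a x -> near_one r (cj x).
  move=> a x ar xa i j; apply: lt_le_trans (improve a x ar xa (all_near a x ar xa) i j) _.
  by rewrite ge_min lexx.
(* The starting disc may depend on g, through bounds for the entries of g and its inverse. *)
have [i0 Hi0] : exists i0, forall a x, absv a <= rho * absv w ^+ i0 -> limit a x ->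
    near_one r (cj x).
  have [C1 C11 HC1] := mx_bounded (invmx g); have [C2 C21 HC2] := mx_bounded g.
  have C10 : 0 < C1 := lt_le_trans ltr01 C11; have C20 : 0 < C2 := lt_le_trans ltr01 C21.
  have C0 : 0 < C1 * C2 * (B * rho) by rewrite !mulr_gt0.
  have [i0 /(_ i0 (leqnn _)) wi] := expr_arbitrarily_small (ltW w0) w1 (divr_gt0 r0 C0).
  exists i0 => a x ai xa i j.
  have ar : absv a <= rho.
    by apply: le_trans ai _; rewrite ler_piMr ?(ltW rho0) // exprn_ile1 ?absv_ge0 ?(ltW w1).
  apply: (@le_lt_trans _ _ (C1 * (B * absv a) * C2)); last first.
    apply: (@le_lt_trans _ _ (C1 * C2 * (B * rho) * absv w ^+ i0)); last first.
      by rewrite mulrC -ltr_pdivlMr.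
    have -> : C1 * C2 * (B * rho) * absv w ^+ i0 = C1 * (B * (rho * absv w ^+ i0)) * C2 by ring.
    by rewrite ler_pM2r // !ler_pM2l.
  have Ba0 : 0 <= B * absv a by rewrite mulr_ge0 ?absv_ge0 // ltW.
  rewrite cjE mxE; apply: absv_sum_le => [|k _]; first by rewrite !mulr_ge0 ?absv_ge0 ?(ltW C10) ?(ltW C20) ?(ltW B0).
  rewrite absvM; apply: ler_pM; rewrite ?absv_ge0 // mxE.
  apply: absv_sum_le => [|m _]; first by rewrite mulr_ge0 // ltW.
  by rewrite absvM; apply: ler_pM; rewrite ?absv_ge0 // limit_dist // ltW // small.
(* Each step enlarges the radius by |w|^-1: on the smaller disc the bound r improves to e' by
   contraction, and doubling yields c * e' < r on the larger one. *)
suff down i : forall a x, absv a <= rho * absv w ^+ (i0 - i) -> limit a x -> near_one r (cj x).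
  by have := down i0; rewrite subnn expr0 mulr1.
elim: i => [|i IH]; first by rewrite subn0.
have [i0i|ii0] := leqP i0 i.
  have -> : (i0 - i.+1 = i0 - i)%N by move: i0i; clear; lia.
  exact: IH.
have iE : (i0 - i = (i0 - i.+1).+1)%N by rewrite subnSK.
move=> a x ai xa i' j'.
have ar : absv a <= rho.
  by apply: le_trans ai _; rewrite ler_piMr ?(ltW rho0) // exprn_ile1 ?absv_ge0 ?(ltW w1).
(* The origin is treated directly, since [doubling] divides by powers of a in effect and requires a
   != 0. *)
have [a00|a0] := eqVneq a 0.
  have x0 : mxof x = 1%:M.
    rewrite -one; congr mxof; apply/funext; apply: (@limit0 _ _ _ _ B).
    by rewrite -a00.
  by rewrite /cj x0 mulmx1 mulVmx // subrr mxE absv0.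
rewrite cjl; apply: le_lt_trans ce'.
apply: (double (l i' j') a e' a0 e'0 _ _ x xa).
  by apply: le_trans ar _; rewrite ge_min lexx.
move=> b y ba yb; rewrite -cjl; apply: ltW; apply: (improve b y _ yb).
- by apply: le_trans ba (le_trans _ ar); rewrite ler_piMl ?absv_ge0 // ltW.
- apply: (IH b y _ yb); rewrite iE exprS mulrCA.
  by apply: le_trans ba _; rewrite ler_pM2l.
Qed.

(** The value at a point of the curve equals the value at its conjugate, which is arbitrarily close
    to 1; a Lipschitz bound independent of g gives equality with the value at 1, and the identity
    principle makes it formal. *)
Lemma char_coef_curve (rho : R) k : 0 < rho -> B * rho < 1 ->
  (forall e : R, 0 < e -> exists2 g : 'M[F]_n, g \in unitmx &
    forall a x, absv a <= rho -> limit a x -> near_one e (invmx g *m mxof x *m g)) ->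
  forall m, 'X^(m.+1) %| pev (curve Z f (vec 1%:M) u m)
    (char_coef F n k - mpolyC N (char_poly (1%:M : 'M[F]_n))`_k).
Proof.
move=> rho0 Brho conj m; set P := _ - _.
have P_vanish a x : absv a <= rho -> B * absv a < 1 -> limit a x -> meval x P = 0.
  move=> ar a1 xa; rewrite mevalB mevalC -(vec_mxof x) meval_char_coef.
  have [C C1 HC] := meval_lipschitz (char_coef F n k).
  have C0 : 0 < C := lt_le_trans ltr01 C1.
  apply/eqP; rewrite -[_ == 0]negbK -absv_gt0; apply/negP => d0.
  set d := absv _ in d0.
  pose e := Num.min 1 (d / (2 * C)).
  have e0 : 0 < e by rewrite lt_min ltr01 divr_gt0 // mulr_gt0.
  have [g gU Hg] := conj e e0.
  pose A := invmx g *m mxof x *m g.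
  have A1 i j : absv ((A - 1%:M) i j) <= e by apply: ltW; apply: Hg xa i j.
  have one1 (i j : 'I_n) : absv ((1%:M : 'M[F]_n) i j) <= 1.
    by rewrite mxE; case: (i == j); rewrite ?absv1 ?absv0.
  have [||||_] := HC (vec A) (vec 1%:M) e.
  - exact: ltW.
  - move=> l; rewrite /vec; case/mxvec_indexP: l => i j; rewrite mxvecE.
    have <- : ((A - 1%:M) + 1%:M) i j = A i j by rewrite subrK.
    rewrite mxE.
    by apply: absvD_le => //; apply: le_trans (A1 i j) _; rewrite ge_min lexx.
  - by move=> l; rewrite /vec; case/mxvec_indexP: l => i j; rewrite mxvecE.
  - move=> l; rewrite /vec; case/mxvec_indexP: l => i j; rewrite !mxvecE.
    by have := A1 i j; rewrite mxE [X in _ + X]mxE.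
  rewrite !meval_char_coef char_poly_conj // -/d leNgt => /negP; apply.
  apply: le_lt_trans (_ : C * (d / (2 * C)) < d).
    by rewrite ler_pM2l // ge_min lexx orbT.
  rewrite mulrA ltr_pdivrMr ?mulr_gt0 // mulrA [d * 2]mulrC -mulrA [d * C]mulrC.
  by rewrite ltr_pMl ?mulr_gt0 // ltr1n.
(* The partial sum of order [m.+1] and the curve after m iterations agree modulo ['X^(m.+1)]. *)
have := formal_vanishing B1 psiB rho0 P_vanish m.+1.
rewrite -(subrK (pev (psum curve_coef m.+1) P) (pev (curve _ _ _ _ _) P)) => H.
apply: dvdp_add => //; apply: dvdp_pev_sub => j.
by rewrite psumS curve_psum opprD addrA subrr add0r dvdpNr -mul_polyC dvdp_mull.
Qed.

End CurvesOfRationalPoints.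

Local Open Scope classical_set_scope.

Theorem mainTheorem3 (R : realType) (F : nonArchLocalFieldType R)
    (L : closedFieldType) (iota : {rmorphism F -> L})
    (L_algebraic : forall x : L, algebraicOver iota x)
    (n : nat) (G : linearGroup iota n)
    (G_connected : zariski_connected G) (G_reductive : reductive G)
    (G_nontrivial : geometric_points G <> [set 1%:M])
    (K : set (rational_points G)) (K_compact : compact K)
    (K_open : open_subgroup K) :
  fair K.
Proof.
apply: contrapT => /(not_fair_contraction K_open)[r r0 bad].
apply: G_nontrivial; apply: unipotent_linearGroup_trivial => // A GA.
apply: unipotent_of_char_poly; apply/polyP => k.
have [Z [f Zf]] := pivots_exist iota (geometric_points G).
have [z z_inj] := absv_infinite F.
pose P := char_coef F n k - mpolyC (n * n) (char_poly (1%:M : 'M[F]_n))`_k.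
(* P has coefficients in F and is tested on curves over F only, yet the conclusion concerns all
   L-points of G. *)
have : vanishes (points (geometric_points G)) (map_mpoly iota P).
  apply: (vanishes_of_curves (linearGroup1 G) (@linearGroupM _ _ _ _ G)
    (@linearGroupV _ _ _ _ G) (@linearGroupU _ _ _ _ G) (linearGroup_prime G_connected)
    (@linearGroup_defined _ _ _ _ G) Zf z_inj) => u.
  have [B B1 psiB] := curve_coef_bound Z f u.
  have [rho [rho0 Brho conj]] := contracted_curve G_connected Zf B1 psiB r0 bad.
  exact: (char_coef_curve B1 psiB k rho0 Brho conj).
move=> /(_ (vec A) (ex_intro2 _ _ A GA erefl)).
rewrite rmorphB /= map_mpolyC map_char_coef mevalB mevalC meval_char_coef => /eqP.
by rewrite subr_eq0 -coef_map map_char_poly map_mx1 => /eqP.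
Qed.
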